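(* Let $\alpha$ be an amenable action of a discrete group $G$ on a unital C*-algebra $A$. Let $u\in M^{\rm cb}A(G)$, let $T\in\mathrm{CB}(A)$ be $\alpha$-invariant, and let $F_{T,u}:G\to\mathrm{CB}(A)$ be given by $F_{T,u}(t)(a)=u(t)T(a)$, $a\in A$, $t\in G$. The following hold: (i) $F_{T,u}\in\mathfrak{S}^{\rm inv}(A,G,\alpha)$; (ii) $F_{T,u}\in\mathfrak{S}^{\rm inv}_{\rm cc}(A,G,\alpha)$ if $u\in A_{\rm cb}(G)$ and $T$ is completely compact; (iii) if $u\in A_{\rm cb}(G)$ and $T$ lies in the closure, in the completely bounded norm, of the finite rank maps on $A$, then $S_{F_{T,u}}$ lies in the closure, in the completely bounded norm, of the set of finite rank maps on $A\rtimes_{\alpha,r}G$ of the form $S_F$ with $F\in\mathfrak{S}(A,G,\alpha)$.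
   Context: $G$ is a discrete group, $A\subseteq\mathcal{B}(H)$ a (non-degenerate) C*-algebra, $\alpha:G\to\mathrm{Aut}(A)$ a homomorphism. On $\mathcal{H}=\ell^2(G,H)$ put $(\lambda_t\xi)(s)=\xi(t^{-1}s)$ and $(\pi(a)\xi)(s)=\alpha_{s^{-1}}(a)(\xi(s))$. For $f\in\ell^1(G,A)$ let $\tilde\pi(f)=\sum_{s\in G}\pi(f(s))\lambda_s$; the reduced crossed product $A\rtimes_{\alpha,r}G$ is the norm closure of $\tilde\pi(\ell^1(G,A))$ in $\mathcal{B}(\mathcal{H})$. A bounded map $F:G\to\mathrm{CB}(A)$ is a Herz-Schur $(A,G,\alpha)$-multiplier if the map $S_F:\tilde\pi(f)\mapsto\tilde\pi(F\cdot f)$, where $(F\cdot f)(t)=F(t)(f(t))$, is completely bounded; $S_F$ also denotes its completely bounded extension to $A\rtimes_{\alpha,r}G$. $\mathfrak{S}(A,G,\alpha)$ is the space of all such $F$. A linear map $T:A\to A$ is $\alpha$-invariant if $\alpha_t\circ T=T\circ\alpha_t$ for all $t\in G$. $\mathfrak{S}^{\rm inv}(A,G,\alpha)$ is the set of $F\in\mathfrak{S}(A,G,\alpha)$ with $F(s)$ $\alpha$-invariant for every $s\in G$, and $\mathfrak{S}^{\rm inv}_{\rm cc}(A,G,\alpha)$ is the set of those $F\in \mathfrak{S}^{\rm inv}(A,G,\alpha)$ for which $S_F$ is completely compact. Finite rank maps are understood to be completely bounded. A completely bounded map $\Psi:\mathcal{X}\to\mathcal{Z}$ between operator spaces is completely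 compact if for every $\epsilon>0$ there is a finite dimensional subspace $\mathcal{Y}\subseteq\mathcal{Z}$ such that $\mathrm{dist}(\Psi^{(m)}(x),M_m(\mathcal{Y}))<\epsilon$ for all $m\in\mathbb{N}$ and all $x\in M_m(\mathcal{X})$ with $\|x\|\le1$. The action $\alpha$ on the unital C*-algebra $A$ is amenable if there is a net $(\xi_i)_{i\in\mathbb{I}}$ of finitely supported functions $\xi_i:G\to Z(A)^+$ (positive elements of the centre of $A$) such that $\sum_{t\in G}\xi_i(t)^2=1_A$ for each $i$ and $\left\|\sum_{s\in G}(\xi_i(s)-\alpha_t(\xi_i(t^{-1}s)))^2\right\|\to_{i\in\mathbb{I}}0$ for every $t\in G$. $A(G)$ is the Fourier algebra of $G$ (functions $s\mapsto(\lambda^0_s\xi,\eta)$, with $\lambda^0$ the left regular representation and $\xi,\eta\in\ell^2(G)$), as the operator space predual of the group von Neumann algebra $\mathrm{VN}(G)$. $M^{\rm cb}A(G)$ is the algebra of functions $u:G\to\mathbb{C}$ with $uA(G)\subseteq A(G)$ and $v\mapsto uv$ completely bounded on $A(G)$, with norm $\|u\|_{\rm m}$ equal to the completely bounded norm of the map $\lambda^0(f)\mapsto\lambda^0(uf)$ on $C_r^*(G)$. $A_{\rm cb}(G)$ is the closure of $A(G)$ in $M^{\rm cb}A(G)$ in $\|\cdot\|_{\rm m}$. *)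

(* Defs.v *)
From HB Require Import structures.
From mathcomp Require Import all_boot all_order all_algebra.
From mathcomp Require Import sesquilinear complex finmap.
From mathcomp Require Import all_classical all_reals all_analysis.
Set Implicit Arguments.
Unset Strict Implicit.
Unset Printing Implicit Defensive.
From mathcomp Require Import ring lra.
Import Order.TTheory GRing.Theory Num.Theory ComplexField.Normc.
Import numFieldNormedType.Exports.
Local Open Scope classical_set_scope.
Local Open Scope ring_scope.
Local Open Scope complex_scope.


Definition form_norm (R : realType) (H : lmodType R[i])
    (f : {dot H for (@Num.conj R[i])}) (x : H) : R :=
  Num.sqrt (complex.Re (f x x)).

HB.mixin Record isHilbert (R : realType) H of GRing.Lmodule R[i] H := {
  hform : {dot H for (@Num.conj R[i])};
  hcomplete : forall u : nat -> H,
    (forall e : R, 0 < e -> exists N, forall m n,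
       (N <= m)%N -> (N <= n)%N -> form_norm hform (u m - u n) < e) ->
    exists l, forall e : R, 0 < e -> exists N, forall n,
       (N <= n)%N -> form_norm hform (u n - l) < e
}.

#[short(type="hilbertType")]
HB.structure Definition Hilbert (R : realType) :=
  {H of isHilbert R H & GRing.Lmodule R[i] H}.

(* The inner product is linear in its first argument. *)
Definition hdot (R : realType) (H : hilbertType R) (x y : H) : R[i] :=
  hform x y.

Definition hnorm (R : realType) (H : hilbertType R) (x : H) : R :=
  form_norm hform x.

Section HilbertTheory.
Variables (R : realType) (H : hilbertType R).
Implicit Types (x y z : H) (c : R[i]).

Lemma hdotPl c x y z : hdot (c *: x + y) z = c * hdot x z + hdot y z.
Proof. by rewrite /hdot linearPl. Qed.

Lemma hdotC x y : hdot x y = (hdot y x)^*.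
Proof. by rewrite /hdot hermC /= expr0 mul1r. Qed.

Lemma hdot_ge0 x : 0 <= hdot x x.
Proof. exact: dnorm_ge0. Qed.

Lemma hdot_gt0 x : (0 < hdot x x) = (x != 0).
Proof. exact: dnorm_gt0. Qed.

Lemma hdotPr c x y z : hdot z (c *: x + y) = c^* * hdot z x + hdot z y.
Proof. by rewrite hdotC hdotPl rmorphD rmorphM /= -!hdotC. Qed.

Lemma hnorm_sqr x : hnorm x ^+ 2 = complex.Re (hdot x x).
Proof.
by rewrite sqr_sqrtr//; have := hdot_ge0 x; rewrite lecE => /andP[].
Qed.

Lemma hnorm_ge0 x : 0 <= hnorm x.
Proof. exact: sqrtr_ge0. Qed.

Lemma hdotxx x : hdot x x = (hnorm x ^+ 2)%:C.
Proof.
rewrite hnorm_sqr; have := hdot_ge0 x; rewrite lecE => /andP[/eqP + _] /=.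
by case: (hdot x x) => a b /= ->.
Qed.

Lemma hdotDl x y z : hdot (x + y) z = hdot x z + hdot y z.
Proof. by rewrite -[x in LHS]scale1r hdotPl mul1r. Qed.

Lemma hdotDr x y z : hdot z (x + y) = hdot z x + hdot z y.
Proof. by rewrite -[x in LHS]scale1r hdotPr rmorph1 mul1r. Qed.

Lemma hdot0l x : hdot 0 x = 0.
Proof. by apply: (addrI (hdot 0 x)); rewrite -hdotDl !addr0. Qed.

Lemma hdotZl c x y : hdot (c *: x) y = c * hdot x y.
Proof. by rewrite -[c *: x]addr0 hdotPl hdot0l addr0. Qed.

Lemma hdotZr c x y : hdot x (c *: y) = c^* * hdot x y.
Proof. by rewrite hdotC hdotZl rmorphM /= -hdotC. Qed.

Lemma hnormD_sqr x y :
  hnorm (x + y) ^+ 2 = hnorm x ^+ 2 + hnorm y ^+ 2 + 2 * complex.Re (hdot x y).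
Proof.
rewrite !hnorm_sqr hdotDl !hdotDr [hdot y x]hdotC.
by case: (hdot x x) (hdot x y) (hdot y y) => [a b] [c d] [e f] /=; ring.
Qed.

Lemma hnormZ_sqr c x : hnorm (c *: x) ^+ 2 = normc c ^+ 2 * hnorm x ^+ 2.
Proof.
rewrite [LHS]hnorm_sqr hdotZl hdotZr hdotxx; case: c => a b /=.
by rewrite sqr_sqrtr ?addr_ge0 ?sqr_ge0//; ring.
Qed.

Lemma hnormN_sqr x : hnorm (- x) ^+ 2 = hnorm x ^+ 2.
Proof.
by rewrite -scaleN1r hnormZ_sqr normcN normc1 expr1n mul1r.
Qed.

Lemma hnormD_sqr_le x y :
  hnorm (x + y) ^+ 2 <= 2 * hnorm x ^+ 2 + 2 * hnorm y ^+ 2.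
Proof.
have := sqr_ge0 (hnorm (x - y)).
rewrite !hnormD_sqr hnormN_sqr -scaleN1r hdotZr.
by case: (hdot x y) => a b /=; lra.
Qed.

Lemma normc_hdot_le x y : normc (hdot x y) <= hnorm x ^+ 2 + hnorm y ^+ 2.
Proof.
have re_le z : `|complex.Re (hdot x z)| * 2 <= hnorm x ^+ 2 + hnorm z ^+ 2.
  have := sqr_ge0 (hnorm (x - z)); have := sqr_ge0 (hnorm (x + z)).
  rewrite !hnormD_sqr hnormN_sqr -scaleN1r hdotZr.
  case: (hdot x z) => a b /=; rewrite -[a in `|a|]/a => h1 h2.
  by case: (lerP 0 a) => a0; rewrite ?(ger0_norm a0) ?(ltr0_norm a0); lra.
have := re_le y; have := re_le ('i *: y).
rewrite hdotZr hnormZ_sqr; case: (hdot x y) => a b /=.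
rewrite expr0n add0r expr1n sqrtr1 expr1n mul1r mul0r sub0r mulN1r opprK => hb ha.
apply: (@le_trans _ _ (`|a| + `|b|)); last by lra.
rewrite -(@ler_pXn2r _ 2)// ?nnegrE ?sqrtr_ge0 ?addr_ge0//.
rewrite sqr_sqrtr ?addr_ge0 ?sqr_ge0// sqrrD !real_normK ?num_real//.
by have := mulr_ge0 (normr_ge0 a) (normr_ge0 b); lra.
Qed.

End HilbertTheory.

Definition has_usum (R : realType) (V : zmodType) (nrm : V -> \bar R)
    (I : choiceType) (f : I -> V) (x : V) : Prop :=
  forall e : R, 0 < e -> exists J0 : {fset I}, forall J : {fset I},
    (J0 `<=` J)%fset -> (nrm (x - \sum_(i <- J) f i)%R <= e%:E)%E.

(* [xget 0 P] is a point of [P] if there is one, and 0 otherwise. *)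
Definition usum (R : realType) (V : zmodType) (D : set V) (nrm : V -> \bar R)
    (I : choiceType) (f : I -> V) : V :=
  xget 0 [set x | D x /\ has_usum nrm f x].

Definition csum (R : realType) (I : choiceType) (f : I -> R[i]) : R[i] :=
  usum setT (fun z => (normc z)%:E) f.

Section CsumTheory.
Variables (R : realType) (I : choiceType).
Implicit Types (f g : I -> R[i]) (x y c : R[i]).

Local Notation has_csum := (has_usum (fun z : R[i] => (normc z)%:E)).

Lemma normc_ge0 x : 0 <= normc x.
Proof. by case: x => a b; exact: sqrtr_ge0. Qed.

Lemma has_csum_uniq f x y : has_csum f x -> has_csum f y -> x = y.
Proof.
move=> fx fy; apply/eqP; rewrite -subr_eq0; apply/eqP/eq0_normc/eqP.
rewrite eq_le normc_ge0 andbT; apply/ler_addgt0Pl => e e0; rewrite addr0.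
have e2 : 0 < e / 2 by rewrite divr_gt0.
have [J1 h1] := fx _ e2; have [J2 h2] := fy _ e2.
have := h1 (J1 `|` J2)%fset (fsubsetUl _ _).
have := h2 (J1 `|` J2)%fset (fsubsetUr _ _).
rewrite !lee_fin => k2 k1.
rewrite (_ : x - y = (x - \sum_(i <- (J1 `|` J2)%fset) f i)
  + - (y - \sum_(i <- (J1 `|` J2)%fset) f i)); last by ring.
by apply: le_trans (le_normcD _ _) _; rewrite normcN; lra.
Qed.

Lemma has_csumP f g x y c : has_csum f x -> has_csum g y ->
  has_csum (fun i => c * f i + g i) (c * x + y).
Proof.
move=> fx gy e e0.
have n0 := normc_ge0 c.
have d0 : 0 < e / 2 / (normc c + 1) by rewrite !divr_gt0// ltr_wpDl.
have e2 : 0 < e / 2 by rewrite divr_gt0.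
have [J1 h1] := fx _ d0; have [J2 h2] := gy _ e2.
exists (J1 `|` J2)%fset => J; rewrite fsubUset => /andP[/h1 k1 /h2 k2].
rewrite !lee_fin in k1 k2 *.
rewrite big_split /= -mulr_sumr.
rewrite (_ : _ - _ = c * (x - \sum_(i <- J) f i) + (y - \sum_(i <- J) g i)); last by ring.
apply: le_trans (le_normcD _ _) _; rewrite normcM.
move: k1; rewrite ler_pdivlMr ?ltr_wpDl// => k1.
have := normc_ge0 (x - \sum_(i <- J) f i); nra.
Qed.

Lemma normc_conj x : normc x^* = normc x.
Proof. by case: x => a b /=; rewrite sqrrN. Qed.

Lemma has_csum_conj f x : has_csum f x -> has_csum (fun i => (f i)^*) x^*.
Proof.
move=> fx e e0; have [J0 h] := fx _ e0; exists J0 => J /h.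
by rewrite -raddf_sum -raddfB normc_conj.
Qed.

Lemma has_csum_ge0 (g : I -> R) (K : R) : (forall i, 0 <= g i) ->
  (forall J : {fset I}, \sum_(i <- J) g i <= K) ->
  exists x, has_csum (fun i => (g i)%:C) x.
Proof.
move=> g0 gK; pose S := [set \sum_(i <- J) g i | J in [set: {fset I}]].
have hS : has_sup S.
  split; first by exists (\sum_(i <- fset0) g i), fset0.
  by exists K => _ [J _ <-].
exists (sup S)%:C => e e0.
have [_ [J0 _ <-] hJ] := sup_adherent e0 hS.
exists J0 => J J0J; rewrite lee_fin -raddf_sum -raddfB /= expr0n addr0 sqrtr_sqr.
have le1 : \sum_(i <- J) g i <= sup S by apply: ub_le_sup; [exact: hS.2|exists J].
have le2 : \sum_(i <- J0) g i <= \sum_(i <- J) g i.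
  rewrite [leRHS](big_fsetID _ (mem J0)) /=.
  rewrite (_ : [fset x in J | x \in J0]%fset = J0); last first.
    apply/fsetP => i; rewrite !inE /= andbC; case: (boolP (i \in J0)) => //= iJ0.
    exact: (fsubsetP J0J).
  by rewrite lerDl sumr_ge0.
by rewrite ger0_norm ?subr_ge0//; lra.
Qed.

Lemma has_csum_ex f (K : R) :
  (forall J : {fset I}, \sum_(i <- J) normc (f i) <= K) ->
  exists x, has_csum f x.
Proof.
move=> fK; pose n i := normc (f i).
pose a i := complex.Re (f i) + n i; pose b i := complex.Im (f i) + n i.
have ab i : (0 <= a i /\ a i <= 2 * n i) /\ (0 <= b i /\ b i <= 2 * n i).
  rewrite /a /b /n; case: (f i) => p q /=.
  have := sqrtr_ge0 (p ^+ 2 + q ^+ 2).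
  have := @sqr_sqrtr _ (p ^+ 2 + q ^+ 2).
  rewrite addr_ge0 ?sqr_ge0// => /(_ isT).
  move: (Num.sqrt _) => s ss s0; split; split; nra.
have K2 (g : I -> R) : (forall i, g i <= 2 * n i) ->
    forall J : {fset I}, \sum_(i <- J) g i <= 2 * K.
  move=> gn J; apply: (@le_trans _ _ (\sum_(i <- J) 2 * n i)); first exact: ler_sum.
  by rewrite -mulr_sumr ler_pM2l.
have [x hx] := has_csum_ge0 (fun i => (ab i).1.1) (K2 _ (fun i => (ab i).1.2)).
have [y hy] := has_csum_ge0 (fun i => (ab i).2.1) (K2 _ (fun i => (ab i).2.2)).
have [z hz] := has_csum_ge0 (fun i => normc_ge0 (f i)) fK.
exists ('i * (-1 * z + y) + (-1 * z + x)).
have := has_csumP 'i (has_csumP (-1) hz hy) (has_csumP (-1) hz hx).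
congr has_usum; apply/funext => i; rewrite /a /b /n.
by case: (f i) => p q /=; apply/eqP; rewrite eq_complex /=; apply/andP; split; apply/eqP; ring.
Qed.

Lemma csumE f x : has_csum f x -> csum f = x.
Proof.
move=> fx; rewrite /csum /usum; case: xgetP => [y _ [_ fy]|/(_ x)].
  exact: has_csum_uniq fy fx.
by case; split.
Qed.

Let normc_real_le x (s e : R) : normc (x - s%:C) <= e ->
  [/\ complex.Re x <= s + e, s - e <= complex.Re x & `|complex.Im x| <= e].
Proof.
case: x => a b /=; rewrite oppr0 addr0 => h.
have h1 : `|a - s| <= e.
  by apply: le_trans h; rewrite -sqrtr_sqr ler_wsqrtr// lerDl sqr_ge0.
have h2 : `|b| <= e.
  by apply: le_trans h; rewrite -sqrtr_sqr ler_wsqrtr// lerDr sqr_ge0.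
by move: h1; rewrite ler_norml => /andP[] *; split => //; lra.
Qed.

Lemma sum_le_csum (g : I -> R) x : (forall i, 0 <= g i) ->
  has_csum (fun i => (g i)%:C) x ->
  forall J : {fset I}, \sum_(i <- J) g i <= complex.Re x.
Proof.
move=> g0 gx J; apply/ler_addgt0Pl => e /gx[J0].
move=> /(_ (J `|` J0)%fset (fsubsetUr _ _)).
rewrite lee_fin -raddf_sum => /normc_real_le[_ + _]; rewrite lerBlDl.
apply: le_trans; rewrite [leRHS](big_fsetID _ (mem J)) /=.
rewrite (_ : [fset i in (J `|` J0) | i \in J]%fset = J); last first.
  by apply/fsetP => i; rewrite !inE /= andbC; case: (i \in J).
by rewrite lerDl sumr_ge0.
Qed.

Lemma csum_le_sum (g : I -> R) x K :
  (forall J : {fset I}, \sum_(i <- J) g i <= K) ->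
  has_csum (fun i => (g i)%:C) x -> complex.Im x = 0 /\ complex.Re x <= K.
Proof.
move=> gK gx; split; last first.
  apply/ler_addgt0Pr => e /gx[J0] /(_ J0 (fsubset_refl _)).
  rewrite lee_fin -raddf_sum => /normc_real_le[h _ _].
  by apply: le_trans h _; rewrite lerD2r.
apply/eqP; rewrite -normr_eq0 eq_le normr_ge0 andbT.
apply/ler_addgt0Pr => e /gx[J0] /(_ J0 (fsubset_refl _)).
by rewrite lee_fin -raddf_sum add0r => /normc_real_le[].
Qed.

End CsumTheory.

Section L2.
Variables (R : realType) (I : choiceType) (H : hilbertType R).

Definition square_summable : {pred I -> H} := fun f =>
  `[< (\esum_(i in [set: I]) (hnorm (f i) ^+ 2)%:E < +oo)%E >].

Lemma square_summableP f : reflect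
  (exists K : R, forall J : {fset I}, \sum_(i <- J) hnorm (f i) ^+ 2 <= K)
  (f \in square_summable).
Proof.
apply: (iffP idP) => [/asboolP|[K hK]].
  set s := esum _ _ => soo; exists (fine s) => J.
  rewrite -lee_fin fineK; last first.
    by rewrite ge0_fin_numE// esum_ge0// => i _; rewrite lee_fin sqr_ge0.
  apply: esum_ge; exists [set` J]; first by split.
  by rewrite -fsbig_seq ?fset_uniq// sumEFin.
apply/asboolP/(@le_lt_trans _ _ K%:E); last exact: ltry.
apply: ge_ereal_sup => _ [X [finX _] <-].
by rewrite fsbig_finite// sumEFin lee_fin.
Qed.

Fact square_summable_submod : submod_closed square_summable.
Proof.
split=> [|c f g /square_summableP[K hK] /square_summableP[L hL]].
  apply/square_summableP; exists 0 => J; rewrite big1// => i _.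
  by rewrite hnorm_sqr hdot0l.
apply/square_summableP; exists (2 * (normc c ^+ 2 * K) + 2 * L) => J.
apply: (@le_trans _ _ (\sum_(i <- J) (2 * (normc c ^+ 2 * hnorm (f i) ^+ 2) +
    2 * hnorm (g i) ^+ 2))).
  by apply: ler_sum => i _; rewrite -hnormZ_sqr; exact: hnormD_sqr_le.
rewrite big_split /= -!mulr_sumr lerD// ler_pM2l// ler_wpM2l//.
by rewrite sqr_ge0.
Qed.

HB.instance Definition _ :=
  GRing.isSubmodClosed.Build R[i] (I -> H) square_summable
    square_summable_submod.

Record l2 := L2 { l2val :> I -> H; _ : l2val \in square_summable }.

HB.instance Definition _ := [isSub for l2val].
HB.instance Definition _ := [Choice of l2 by <:].
HB.instance Definition _ := [SubChoice_isSubLmodule of l2 by <:].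

(* The element of [l2] with values [f], or 0 if [f] is not square summable. *)
Definition mkl2 (f : I -> H) : l2 := insubd 0 f.

Definition l2dot (x y : l2) : R[i] := csum (fun i => hdot (x i) (y i)).

Local Notation has_csum := (has_usum (fun z : R[i] => (normc z)%:E)).

Lemma l2dotP (x y : l2) : has_csum (fun i => hdot (x i) (y i)) (l2dot x y).
Proof.
have /square_summableP[K hK] : l2val x \in square_summable by case: (x).
have /square_summableP[L hL] : l2val y \in square_summable by case: (y).
have [|z hz] := @has_csum_ex _ _ (fun i => hdot (x i) (y i)) (K + L).
  move=> J; apply: le_trans (lerD (hK J) (hL J)); rewrite -big_split /=.
  by apply: ler_sum => i _; exact: normc_hdot_le.
by rewrite /l2dot (csumE hz).
Qed.

Let l2dotPl y : scalar (l2dot ^~ y).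
Proof.
move=> c x z; apply: csumE.
have := has_csumP c (l2dotP x y) (l2dotP z y).
by congr has_usum; apply/funext => i /=; rewrite hdotPl.
Qed.

Let l2dotC x y : l2dot x y = (-1) ^+ false * (l2dot y x)^*.
Proof.
rewrite expr0 mul1r; apply: csumE.
have := has_csum_conj (l2dotP y x).
by congr has_usum; apply/funext => i; rewrite -hdotC.
Qed.

Let l2dot_bilinear :
  bilinear_for *%R (@Num.conj R[i] \; *%R) l2dot.
Proof.
split=> [y|x c y z]; first exact: l2dotPl.
rewrite l2dotC expr0 mul1r l2dotPl rmorphD rmorphM /=.
by rewrite [l2dot x y]l2dotC [l2dot x z]l2dotC !expr0 !mul1r.
Qed.

Let l2dotxx (x : l2) : has_csum (fun i => (hnorm (x i) ^+ 2)%:C) (l2dot x x).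
Proof.
by have := l2dotP x x; congr has_usum; apply/funext => i; rewrite hdotxx.
Qed.

Let sum_le_l2dot (x : l2) (J : {fset I}) :
  \sum_(i <- J) hnorm (x i) ^+ 2 <= complex.Re (l2dot x x).
Proof. by apply: sum_le_csum (l2dotxx x) J => i; exact: sqr_ge0. Qed.

Let l2dot_gt0 (x : l2) : x != 0 -> 0 < l2dot x x.
Proof.
move=> x0; have x2 : l2val x \in square_summable by case: (x).
have [K hK] := square_summableP _ x2.
rewrite ltcE (csum_le_sum hK (l2dotxx x)).1 eqxx /=.
have [i xi] : exists i, x i != 0.
  apply: contrapT => /forallNP xi0; move/eqP: x0; apply; apply/val_inj/funext => i.
  by apply/eqP/negPn/negP; exact: xi0.
apply: lt_le_trans (sum_le_l2dot x [fset i]%fset).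
rewrite big_seq_fset1 hnorm_sqr.
by have := xi; rewrite -hdot_gt0 ltcE => /andP[].
Qed.

HB.instance Definition _ := bilinear_isBilinear.Build R[i] l2 l2 R[i]
  *%R (@Num.conj R[i] \; *%R) l2dot l2dot_bilinear.
HB.instance Definition _ := isHermitianSesquilinear.Build R[i] l2 false
  (@Num.conj R[i]) l2dot l2dotC.
HB.instance Definition _ := isDotProduct.Build R[i] l2 l2dot l2dot_gt0.

Definition l2form : {dot l2 for (@Num.conj R[i])} := l2dot.

Let hnorm_le_l2 (x : l2) (e : R) : 0 < e -> form_norm l2form x < e ->
  forall J : {fset I}, \sum_(i <- J) hnorm (x i) ^+ 2 <= e ^+ 2.
Proof.
move=> e0 xe J; apply: le_trans (sum_le_l2dot x J) _.
move: xe; rewrite /form_norm /= => /ltW.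
rewrite -(@ler_pXn2r _ 2)// ?nnegrE ?sqrtr_ge0 ?(ltW e0)//.
by rewrite sqr_sqrtr// (le_trans _ (sum_le_l2dot x fset0))// big_seq_fset0.
Qed.

Let l2_complete (u : nat -> l2) :
  (forall e : R, 0 < e -> exists N, forall m n,
     (N <= m)%N -> (N <= n)%N -> form_norm l2form (u m - u n) < e) ->
  exists l, forall e : R, 0 < e -> exists N, forall n,
     (N <= n)%N -> form_norm l2form (u n - l) < e.
Proof.
move=> uC.
have uCJ (e : R) : 0 < e -> exists N, forall m n, (N <= m)%N -> (N <= n)%N ->
    forall J : {fset I}, \sum_(i <- J) hnorm (u m i - u n i) ^+ 2 <= e ^+ 2.
  move=> e0; have [N hN] := uC _ e0; exists N => m n Nm Nn.
  exact: hnorm_le_l2 e0 (hN _ _ Nm Nn).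
have uCi i : exists l : H, forall e : R, 0 < e -> exists N, forall n,
    (N <= n)%N -> hnorm (u n i - l) < e.
  apply: (@hcomplete R H (fun n => u n i)) => e e0.
  have e2 : 0 < e / 2 by rewrite divr_gt0.
  have [N hN] := uCJ _ e2; exists N => m n Nm Nn.
  have := hN _ _ Nm Nn [fset i]%fset; rewrite big_seq_fset1.
  rewrite ler_pXn2r// ?nnegrE ?hnorm_ge0 ?(ltW e2)// => h.
  by apply: le_lt_trans h _; lra.
have [l hl] := choice uCi.
have ulJ (s : seq I) (d : R) : 0 < d -> exists M, forall m, (M <= m)%N ->
    \sum_(i <- s) hnorm (u m i - l i) ^+ 2 <= d.
  elim: s d => [|i s IH] d d0; first by exists 0%N => m _; rewrite big_nil ltW.
  have d2 : 0 < d / 2 by rewrite divr_gt0.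
  have [M1 h1] := IH _ d2.
  have [M2 h2] := hl i (Num.sqrt (d / 2)) (ltac:(by rewrite sqrtr_gt0)).
  exists (maxn M1 M2) => m; rewrite geq_max => /andP[/h1 k1 /h2 /ltW k2].
  rewrite big_cons; move: k2.
  rewrite -(@ler_pXn2r _ 2)// ?nnegrE ?sqrtr_ge0 ?hnorm_ge0//.
  by rewrite [Num.sqrt (d / 2) ^+ 2]sqr_sqrtr ?(ltW d2)// => k2; rewrite [leRHS]splitr; exact: lerD.
have close (e : R) : 0 < e -> exists N, forall n, (N <= n)%N ->
    forall J : {fset I}, \sum_(i <- J) hnorm (u n i - l i) ^+ 2 <= e ^+ 2.
  move=> e0; have e2 : 0 < e / 2 by rewrite divr_gt0.
  have [N hN] := uCJ _ e2; exists N => n Nn J.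
  have [M hM] := ulJ J (e ^+ 2 / 8) (ltac:(by rewrite divr_gt0// exprn_gt0)).
  pose m := maxn N M.
  apply: (@le_trans _ _ (\sum_(i <- J) (2 * hnorm (u n i - u m i) ^+ 2 +
      2 * hnorm (u m i - l i) ^+ 2))).
    apply: ler_sum => i _.
    by rewrite -[X in hnorm X](@subrKA _ (u m i)) hnormD_sqr_le.
  rewrite big_split /= -!mulr_sumr.
  have := hM m (leq_maxr _ _); have := hN n m Nn (leq_maxl _ _) J.
  have := sqr_ge0 e; rewrite expr_div_n; lra.
have [N0 hN0] := close 1 ltr01.
have l2l : l \in square_summable.
  have -> : l = l2val (u N0) - (l2val (u N0) - l) by rewrite opprB addrC subrK.
  apply: rpredB; first by case: (u N0).
  by apply/square_summableP; exists (1 ^+ 2) => J; exact: hN0.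
exists (L2 l2l) => e e0; have e2 : 0 < e / 2 by rewrite divr_gt0.
have [N hN] := close _ e2; exists N => n Nn.
have [im0 re_le] := csum_le_sum (hN _ Nn) (l2dotxx (u n - L2 l2l)).
rewrite /form_norm /= -(@ltr_pXn2r _ 2)// ?nnegrE ?sqrtr_ge0 ?(ltW e0)//.
rewrite sqr_sqrtr; last first.
  by rewrite (le_trans _ (sum_le_l2dot _ fset0))// big_seq_fset0.
by apply: le_lt_trans re_le _; rewrite ltr_pXn2r// ?nnegrE ?ltW//; lra.
Qed.

HB.instance Definition _ := isHilbert.Build R l2 l2_complete.

Lemma l2_hdotE (x y : l2) : hdot x y = csum (fun i => hdot (x i) (y i)).
Proof. by []. Qed.

Lemma mkl2E (f : I -> H) : f \in square_summable -> l2val (mkl2 f) = f.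
Proof. by move=> f2; rewrite /mkl2 insubdK. Qed.

End L2.

Section Scalar.
Variable R : realType.
Local Notation C := (R[i]^o).

Definition cdot (x y : C) : R[i] := (x : R[i]) * (y : R[i])^*.

Let cdot_bilinear : bilinear_for *%R (@Num.conj R[i] \; *%R) cdot.
Proof.
split=> [y c x z|x c y z]; rewrite /cdot /=; first by rewrite mulrDl mulrA.
by rewrite rmorphD rmorphM /= mulrDr mulrCA.
Qed.

Let cdotC x y : cdot x y = (-1) ^+ false * (cdot y x)^*.
Proof. by rewrite /cdot expr0 mul1r rmorphM /= conjCK mulrC. Qed.

Let cdot_gt0 (x : C) : x != 0 -> 0 < cdot x x.
Proof. by move=> x0; rewrite /cdot -sqr_normc exprn_gt0// normr_gt0. Qed.

HB.instance Definition _ := bilinear_isBilinear.Build R[i] C C R[i]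
  *%R (@Num.conj R[i] \; *%R) cdot cdot_bilinear.
HB.instance Definition _ := isHermitianSesquilinear.Build R[i] C false
  (@Num.conj R[i]) cdot cdotC.
HB.instance Definition _ := isDotProduct.Build R[i] C cdot cdot_gt0.

Definition cform : {dot C for (@Num.conj R[i])} := cdot.

Let cform_norm (x : C) : form_norm cform x = normc (x : R[i]).
Proof.
rewrite /form_norm /= /cdot; case: (x : R[i]) => a b /=.
by rewrite mulrN opprK -!expr2.
Qed.

Let real_complete (v : nat -> R) :
  (forall e : R, 0 < e -> exists N, forall m n,
     (N <= m)%N -> (N <= n)%N -> `|v m - v n| < e) ->
  exists l, forall e : R, 0 < e -> exists N, forall n,
     (N <= n)%N -> `|v n - l| < e.
Proof.
move=> vC; have : cvgn v.
  apply: cauchy_cvg; apply/cauchy_exP => e e0; have [N hN] := vC _ e0.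
  by exists (v N), N => // n /= Nn; exact: hN.
move=> /cvg_ex[l /cvgrPdist_lt vl]; exists l => e /vl[N _ hN].
by exists N => n /hN /=; rewrite distrC.
Qed.

Let c_complete (u : nat -> C) :
  (forall e : R, 0 < e -> exists N, forall m n,
     (N <= m)%N -> (N <= n)%N -> form_norm cform (u m - u n) < e) ->
  exists l, forall e : R, 0 < e -> exists N, forall n,
     (N <= n)%N -> form_norm cform (u n - l) < e.
Proof.
move=> uC.
have [|a ha] := real_complete (v := fun n => complex.Re (u n)).
  move=> e /uC[N hN]; exists N => m n Nm Nn; apply: le_lt_trans (hN _ _ Nm Nn).
  rewrite cform_norm; case: (u m) (u n) => [x y] [z t] /=.
  by rewrite -sqrtr_sqr ler_wsqrtr// lerDl sqr_ge0.
have [|b hb] := real_complete (v := fun n => complex.Im (u n)).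
  move=> e /uC[N hN]; exists N => m n Nm Nn; apply: le_lt_trans (hN _ _ Nm Nn).
  rewrite cform_norm; case: (u m) (u n) => [x y] [z t] /=.
  by rewrite -sqrtr_sqr ler_wsqrtr// lerDr sqr_ge0.
exists (a +i* b) => e e0; have e2 : 0 < e / 2 by rewrite divr_gt0.
have [N1 h1] := ha _ e2; have [N2 h2] := hb _ e2.
exists (maxn N1 N2) => n; rewrite geq_max => /andP[/h1 + /h2].
rewrite cform_norm; case: (u n) => x y /= k1 k2.
rewrite -(@ltr_pXn2r _ 2)// ?nnegrE ?sqrtr_ge0 ?(ltW e0)//.
rewrite sqr_sqrtr ?addr_ge0 ?sqr_ge0//.
rewrite -(real_normK (num_real (x - a))) -(real_normK (num_real (y - b))).
have := normr_ge0 (x - a); have := normr_ge0 (y - b); nra.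
Qed.

HB.instance Definition _ := isHilbert.Build R C c_complete.

Lemma scalar_hdotE (x y : C) : hdot x y = (x : R[i]) * (y : R[i])^*.
Proof. by []. Qed.

End Scalar.

Section Operators.
Variable R : realType.
Implicit Types H : hilbertType R.

Definition opnorm H (X : H -> H) : \bar R :=
  ereal_sup [set (hnorm (X x))%:E | x in [set x | hnorm x <= 1]].

Definition bounded_op H : set (H -> H) :=
  [set X | linear X /\ (opnorm X < +oo)%E].

Definition is_adjoint H (X Y : H -> H) : Prop :=
  forall x y, hdot (X x) y = hdot x (Y y).

Definition positive_op H (X : H -> H) : Prop := forall x, 0 <= hdot (X x) x.

Definition norm_closure H (S : set (H -> H)) : set (H -> H) :=
  [set X | bounded_op X /\
    forall e : R, 0 < e -> exists2 Y, S Y & (opnorm (X - Y)%R < e%:E)%E].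

Definition lspan (V : lmodType R[i]) (S : set V) : set V :=
  [set y | exists n (c : 'I_n -> R[i]) (x : 'I_n -> V),
    (forall k, S (x k)) /\ y = \sum_k c k *: x k].

Definition finite_dim (V : lmodType R[i]) (Y : set V) : Prop :=
  exists n (b : 'I_n -> V), Y = lspan (range b).

Definition linear_on (V W : lmodType R[i]) (X : set V) (T : V -> W) : Prop :=
  forall c x y, X x -> X y -> T (c *: x + y) = c *: T x + T y.

(* Square matrices over an operator space are functions of two indices. A
   matrix of operators on [H] has its norm as an operator on the Hilbert sum
   of copies of [H] indexed by [I]. *)
Definition mxnorm H (I : finType) (x : I -> I -> H -> H) : \bar R :=
  ereal_sup [set (Num.sqrt (\sum_i hnorm (\sum_j x i j (v j)) ^+ 2))%:E |
    v in [set v : I -> H | \sum_j hnorm (v j) ^+ 2 <= 1]].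

Definition mx_over (V : Type) (X : set V) n : set ('I_n -> 'I_n -> V) :=
  [set x | forall i j, X (x i j)].

Definition mxnorms (V : Type) : Type := forall n, ('I_n -> 'I_n -> V) -> \bar R.

Definition op_mxnorms H : mxnorms (H -> H) := fun n x => mxnorm x.

(* The completely bounded norm of the restriction of [T] to [X], with respect
   to given matrix norms on the domain and on the codomain. *)
Definition cbnorm (V W : Type) (nV : mxnorms V) (nW : mxnorms W) (X : set V)
    (T : V -> W) : \bar R :=
  ereal_sup [set r | exists n (x : 'I_n -> 'I_n -> V),
    [/\ mx_over X x, (nV n x <= 1)%E & r = nW n (fun i j => T (x i j))]].

Definition op_cbnorm H : set (H -> H) -> ((H -> H) -> H -> H) -> \bar R :=
  cbnorm (@op_mxnorms H) (@op_mxnorms H).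

(* Maps between operator spaces X and Z in B(H) are functions on all of
   [H -> H] whose values outside X are irrelevant. *)
Definition cb_map H (X Z : set (H -> H)) (T : (H -> H) -> H -> H) : Prop :=
  [/\ linear_on X T, (forall x, X x -> Z (T x)) & (op_cbnorm X T < +oo)%E].

Definition finite_rank H (X Z : set (H -> H)) (T : (H -> H) -> H -> H) : Prop :=
  cb_map X Z T /\ exists2 Y, finite_dim Y & forall x, X x -> Y (T x).

Definition mxdist H n (x : 'I_n -> 'I_n -> H -> H) (Y : set (H -> H)) : \bar R :=
  ereal_inf [set mxnorm (fun i j => x i j - y i j) | y in @mx_over _ Y n].

Definition completely_compact H (X Z : set (H -> H))
    (T : (H -> H) -> H -> H) : Prop :=
  cb_map X Z T /\
  forall e : R, 0 < e -> exists Y : set (H -> H),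
    [/\ finite_dim Y, Y `<=` Z &
        forall n (x : 'I_n -> 'I_n -> H -> H), mx_over X x ->
          (mxnorm x <= 1)%E -> (mxdist (fun i j => T (x i j)) Y < e%:E)%E].

Record cstar_algebra H (A : set (H -> H)) : Prop := CstarAlgebra {
  cstar_bounded : A `<=` @bounded_op H;
  cstar0 : A 0;
  cstarP : forall c a b, A a -> A b -> A (c *: a + b);
  cstarM : forall a b, A a -> A b -> A (a \o b);
  cstar_adjoint : forall a, A a -> exists2 b, A b & is_adjoint a b;
  cstar_closed : norm_closure A `<=` A
}.

Definition nondegenerate_on H (A : set (H -> H)) : Prop :=
  forall (x : H) (e : R), 0 < e ->
    exists n (a : 'I_n -> H -> H) (y : 'I_n -> H),
      (forall k, A (a k)) /\ hnorm (x - \sum_k a k (y k)) < e.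

Definition unit_of H (A : set (H -> H)) (one : H -> H) : Prop :=
  A one /\ forall a, A a -> one \o a = a /\ a \o one = a.

Definition centre H (A : set (H -> H)) : set (H -> H) :=
  [set z | A z /\ forall a, A a -> z \o a = a \o z].

Record star_automorphism H (A : set (H -> H)) (phi : (H -> H) -> H -> H) :
    Prop := StarAutomorphism {
  saut_bij : set_bij A A phi;
  saut_linear : linear_on A phi;
  sautM : forall a b, A a -> A b -> phi (a \o b) = phi a \o phi b;
  saut_adjoint : forall a b, A a -> A b ->
    is_adjoint a b -> is_adjoint (phi a) (phi b)
}.

End Operators.

Section CrossedProduct.
Variables (R : realType) (G : groupType) (H : hilbertType R).
Variables (A : set (H -> H)) (alpha : G -> (H -> H) -> H -> H).

Definition action_on : Prop :=
  (forall t, star_automorphism A (alpha t)) /\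
  forall s t a, A a -> alpha (s * t)%g a = alpha s (alpha t a).

(* Amenability of the action, [one] being the unit of [A]; the net [xi] is
   indexed by the directed set [(I, le)]. *)
Definition amenable_action (one : H -> H) : Prop :=
  exists (I : Type) (le : I -> I -> Prop) (xi : I -> G -> H -> H),
    [/\ [/\ inhabited I, (forall i, le i i),
            (forall i j k, le i j -> le j k -> le i k) &
            (forall i j, exists k, le i k /\ le j k)],
        (forall i, finite_set [set t | xi i t <> 0]),
        (forall i t, centre A (xi i t) /\ positive_op (xi i t)),
        (forall i, \sum_(t \in [set: G]) (xi i t \o xi i t) = one) &
        forall t (e : R), 0 < e -> exists i0, forall i, le i0 i ->
          (opnorm (\sum_(s \in [set: G])
             (let d := xi i s - alpha t (xi i (t^-1 * s)%g) in d \o d))%R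
           < e%:E)%E].

Definition alpha_invariant (T : (H -> H) -> H -> H) : Prop :=
  forall t a, A a -> alpha t (T a) = T (alpha t a).

Definition lambda_shift (t : G) (x : l2 G H) : l2 G H :=
  mkl2 (fun s => x (t^-1 * s)%g).

Definition pi_rep (a : H -> H) (x : l2 G H) : l2 G H :=
  mkl2 (fun s => alpha s^-1%g a (x s)).

Definition l1A : set (G -> H -> H) :=
  [set f | (forall s, A (f s)) /\
           (\esum_(s in [set: G]) opnorm (f s) < +oo)%E].

Definition trep (f : G -> H -> H) : l2 G H -> l2 G H :=
  usum (@bounded_op R (l2 G H)) (@opnorm R (l2 G H))
    (fun s => pi_rep (f s) \o lambda_shift s).

Definition crossed_product : set (l2 G H -> l2 G H) :=
  norm_closure (trep @` l1A).

Definition mulF (F : G -> (H -> H) -> H -> H) (f : G -> H -> H) : G -> H -> H :=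
  fun t => F t (f t).

Definition trep_mxnorms : mxnorms R (G -> H -> H) :=
  fun n f => mxnorm (fun i j => trep (f i j)).

(* The last condition is the complete boundedness of trep f |-> trep (F . f),
   with matrices over trep (l1(G, A)) represented by matrices over l1(G, A). *)
Definition HS_multiplier : set (G -> (H -> H) -> H -> H) :=
  [set F | [/\ (forall t, cb_map A A (F t)),
               (exists K : R, forall t, (op_cbnorm A (F t) <= K%:E)%E) &
               (cbnorm trep_mxnorms trep_mxnorms l1A (mulF F) < +oo)%E]].

(* The completely bounded extension of trep f |-> trep (F . f) to the reduced
   crossed product. *)
Definition HS_map (F : G -> (H -> H) -> H -> H) :
    (l2 G H -> l2 G H) -> l2 G H -> l2 G H :=
  xget 0 [set S | cb_map crossed_product crossed_product S /\
                  forall f, l1A f -> S (trep f) = trep (mulF F f)].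

Definition HS_inv : set (G -> (H -> H) -> H -> H) :=
  [set F | HS_multiplier F /\ forall s, alpha_invariant (F s)].

Definition HS_inv_cc : set (G -> (H -> H) -> H -> H) :=
  [set F | HS_inv F /\
           completely_compact crossed_product crossed_product (HS_map F)].

End CrossedProduct.

Section FourierAlgebra.
Variables (R : realType) (G : groupType).
Local Notation L2 := (l2 G (R[i]^o)).
Implicit Types (u v : G -> R[i]).

Definition lambda0 : G -> L2 -> L2 := @lambda_shift R G (R[i]^o).

Definition coeff (x y : L2) : G -> R[i] := fun s => hdot (lambda0 s x) y.

Definition fourier_algebra : set (G -> R[i]) :=
  [set v | exists x y, v = coeff x y].

(* VN(G): the closure of the span of lambda0 in the weak operator topology. *)
Definition group_vN : set (L2 -> L2) :=
  [set X | bounded_op X /\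
    forall n (x y : 'I_n -> L2) (e : R), 0 < e ->
      exists2 Y, lspan (range lambda0) Y &
        forall k, normc (hdot (X (x k) - Y (x k)) (y k)) < e].

(* The duality between A(G) and VN(G); the value does not depend on the
   vectors representing [v]. *)
Definition pairing v (X : L2 -> L2) : R[i] :=
  xget 0 [set c | exists x y, v = coeff x y /\ c = hdot (X x) y].

(* The norm of M_n(A(G)), embedded in CB(VN(G), M_n). *)
Definition fourier_mxnorms : mxnorms R (G -> R[i]) := fun n w =>
  ereal_sup [set r | exists m (X : 'I_m -> 'I_m -> L2 -> L2),
    [/\ mx_over group_vN X, (mxnorm X <= 1)%E &
        r = mxnorm (fun (p q : 'I_n * 'I_m) (z : R[i]^o) =>
              (pairing (w p.1 q.1) (X p.2 q.2) *: z))]].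

Definition mulu u v : G -> R[i] := fun s => u s * v s.

Definition McbA : set (G -> R[i]) :=
  [set u | (forall v, fourier_algebra v -> fourier_algebra (mulu u v)) /\
    (cbnorm fourier_mxnorms fourier_mxnorms fourier_algebra (mulu u)
     < +oo)%E].

Definition l1C : set (G -> R[i]) :=
  [set f | (\esum_(s in [set: G]) (normc (f s))%:E < +oo)%E].

Definition lambda0_sum (f : G -> R[i]) : L2 -> L2 :=
  usum (@bounded_op R L2) (@opnorm R L2) (fun s => f s *: lambda0 s).

Definition lambda0_mxnorms : mxnorms R (G -> R[i]) :=
  fun n f => mxnorm (fun i j => lambda0_sum (f i j)).

(* The completely bounded norm of lambda0 f |-> lambda0 (u f), computed on the
   dense subspace lambda0 (l1(G)) of the reduced group C*-algebra. *)
Definition cb_multiplier_norm u : \bar R :=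
  cbnorm lambda0_mxnorms lambda0_mxnorms l1C (mulu u).

Definition AcbG : set (G -> R[i]) :=
  [set u | McbA u /\ forall e : R, 0 < e -> exists2 v, fourier_algebra v &
    (cb_multiplier_norm (fun s => u s - v s)%R < e%:E)%E].

End FourierAlgebra.

Definition FTu (R : realType) (G : groupType) (H : hilbertType R)
    (T : (H -> H) -> H -> H) (u : G -> R[i]) : G -> (H -> H) -> H -> H :=
  fun t a => u t *: T a.

(* Main.v *)
(* An element X of the reduced crossed product is a G x G matrix with entries
   X_{s,t} = alpha_{s^-1}(a_{s t^-1}), where a_r in A is its r-th Fourier
   coefficient; its norm, and that of a matrix over the crossed product, is the
   supremum of the norms of the finite sections.  For alpha-invariant T, the
   map S_F with F = F_{T,u} acts on sections as T applied entrywise followed by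
   Schur multiplication by u(s t^-1).  The latter is bounded as soon as u is a
   completely bounded multiplier, because the matrix [a_ij lambda_{s_i s_j^-1}]
   is unitarily equivalent to [a_ij (x) 1].  This gives (i).  For (ii) and (iii),
   u in A_cb(G) is approximated in the Schur norm by finitely supported v, being
   a limit of coefficients of finitely supported vectors; then S_F becomes the
   finite sum of the maps X |-> v(r) pi(T(a_r)) lambda_r, each of which inherits
   complete compactness, or approximability by finite rank maps, from T.  Here
   pi is completely contractive because *-automorphisms are, which is proved by
   extracting a square root of 1 - a* a. *)

Require Import Defs.
From mathcomp Require Import all_boot all_order all_algebra.
From mathcomp Require Import complex finmap.
From mathcomp Require Import all_classical all_reals all_analysis.
From mathcomp Require Import ring lra.
Import Order.TTheory GRing.Theory Num.Theory.
Import ComplexField.Normc.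
Import numFieldNormedType.Exports.
Local Open Scope classical_set_scope.
Local Open Scope ring_scope.
Local Open Scope complex_scope.
Set Implicit Arguments.
Unset Strict Implicit.
Unset Printing Implicit Defensive.

(** * Bounded operators on a Hilbert space *)

(** The norms of the statement are extended real suprema over matrices indexed by ordinals. The
    proof works with explicit real bounds and arbitrary finite index types ([opbd], [mxbd], [cbbd]),
    because the indices that occur are products of a matrix index with a group element or with a
    basis vector.

    [HS_map] is a choice among completely bounded extensions, so a formula for it can only come from
    exhibiting a candidate and using density of the image of [trep]. Candidates are specified by
    their Fourier coefficients, which determine an element of the crossed product.

    Multipliers carry two norms: membership in [McbA] refers to A(G) and its duality with VN(G),
    closeness in [AcbG] to the reduced group algebra. Both are translated into the single notion
    [schur_bd].

    Hence u is replaced by a finitely supported v while the invariant T is still in place. The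
    passage from T to T' is then paid for by the sum of the |v(r)|, which is finite whatever T'
    is. *)

Section HilbertNorm.
Variables (R : realType) (H : hilbertType R).
Implicit Types (x y z : H) (c : R[i]).

Lemma hnorm_unsquare (a b : R) : 0 <= a -> 0 <= b -> (a ^+ 2 <= b ^+ 2) = (a <= b).
Proof. by move=> a0 b0; rewrite ler_pXn2r. Qed.

Lemma hnormZ c x : hnorm (c *: x) = normc c * hnorm x.
Proof.
apply/eqP; rewrite -(@eqrXn2 _ 2)// ?mulr_ge0 ?hnorm_ge0 ?normc_ge0//.
by rewrite hnormZ_sqr exprMn.
Qed.

Lemma hnorm0 : hnorm (0 : H) = 0.
Proof. by rewrite -(scale0r (0 : H)) hnormZ normc0 mul0r. Qed.

Lemma hnormN x : hnorm (- x) = hnorm x.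
Proof. by rewrite -scaleN1r hnormZ normcN normc1 mul1r. Qed.

Lemma hnorm_eq0 x : hnorm x = 0 -> x = 0.
Proof.
move=> x0; apply/eqP; apply: contraT; rewrite -hdot_gt0 hdotxx x0 expr0n.
by rewrite ltxx.
Qed.

Lemma normc_sqr c : (normc c ^+ 2)%:C = c * c^*.
Proof.
case: c => a b; rewrite /= sqr_sqrtr ?addr_ge0 ?sqr_ge0//.
by apply/eqP; rewrite eq_complex /=; apply/andP; split; apply/eqP; ring.
Qed.

Lemma normc_hdot_CS x y : normc (hdot x y) <= hnorm x * hnorm y.
Proof.
have [->|y0] := eqVneq y 0.
  by rewrite hdotC hdot0l rmorph0 normc0 mulr_ge0 ?hnorm_ge0.
have ny : 0 < hnorm y.
  rewrite lt_neqAle hnorm_ge0 andbT eq_sym; apply/eqP => /hnorm_eq0 h.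
  by rewrite h eqxx in y0.
set w := hdot x y.
(* With this [t], the vector [x + (t w) y] is the component of [x] orthogonal to [y]. *)
pose t : R := - (hnorm y ^+ 2)^-1.
have := sqr_ge0 (hnorm (x + (t%:C * w) *: y)).
rewrite hnormD_sqr hnormZ_sqr hdotZr rmorphM /= -/w.
have -> : complex.Re (conjc t%:C * conjc w * w) = t * normc w ^+ 2.
  have -> : conjc t%:C * conjc w * w = (t * normc w ^+ 2)%:C.
    rewrite conjc_real -mulrA [_^* * w]mulrC -[w * w^*](normc_sqr w).
    by rewrite -rmorphM.
  by [].
have -> : normc (t%:C * w) ^+ 2 = t ^+ 2 * normc w ^+ 2.
  rewrite normcM exprMn; congr (_ * _).
  by rewrite /= expr0n addr0 sqr_sqrtr// sqr_ge0.
move=> h.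
rewrite -hnorm_unsquare ?normc_ge0 ?mulr_ge0 ?hnorm_ge0// exprMn.
have e1 : t * hnorm y ^+ 2 = -1 by rewrite /t mulNr mulVf// expf_neq0// gt_eqF.
have y2 : 0 < hnorm y ^+ 2 by rewrite exprn_gt0.
have h2 : 0 <= hnorm y ^+ 2 * (hnorm x ^+ 2 + t ^+ 2 * normc w ^+ 2 * hnorm y ^+ 2 +
  2 * (t * normc w ^+ 2)) by rewrite mulr_ge0// ltW.
have h3 : hnorm y ^+ 2 * (hnorm x ^+ 2 + t ^+ 2 * normc w ^+ 2 * hnorm y ^+ 2 +
  2 * (t * normc w ^+ 2)) = hnorm y ^+ 2 * hnorm x ^+ 2 +
  (t * hnorm y ^+ 2) ^+ 2 * normc w ^+ 2 + 2 * (t * hnorm y ^+ 2) * normc w ^+ 2.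
  by ring.
rewrite h3 e1 in h2; lra.
Qed.

Lemma Re_le_normc c : complex.Re c <= normc c.
Proof.
case: c => a b /=; apply: le_trans (ler_norm _) _.
by rewrite -sqrtr_sqr ler_wsqrtr// lerDl sqr_ge0.
Qed.

Lemma hnormD x y : hnorm (x + y) <= hnorm x + hnorm y.
Proof.
rewrite -hnorm_unsquare ?addr_ge0 ?hnorm_ge0// hnormD_sqr sqrrD.
have := le_trans (Re_le_normc _) (normc_hdot_CS x y).
by rewrite -mulr_natl; lra.
Qed.

Lemma hnormB_add x y a b : hnorm x <= a -> hnorm y <= b -> hnorm (x - y) <= a + b.
Proof.
by move=> xa yb; apply: le_trans (hnormD _ _) _; rewrite hnormN; exact: lerD.
Qed.

Lemma hnormB_le x y : hnorm y <= hnorm x + hnorm (x - y).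
Proof. by rewrite -{1}(subKr x y); apply: le_trans (hnormD _ _) _; rewrite hnormN. Qed.

Lemma hnormD_le x y a b : hnorm x <= a -> hnorm y <= b -> hnorm (x + y) <= a + b.
Proof. by move=> xa yb; apply: le_trans (hnormD _ _) (lerD _ _). Qed.

Lemma hnorm_sum (I : Type) (s : seq I) (P : pred I) (f : I -> H) :
  hnorm (\sum_(i <- s | P i) f i) <= \sum_(i <- s | P i) hnorm (f i).
Proof.
elim/big_rec2: _ => [|i a x _ h]; first by rewrite hnorm0.
by apply: le_trans (hnormD _ _) _; rewrite lerD2l.
Qed.

Lemma hdot_suml (I : Type) (s : seq I) (P : pred I) (f : I -> H) y :
  hdot (\sum_(i <- s | P i) f i) y = \sum_(i <- s | P i) hdot (f i) y.
Proof.
by elim/big_rec2: _ => [|i a x _ h]; rewrite ?hdot0l// hdotDl h.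
Qed.

Lemma hdotBl x y z : hdot (x - y) z = hdot x z - hdot y z.
Proof. by rewrite hdotDl -[- y]scaleN1r hdotZl mulN1r. Qed.

Lemma hdotBr x y z : hdot z (x - y) = hdot z x - hdot z y.
Proof. by rewrite hdotDr -[- y]scaleN1r hdotZr rmorphN rmorph1 mulN1r. Qed.

Lemma hdot0r x : hdot x 0 = 0.
Proof. by rewrite hdotC hdot0l rmorph0. Qed.

Lemma hnorm_small x k : (forall e : R, 0 < e -> hnorm x <= e * k) -> x = 0.
Proof.
move=> h; apply: hnorm_eq0; apply/eqP; rewrite eq_le hnorm_ge0 andbT.
apply/ler_addgt0Pl => e e0; rewrite addr0.
have k1 : 0 < `|k| + 1 by rewrite ltr_wpDl.
apply: le_trans (h (e / (`|k| + 1)) (divr_gt0 e0 k1)) _.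
rewrite -mulrA ler_piMr ?(ltW e0)// mulrC ler_pdivrMr// mul1r.
by apply: le_trans (ler_norm _) _; rewrite lerDl.
Qed.

End HilbertNorm.

Section BoundedOperators.
Variables (R : realType) (H : hilbertType R).
Implicit Types (x y : H) (X Y : H -> H) (k l : R).

(** A bound by a real number, free of the extended reals of [opnorm]. For linear [X] and [k >= 0] it
    says that the operator norm is at most [k]. *)
Definition opbd X k : Prop := forall x, hnorm (X x) <= k * hnorm x.

Lemma lin0 X : linear X -> X 0 = 0.
Proof. by move=> h; have := h (-1) 0 0; rewrite scaler0 addr0 scaleN1r addNr. Qed.

Lemma linD X x y : linear X -> X (x + y) = X x + X y.
Proof. by move=> h; have := h 1 x y; rewrite !scale1r. Qed.

Lemma linZ X c x : linear X -> X (c *: x) = c *: X x.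
Proof. by move=> h; have := h c x 0; rewrite !addr0 lin0// addr0. Qed.

Lemma linB X x y : linear X -> X (x - y) = X x - X y.
Proof. by move=> h; rewrite linD// -scaleN1r linZ// scaleN1r. Qed.

Lemma linsum X (I : Type) (s : seq I) (P : pred I) (f : I -> H) : linear X ->
  X (\sum_(i <- s | P i) f i) = \sum_(i <- s | P i) X (f i).
Proof.
by move=> h; elim/big_rec2: _ => [|i a x _ <-]; rewrite ?lin0// linD.
Qed.

Lemma opbd_le X k l : k <= l -> opbd X k -> opbd X l.
Proof. by move=> kl h x; apply: le_trans (h x) _; rewrite ler_wpM2r ?hnorm_ge0. Qed.

Lemma opbdD X Y k l : opbd X k -> opbd Y l -> opbd (X + Y) (k + l).
Proof. by move=> hX hY x; rewrite mulrDl; exact: hnormD_le. Qed.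

Lemma opbdZ c X k : opbd X k -> opbd (c *: X) (normc c * k).
Proof. by move=> hX x; rewrite hnormZ -mulrA ler_wpM2l ?normc_ge0. Qed.

Lemma opbdN X k : opbd X k -> opbd (- X) k.
Proof. by move=> hX x; rewrite hnormN. Qed.

Lemma opbdB X Y k l : opbd X k -> opbd Y l -> opbd (X - Y) (k + l).
Proof. by move=> hX /opbdN; exact: opbdD. Qed.

Lemma opbdBC X Y k : opbd (X - Y) k -> opbd (Y - X) k.
Proof. by move=> h; rewrite -opprB; exact: opbdN. Qed.

Lemma opbdM X Y k l : 0 <= k -> opbd X k -> opbd Y l -> opbd (X \o Y) (k * l).
Proof.
by move=> k0 hX hY x; apply: le_trans (hX _) _; rewrite -mulrA ler_wpM2l.
Qed.

Lemma opbd0 : opbd (0 : H -> H) 0.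
Proof. by move=> x; rewrite hnorm0 mul0r. Qed.

Lemma opbd_sum (I : Type) (s : seq I) (P : pred I) (f : I -> H -> H) (k : I -> R) :
  (forall i, P i -> opbd (f i) (k i)) ->
  opbd (\sum_(i <- s | P i) f i) (\sum_(i <- s | P i) k i).
Proof.
move=> h; elim/big_rec2: _ => [|i a X Pi hX]; first exact: opbd0.
exact: opbdD (h _ Pi) hX.
Qed.

Lemma opbd_limit X k : (forall e, 0 < e -> opbd X (k + e)) -> opbd X k.
Proof.
move=> h x; have [x0|x0] := eqVneq (hnorm x) 0.
  by have := h 1 ltr01 x; rewrite x0 !mulr0.
apply/ler_addgt0Pr => e e0.
have xp : 0 < hnorm x by rewrite lt_neqAle eq_sym x0 hnorm_ge0.
by have := h (e / hnorm x) (divr_gt0 e0 xp) x; rewrite mulrDl divfK.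
Qed.

Lemma opbd_small X : (forall e, 0 < e -> opbd X e) -> X = 0.
Proof.
move=> h; apply/funext => x; apply: (@hnorm_small _ _ _ (hnorm x)) => e e0.
exact: h.
Qed.

Lemma linear_fct0 : linear (0 : H -> H).
Proof. by move=> c x y; rewrite /= scaler0 addr0. Qed.

Lemma linear_fctP c X Y : linear X -> linear Y -> linear (c *: X + Y).
Proof.
move=> hX hY d x y; rewrite !fctE /= hX hY !scalerDr !scalerA mulrC.
by rewrite addrACA.
Qed.

Lemma linear_fctB X Y : linear X -> linear Y -> linear (X - Y).
Proof.
by move=> hX hY; rewrite addrC -scaleN1r; exact: linear_fctP.
Qed.

Lemma linear_comp X Y : linear X -> linear Y -> linear (X \o Y).
Proof. by move=> hX hY c x y; rewrite /= hY hX. Qed.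

Lemma linear_fct_sum (I : Type) (s : seq I) (P : pred I) (f : I -> H -> H) :
  (forall i, P i -> linear (f i)) -> linear (\sum_(i <- s | P i) f i).
Proof.
move=> h; elim/big_rec: _ => [|i X Pi hX]; first exact: linear_fct0.
by rewrite -[f i]scale1r; apply: linear_fctP => //; exact: h.
Qed.

Lemma opnorm_ge0 X : (0 <= opnorm X)%E.
Proof.
apply: (@le_trans _ _ (hnorm (X 0))%:E); first by rewrite lee_fin hnorm_ge0.
by apply: ereal_sup_ubound; exists 0 => //=; rewrite hnorm0.
Qed.

Lemma opbd_opnorm X k : 0 <= k -> opbd X k -> (opnorm X <= k%:E)%E.
Proof.
move=> k0 h; apply: ge_ereal_sup => _ [x /= x1 <-]; rewrite lee_fin.
by apply: le_trans (h x) _; rewrite -[leRHS]mulr1 ler_wpM2l.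
Qed.

Lemma opnorm_opbd X k : linear X -> (opnorm X <= k%:E)%E -> opbd X k.
Proof.
move=> hX h x; have [x0|x0] := eqVneq (hnorm x) 0.
  by rewrite (hnorm_eq0 x0) lin0// hnorm0 mulr0.
have xp : 0 < hnorm x by rewrite lt_neqAle eq_sym x0 hnorm_ge0.
have nc : normc ((hnorm x)^-1)%:C = (hnorm x)^-1.
  by rewrite /= expr0n addr0 sqrtr_sqr ger0_norm// invr_ge0 ltW.
have : ((hnorm (X (((hnorm x)^-1)%:C *: x)))%:E <= k%:E)%E.
  apply: le_trans h; apply: ereal_sup_ubound.
  by exists (((hnorm x)^-1)%:C *: x) => //=; rewrite hnormZ nc mulVf.
by rewrite lee_fin linZ// hnormZ nc mulrC ler_pdivrMr.
Qed.

Lemma bounded_opP X : bounded_op X <-> linear X /\ exists2 k, 0 <= k & opbd X k.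
Proof.
split=> [[hX fX]|[hX [k k0 kX]]]; split => //.
  exists (fine (opnorm X)); first by rewrite fine_ge0// opnorm_ge0.
  apply: opnorm_opbd => //; rewrite fineK// ge0_fin_numE//; exact: opnorm_ge0.
by apply: le_lt_trans (opbd_opnorm k0 kX) _; exact: ltry.
Qed.

Lemma opbd_opnorm_lt X k e : 0 <= k -> k < e -> opbd X k -> (opnorm X < e%:E)%E.
Proof.
by move=> k0 ke h; apply: le_lt_trans (opbd_opnorm k0 h) _; rewrite lte_fin.
Qed.

(** The limit is taken pointwise, by completeness of [H]; linearity and the uniform estimates pass
    to it. *)
Lemma op_complete (X : nat -> H -> H) :
  (forall n, linear (X n)) ->
  (forall e, 0 < e -> exists N, forall m n, (N <= m)%N -> (N <= n)%N ->
     opbd (X m - X n) e) ->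
  exists2 Y, linear Y & forall e, 0 < e -> exists N, forall n, (N <= n)%N ->
     opbd (X n - Y) e.
Proof.
move=> Xlin XC.
have lim x : exists l : H, forall e : R, 0 < e -> exists N, forall n,
    (N <= n)%N -> hnorm (X n x - l) < e.
  apply: (@hcomplete R H (fun n => X n x)) => e e0.
  have x1 : 0 < hnorm x + 1 by rewrite ltr_wpDl ?hnorm_ge0.
  have [N hN] := XC _ (divr_gt0 e0 x1); exists N => m n Nm Nn.
  apply: le_lt_trans (hN m n Nm Nn x) _.
  by rewrite mulrAC ltr_pdivrMr// ltr_pM2l// ltrDl.
have [Y hY] := choice lim.
exists Y.
  move=> c x y; apply/eqP; rewrite -subr_eq0; apply/eqP.
  apply: (@hnorm_small _ _ _ (1 + normc c + 1)) => e e0.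
  have [N1 h1] := hY (c *: x + y) _ e0.
  have [N2 h2] := hY x _ e0.
  have [N3 h3] := hY y _ e0.
  pose n := maxn N1 (maxn N2 N3).
  have {}h1 := ltW (h1 n (leq_maxl _ _)).
  have {}h2 : hnorm (X n x - Y x) <= e.
    by apply/ltW/h2; rewrite /n leq_max leq_max leqnn orbT.
  have {}h3 : hnorm (X n y - Y y) <= e.
    by apply/ltW/h3; rewrite /n leq_max leq_max leqnn !orbT.
  have -> : Y (c *: x + y) - (c *: Y x + Y y) = - (X n (c *: x + y) - Y (c *: x + y))
     + c *: (X n x - Y x) + (X n y - Y y).
    rewrite Xlin scalerBr opprB opprD !addrA -(addrA (Y _)).
    rewrite opprD !addrA (addrAC _ (- X n y) (c *: _)) subrK.
    by rewrite (addrAC _ (- (c *: _)) (X n y)) subrK.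
  rewrite !mulrDr !mulr1; apply: hnormD_le => //; apply: hnormD_le; rewrite ?hnormN//.
  by rewrite hnormZ mulrC ler_wpM2r// normc_ge0.
move=> e e0; have [N hN] := XC _ e0; exists N => n Nn x.
apply/ler_addgt0Pr => d d0.
have [M hM] := hY x _ d0.
pose m := maxn N M.
have -> : (X n - Y) x = (X n - X m) x + (X m x - Y x).
  by rewrite !fctE addrA subrK.
apply: hnormD_le; first by apply: hN => //; exact: leq_maxl.
by apply/ltW/hM; exact: leq_maxr.
Qed.

End BoundedOperators.

(** * Hilbert sums and matrices of operators *)

Notation l2H := Defs_l2__canonical__Defs_Hilbert.

Lemma fsum_single (V : nmodType) (I : choiceType) (J : {fset I}) (i : I) (f : I -> V) :
  (forall j, j != i -> f j = 0) ->
  \sum_(j <- J) f j = if i \in J then f i else 0.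
Proof.
move=> f0; case: ifPn => iJ.
  by rewrite (bigD1_seq i) ?fset_uniq//= big1 ?addr0.
rewrite big_seq big1// => j jJ; apply: f0.
by apply: contraNneq iJ => <-.
Qed.

Lemma fsum_subset (R : numDomainType) (I : choiceType) (J0 J : {fset I}) (g : I -> R) :
  (forall i, 0 <= g i) -> (J0 `<=` J)%fset -> \sum_(i <- J0) g i <= \sum_(i <- J) g i.
Proof.
move=> g0 J0J; rewrite [leRHS](big_fsetID _ (mem J0)) /=.
rewrite (_ : [fset x in J | x \in J0]%fset = J0) ?lerDl ?sumr_ge0//.
apply/fsetP => i; rewrite !inE /= andbC; case: (boolP (i \in J0)) => //= iJ0.
exact: (fsubsetP J0J).
Qed.

Lemma sum_pair (V : nmodType) (I P : finType) (F : I * P -> V) :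
  \sum_b F b = \sum_i \sum_p F (i, p).
Proof. by rewrite pair_big /=; apply: eq_bigr => -[]. Qed.

Lemma sum_constR (R : numDomainType) (I : finType) (c : R) :
  \sum_(i : I) c = #|I|%:R * c.
Proof. by rewrite sumr_const mulr_natl. Qed.

Section L2Basics.
Variables (R : realType) (I : choiceType) (H : hilbertType R).
Local Notation K := (l2H I H).
Implicit Types (x y : l2 I H) (h : H) (X Y : K -> K) (k : R).

Lemma l2_sum_le x (J : {fset I}) :
  \sum_(i <- J) hnorm (x i) ^+ 2 <= hnorm x ^+ 2.
Proof.
rewrite [leRHS]hnorm_sqr; apply: sum_le_csum => [i|]; first exact: sqr_ge0.
by have := l2dotP x x; congr has_usum; apply/funext => i; rewrite hdotxx.
Qed.

Lemma l2_le_sum x k :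
  (forall J : {fset I}, \sum_(i <- J) hnorm (x i) ^+ 2 <= k) -> hnorm x ^+ 2 <= k.
Proof.
move=> hk; rewrite hnorm_sqr; apply: (csum_le_sum hk _).2.
by have := l2dotP x x; congr has_usum; apply/funext => i; rewrite hdotxx.
Qed.

Lemma l2_ext x y : (forall i, x i = y i) -> x = y.
Proof. by move=> h; apply: val_inj; apply/funext. Qed.

Lemma l2_sumE (T : Type) (s : seq T) (P : pred T) (f : T -> l2 I H) i :
  (\sum_(t <- s | P t) f t) i = \sum_(t <- s | P t) f t i.
Proof. by elim/big_rec2: _ => // t a b _ <-. Qed.

Lemma hnorm_coord x i : hnorm (x i) <= hnorm x.
Proof.
rewrite -hnorm_unsquare ?hnorm_ge0//.
by have := l2_sum_le x [fset i]%fset; rewrite big_seq_fset1.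
Qed.

Lemma l2_approx x (e : R) : 0 < e ->
  exists J : {fset I}, hnorm x ^+ 2 - \sum_(i <- J) hnorm (x i) ^+ 2 <= e.
Proof.
move=> e0; apply: contrapT => /forallNP h.
have : hnorm x ^+ 2 <= hnorm x ^+ 2 - e.
  apply: l2_le_sum => J; have /negP := h J; rewrite -ltNge; lra.
lra.
Qed.

Definition l2delta i h : l2 I H := mkl2 (fun j => if j == i then h else 0).

Lemma l2deltaE i h j : l2delta i h j = if j == i then h else 0.
Proof.
rewrite /l2delta mkl2E//; apply/square_summableP; exists (hnorm h ^+ 2) => J.
rewrite (@fsum_single _ _ _ i) => [|a /negbTE ->]; last by rewrite hnorm0 expr0n.
by rewrite eqxx; case: ifP => _ //; exact: sqr_ge0.
Qed.

Lemma hdot_l2delta x i h : hdot x (l2delta i h) = hdot (x i) h.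
Proof.
rewrite l2_hdotE; apply: csumE => e e0; exists [fset i]%fset => J hJ.
rewrite (@fsum_single _ _ _ i) => [|j /negbTE ji]; last by rewrite l2deltaE ji hdot0r.
by rewrite (fsubsetP hJ) ?inE// l2deltaE eqxx subrr normc0 lee_fin ltW.
Qed.

Lemma l2delta_linear i : linear (l2delta i).
Proof.
move=> c h h'; apply: l2_ext => j.
rewrite l2deltaE [RHS](_ : _ = c *: l2delta i h j + l2delta i h' j)// !l2deltaE.
by case: ifP => // _; rewrite scaler0 addr0.
Qed.

Lemma l2deltaZ i c h : l2delta i (c *: h) = c *: l2delta i h.
Proof.
apply: l2_ext => j; rewrite l2deltaE.
rewrite [RHS](_ : _ = c *: l2delta i h j)// l2deltaE.
by case: ifP => // _; rewrite scaler0.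
Qed.

Lemma l2delta_sum i (T : Type) (s : seq T) (P : pred T) (F : T -> H) :
  l2delta i (\sum_(t <- s | P t) F t) = \sum_(t <- s | P t) l2delta i (F t).
Proof.
apply: l2_ext => j; rewrite l2_sumE l2deltaE; case: eqP => [->|/eqP/negbTE ji].
  by apply: eq_bigr => t _; rewrite l2deltaE eqxx.
by rewrite big1// => t _; rewrite l2deltaE ji.
Qed.

Lemma hnorm_l2delta i h : hnorm (l2delta i h) = hnorm h.
Proof.
apply/eqP; rewrite eq_le -[X in X && _]hnorm_unsquare ?hnorm_ge0//.
apply/andP; split.
  apply: l2_le_sum => J; rewrite (@fsum_single _ _ _ i); last first.
    by move=> a /negbTE ai; rewrite l2deltaE ai hnorm0 expr0n.
  by rewrite l2deltaE eqxx; case: ifP => _ //; exact: sqr_ge0.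
by have := hnorm_coord (l2delta i h) i; rewrite l2deltaE eqxx.
Qed.

Definition entry X i j : H -> H := fun h => X (l2delta j h) i.

Lemma entry_linear X i j : linear X -> linear (entry X i j).
Proof.
move=> hX c h h'; rewrite /entry (_ : l2delta _ _ = c *: l2delta j h + l2delta j h'); last exact: l2delta_linear.
by rewrite hX.
Qed.

Lemma entry_opbd X i j k : opbd X k -> opbd (entry X i j) k.
Proof.
by move=> hX h; apply: le_trans (hnorm_coord _ _) _; rewrite -(hnorm_l2delta j h).
Qed.

Lemma entryD X Y i j : entry (X + Y) i j = entry X i j + entry Y i j.
Proof. by []. Qed.
Lemma entryB X Y i j : entry (X - Y) i j = entry X i j - entry Y i j.
Proof. by []. Qed.
Lemma entryP c X Y i j : entry (c *: X + Y) i j = c *: entry X i j + entry Y i j.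
Proof. by []. Qed.

Definition trunc (J : {fset I}) x : l2 I H := \sum_(j <- J) l2delta j (x j).

Lemma truncE J x i : trunc J x i = if i \in J then x i else 0.
Proof.
rewrite l2_sumE (@fsum_single _ _ _ i) ?l2deltaE ?eqxx// => j ji.
by rewrite l2deltaE eq_sym (negbTE ji).
Qed.

Lemma trunc_approx x (e : R) : 0 < e ->
  exists J : {fset I}, forall J' : {fset I}, (J `<=` J')%fset ->
    hnorm (x - trunc J' x) <= e.
Proof.
move=> e0; have [J hJ] := l2_approx x (exprn_gt0 2 e0).
exists J => J' JJ'; rewrite -hnorm_unsquare ?hnorm_ge0 ?(ltW e0)//.
apply: l2_le_sum => J2.
apply: le_trans hJ; rewrite lerBrDr.
apply: le_trans (l2_sum_le x (J' `|` J2)%fset).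
have tE i : hnorm ((x - trunc J' x) i) ^+ 2 = if i \in J' then 0 else hnorm (x i) ^+ 2.
  have -> : (x - trunc J' x) i = x i - trunc J' x i by [].
  by rewrite truncE; case: ifP => _; rewrite ?subrr ?subr0 ?hnorm0 ?expr0n.
have -> : \sum_(i <- (J' `|` J2)%fset) hnorm (x i) ^+ 2 =
  \sum_(i <- (J' `|` J2)%fset) hnorm ((x - trunc J' x) i) ^+ 2 +
  \sum_(i <- (J' `|` J2)%fset) (if i \in J' then hnorm (x i) ^+ 2 else 0).
  by rewrite -big_split /=; apply: eq_bigr => i _; rewrite tE; case: ifP; rewrite ?add0r ?addr0.
apply: lerD; first by apply: fsum_subset => [i|]; rewrite ?sqr_ge0 ?fsubsetUr.
apply: (@le_trans _ _ (\sum_(i <- J) if i \in J' then hnorm (x i) ^+ 2 else 0)).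
  by rewrite !big_seq; apply: ler_sum => i iJ; rewrite (fsubsetP JJ').
apply: fsum_subset => [i|]; first by case: ifP => _; rewrite ?sqr_ge0.
exact: fsubset_trans (fsubsetUl _ _).
Qed.

(** The a priori bound [k] supplies continuity, which carries the bound [C] from a dense set to all
    vectors; [k] does not enter the conclusion. *)
Lemma opbd_dense X k C (D : set (l2 I H)) : linear X -> 0 <= k -> opbd X k ->
  0 <= C -> (forall x e, 0 < e -> exists2 d, D d & hnorm (x - d) <= e) ->
  (forall d, D d -> hnorm (X d) <= C * hnorm d) -> opbd X C.
Proof.
move=> hX k0 kX C0 Dd h x; apply/ler_addgt0Pr => e e0.
have p0 : 0 < k + C + 1 by rewrite ltr_wpDl// addr_ge0.
have [d dD xd] := Dd x _ (divr_gt0 e0 p0).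
have -> : X x = X d + X (x - d) by rewrite -linD// addrC subrK.
have {}xd : (k + C) * hnorm (x - d) <= e.
  apply: (@le_trans _ _ ((k + C) * (e / (k + C + 1)))); first by rewrite ler_wpM2l ?addr_ge0.
  by rewrite mulrA ler_pdivrMr// mulrC ler_pM2l// lerDl.
have dx : hnorm d <= hnorm x + hnorm (x - d).
  exact: hnormB_le.
apply: le_trans (hnormD_le (h _ dD) (kX _)) _.
have := ler_wpM2l C0 dx; rewrite mulrDr; rewrite mulrDl in xd; lra.
Qed.

(** [X - Y] vanishes on finitely supported vectors, and these are dense. *)
Lemma eq_entries X Y k l : linear X -> linear Y -> 0 <= k -> 0 <= l ->
  opbd X k -> opbd Y l -> (forall i j, entry X i j = entry Y i j) -> X = Y.
Proof.
move=> hX hY k0 l0 kX lY XY; apply/eqP; rewrite -subr_eq0; apply/eqP.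
have hZ := linear_fctB hX hY; have kZ := opbdB kX lY.
have Z0 J x : (X - Y) (trunc J x) = 0.
  rewrite linsum// big1// => j _; apply: l2_ext => i.
  rewrite [LHS](_ : _ = entry X i j (x j) - entry Y i j (x j))// XY subrr.
  by [].
have h0 : opbd (X - Y) 0.
  apply: (@opbd_dense _ (k + l) 0 [set trunc J x | J in setT & x in setT]) => //.
  - exact: addr_ge0.
  - move=> x e e0; have [J hJ] := trunc_approx x e0.
    by exists (trunc J x); [exists J => //; exists x|exact: hJ].
  - by move=> _ [J _ [x _ <-]]; rewrite Z0 hnorm0 mul0r.
by apply: opbd_small => e e0; apply: opbd_le h0; exact: ltW.
Qed.

End L2Basics.

Section FiniteL2.
Variables (R : realType) (I : finType) (H : hilbertType R).
Implicit Types (x y : l2 I H) (f : I -> H).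

Lemma mkl2_finE f i : mkl2 f i = f i.
Proof.
rewrite mkl2E//; apply/square_summableP.
exists (\sum_(i <- [fset i | i : I]%fset) hnorm (f i) ^+ 2) => J.
apply: fsum_subset => [j|]; first exact: sqr_ge0.
by apply/fsubsetP => j _; rewrite !inE.
Qed.

Lemma fset_sumT (g : I -> R) : \sum_(i <- [fset i | i : I]%fset) g i = \sum_i g i.
Proof.
apply/perm_big/uniq_perm; rewrite ?fset_uniq// ?index_enum_uniq// => i.
by rewrite !inE mem_index_enum.
Qed.

Lemma hnorm_l2fin x : hnorm x ^+ 2 = \sum_i hnorm (x i) ^+ 2.
Proof.
apply/eqP; rewrite eq_le; apply/andP; split.
  apply: l2_le_sum => J; rewrite -fset_sumT.
  apply: fsum_subset => [j|]; first exact: sqr_ge0.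
  by apply/fsubsetP => j _; rewrite !inE.
by rewrite -fset_sumT; exact: l2_sum_le.
Qed.

End FiniteL2.

(** * Matrices of operators as operators on a finite Hilbert sum *)

Section OperatorMatrices.
Variables (R : realType) (H : hilbertType R).

(** For linear entries and [k >= 0] this is [mxnorm x <= k], squared to avoid roots. *)
Definition mxbd (I : finType) (x : I -> I -> H -> H) (k : R) : Prop :=
  forall v : I -> H,
    \sum_i hnorm (\sum_j x i j (v j)) ^+ 2 <= k ^+ 2 * \sum_j hnorm (v j) ^+ 2.

Definition mxop (I : finType) (x : I -> I -> H -> H) :
    (l2H I H) -> (l2H I H) :=
  fun v => mkl2 (fun i => \sum_j x i j (v j)).

Variable I : finType.
Local Notation K := (l2H I H).
Implicit Types (x y : I -> I -> H -> H) (k l : R).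

Definition mxlin x : Prop := forall i j, linear (x i j).

Lemma mxopE x v i : mxop x v i = \sum_j x i j (v j).
Proof. exact: mkl2_finE. Qed.

Lemma mxop_linear x : mxlin x -> linear (mxop x).
Proof.
move=> hx c v w; apply: l2_ext => i; rewrite mxopE.
rewrite [RHS](_ : _ = c *: mxop x v i + mxop x w i)// !mxopE scaler_sumr.
rewrite -big_split /=; apply: eq_bigr => j _.
by rewrite [LHS](_ : _ = x i j (c *: v j + w j))// hx.
Qed.

Lemma mxbdP x k : 0 <= k -> mxbd x k <-> opbd (mxop x) k.
Proof.
move=> k0; split => h v.
  rewrite -hnorm_unsquare ?mulr_ge0 ?hnorm_ge0//.
  rewrite exprMn (hnorm_l2fin (mxop x v)) (hnorm_l2fin v).
  by apply: le_trans (h v); apply: ler_sum => i _; rewrite mxopE.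
have hv : hnorm (mkl2 v) ^+ 2 = \sum_j hnorm (v j) ^+ 2.
  by rewrite hnorm_l2fin; apply: eq_bigr => j _; rewrite mkl2_finE.
rewrite -hv -exprMn; set w := mkl2 v in hv *.
have : hnorm (mxop x w) ^+ 2 <= (k * hnorm w) ^+ 2.
  by rewrite hnorm_unsquare ?mulr_ge0 ?hnorm_ge0.
rewrite (hnorm_l2fin (mxop x w)); apply: le_trans; apply: ler_sum => i _.
rewrite mxopE; have -> : \sum_j x i j (w j) = \sum_j x i j (v j).
  by apply: eq_bigr => j _; rewrite mkl2_finE.
by [].
Qed.

Lemma mxnormE x : mxnorm x = opnorm (mxop x).
Proof.
rewrite /mxnorm /opnorm; congr ereal_sup; apply/seteqP; split.
  move=> _ [v /= v1 <-]; exists (mkl2 v) => /=.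
    rewrite -hnorm_unsquare ?hnorm_ge0// expr1n hnorm_l2fin.
    by under eq_bigr do rewrite mkl2_finE.
  congr (_%:E); rewrite -[LHS]ger0_norm ?hnorm_ge0// -sqrtr_sqr hnorm_l2fin.
  congr Num.sqrt; apply: eq_bigr => i _; rewrite mxopE.
  by congr (hnorm _ ^+ 2); apply: eq_bigr => j _; rewrite mkl2_finE.
move=> _ [v /= v1 <-]; exists (l2val v) => /=.
  by rewrite -hnorm_l2fin expr_le1 ?hnorm_ge0.
congr (_%:E); rewrite -[RHS]ger0_norm ?hnorm_ge0// -sqrtr_sqr hnorm_l2fin.
by congr Num.sqrt; apply: eq_bigr => i _; rewrite mxopE.
Qed.

Lemma mxbd_mxnorm x k : 0 <= k -> mxbd x k -> (mxnorm x <= k%:E)%E.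
Proof. by move=> k0 /(mxbdP _ k0) h; rewrite mxnormE; exact: opbd_opnorm. Qed.

Lemma mxnorm_mxbd x k : mxlin x -> 0 <= k -> (mxnorm x <= k%:E)%E -> mxbd x k.
Proof.
move=> hx k0; rewrite mxnormE => h; apply/mxbdP => //.
by apply: opnorm_opbd => //; exact: mxop_linear.
Qed.

Lemma mxbd_le x k l : 0 <= k -> k <= l -> mxbd x k -> mxbd x l.
Proof.
move=> k0 kl /(mxbdP _ k0) h; apply/(mxbdP _ (le_trans k0 kl)).
exact: opbd_le h.
Qed.

Lemma mxbdD x y k l : 0 <= k -> 0 <= l -> mxbd x k -> mxbd y l ->
  mxbd (fun i j => x i j + y i j) (k + l).
Proof.
move=> k0 l0 /(mxbdP _ k0) h1 /(mxbdP _ l0) h2; apply/mxbdP; first exact: addr_ge0.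
suff -> : mxop (fun i j => x i j + y i j) = mxop x + mxop y by exact: opbdD.
apply/funext => v; apply: l2_ext => i; rewrite mxopE.
rewrite [RHS](_ : _ = mxop x v i + mxop y v i)// !mxopE -big_split.
by apply: eq_bigr.
Qed.

Lemma mxbdZ c x k : mxbd x k -> mxbd (fun i j => c *: x i j) (normc c * k).
Proof.
move=> h v; rewrite exprMn -mulrA.
apply: le_trans (ler_wpM2l (sqr_ge0 (normc c)) (h v)).
rewrite mulr_sumr; apply: ler_sum => i _.
by rewrite -hnormZ_sqr scaler_sumr.
Qed.

Lemma mxbd0 : mxbd (fun _ _ : I => 0 : H -> H) 0.
Proof.
move=> v; rewrite expr0n mul0r big1// => i _.
by rewrite big1 ?hnorm0 ?expr0n.
Qed.

Lemma mxbd_sum (T : Type) (s : seq T) (x : T -> I -> I -> H -> H) (k : T -> R) :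
  (forall t, 0 <= k t) -> (forall t, mxbd (x t) (k t)) ->
  mxbd (fun i j => \sum_(t <- s) x t i j) (\sum_(t <- s) k t).
Proof.
move=> k0 h; elim: s => [|t s IH].
  rewrite big_nil; have := mxbd0; congr mxbd.
  by apply/funext => i; apply/funext => j; rewrite big_nil.
rewrite big_cons.
have := mxbdD (k0 t) (sumr_ge0 _ (fun t _ => k0 t)) (h t) IH; congr mxbd.
by apply/funext => i; apply/funext => j; rewrite big_cons.
Qed.

Lemma mxbd_limit x k : 0 <= k -> (forall e, 0 < e -> mxbd x (k + e)) -> mxbd x k.
Proof.
move=> k0 h; apply/mxbdP => //; apply: opbd_limit => e e0.
by apply/mxbdP; [rewrite addr_ge0// ltW|exact: h].
Qed.

(** A crude bound, whose size is irrelevant: it provides the a priori continuity on which density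
    arguments rest. *)
Lemma mxbd_ex x k : (forall i j, opbd (x i j) k) -> 0 <= k -> exists2 K, 0 <= K & mxbd x K.
Proof.
move=> h k0; exists (#|I|%:R * (#|I|%:R * k)); first by rewrite !mulr_ge0.
move=> v; rewrite exprMn.
set S := \sum_j hnorm (v j) ^+ 2.
have S0 : 0 <= S by apply: sumr_ge0 => j _; exact: sqr_ge0.
have vS j : hnorm (v j) <= Num.sqrt S.
  rewrite -hnorm_unsquare ?hnorm_ge0 ?sqrtr_ge0// [Num.sqrt S ^+ 2]sqr_sqrtr//.
  by rewrite /S (bigD1 j)//= lerDl sumr_ge0// => a _; exact: sqr_ge0.
apply: (@le_trans _ _ (\sum_(i : I) ((#|I|%:R * k) ^+ 2 * S))).
  apply: ler_sum => i _; rewrite -[X in _ * X](sqr_sqrtr S0) -exprMn.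
  rewrite hnorm_unsquare ?hnorm_ge0 ?mulr_ge0 ?sqrtr_ge0//.
  apply: le_trans (hnorm_sum _ _ _) _.
  apply: (@le_trans _ _ (\sum_(j : I) k * Num.sqrt S)).
    by apply: ler_sum => j _; apply: le_trans (h i j _) _; exact: ler_wpM2l.
  by rewrite sum_constR mulrA.
rewrite sum_constR -[leRHS]mulrA; apply: ler_wpM2r; first by rewrite mulr_ge0 ?sqr_ge0.
rewrite -natrX ler_nat; case: #|I| => // n.
by rewrite -mulnn leq_pmulr.
Qed.

(** Vectors are extended by zero, so a submatrix inherits the bound. For bijective [f] this is a
    reindexing, which mediates between arbitrary finite types and the ordinals used in [cbnorm]. *)
Lemma mxbd_inj (P : finType) (f : P -> I) x k : injective f -> mxlin x ->
  mxbd x k -> mxbd (fun p q => x (f p) (f q)) k.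
Proof.
(* As [f] is injective, [v'] is the extension of [v] by zero. *)
move=> finj hx h v; pose v' i := \sum_(p | f p == i) v p.
have vf p : v' (f p) = v p.
  rewrite /v' (bigD1 p)//= big1 ?addr0// => q /andP[/eqP /finj -> ].
  by rewrite eqxx.
have sumf (V : nmodType) (F : I -> V) : (forall i, (forall p, f p != i) -> F i = 0) ->
    \sum_i F i = \sum_p F (f p).
  move=> F0; rewrite (partition_big f xpredT)//=; apply: eq_bigr => i _.
  have [[p pi]|ni] := pselect (exists p, f p = i).
    rewrite -pi (bigD1 p)//= big1 ?addr0// => q /andP[/eqP /finj ->].
    by rewrite eqxx.
  rewrite F0 => [|p]; last by apply/eqP => e; apply: ni; exists p.
  by rewrite big1// => p /eqP pi; case: ni; exists p.
have v'0 i : (forall p, f p != i) -> v' i = 0.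
  by move=> h'; rewrite /v' big1// => p /eqP pi; have := h' p; rewrite pi eqxx.
have sv' : \sum_i hnorm (v' i) ^+ 2 = \sum_p hnorm (v p) ^+ 2.
  rewrite sumf => [|i /v'0 ->]; last by rewrite hnorm0 expr0n.
  by apply: eq_bigr => p _; rewrite vf.
rewrite -sv'; apply: le_trans (h v').
have -> : \sum_p hnorm (\sum_q x (f p) (f q) (v q)) ^+ 2 =
    \sum_i (if i \in codom f then hnorm (\sum_j x i j (v' j)) ^+ 2 else 0).
  rewrite sumf => [|i ni]; last first.
    by case: ifPn => // /codomP[p ip]; have := ni p; rewrite ip eqxx.
  apply: eq_bigr => p _; rewrite codom_f sumf => [|j /v'0 ->]; last exact: lin0.
  by under [in RHS]eq_bigr do rewrite vf.
by apply: ler_sum => i _; case: ifP => // _; exact: sqr_ge0.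
Qed.

Lemma mxop_entry x i j : mxlin x -> entry (mxop x) i j = x i j.
Proof.
move=> hx; apply/funext => h; rewrite /entry mxopE (bigD1 j)//= l2deltaE eqxx.
by rewrite big1 ?addr0// => a /negbTE aj; rewrite l2deltaE aj lin0.
Qed.

Lemma mxop_of_entries (X : K -> K) : linear X -> mxop (entry X) = X.
Proof.
move=> hX; apply/funext => v; apply: l2_ext => i; rewrite mxopE /entry.
have -> : v = \sum_j l2delta j (v j).
  apply: l2_ext => a; rewrite l2_sumE (bigD1 a)//= l2deltaE eqxx big1 ?addr0// => j ja.
  by rewrite l2deltaE eq_sym (negbTE ja).
rewrite linsum// l2_sumE; apply: eq_bigr => j _; rewrite l2_sumE.
congr (X (l2delta j _) i); rewrite (bigD1 j)//= l2deltaE eqxx big1 ?addr0// => a aj.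
by rewrite l2deltaE eq_sym (negbTE aj).
Qed.

End OperatorMatrices.

Lemma mxbd_unit (R : realType) (H : hilbertType R) (X : H -> H) (k : R) :
  0 <= k -> mxbd (fun _ _ : unit => X) k <-> opbd X k.
Proof.
move=> k0; have sumu (V : nmodType) (F : unit -> V) : \sum_j F j = F tt.
  by rewrite (bigD1 tt)//= big1 ?addr0// => -[].
split=> h v.
  have := h (fun=> v); rewrite !sumu -exprMn.
  by rewrite hnorm_unsquare ?mulr_ge0 ?hnorm_ge0.
by rewrite !sumu -exprMn hnorm_unsquare ?mulr_ge0 ?hnorm_ge0.
Qed.

(** * Finite sections of matrices of operators on ℓ²(G,H) *)

Section Sections.
Variables (R : realType) (G : choiceType) (H : hilbertType R) (I : finType).
Local Notation K := (l2H G H).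
Variable X : I -> I -> K -> K.

Lemma mxbd_coord s t k : mxbd X k -> mxbd (fun i j => entry (X i j) s t) k.
Proof.
move=> h v.
have -> : \sum_j hnorm (v j) ^+ 2 = \sum_j hnorm (l2delta t (v j)) ^+ 2.
  by apply: eq_bigr => j _; rewrite hnorm_l2delta.
apply: le_trans (h (fun j => l2delta t (v j))); apply: ler_sum => i _.
rewrite hnorm_unsquare ?hnorm_ge0//; apply: le_trans (hnorm_coord _ s).
by rewrite l2_sumE.
Qed.

(** Placing [v (j, p)] at the coordinate [g p] maps the vectors of the section into ℓ²(G,H) without
    increasing the norm, because the points [g p] are distinct. After applying [X], the coordinates
    outside the range of [g] are dropped. *)
Lemma mxbd_section (P : finType) (g : P -> G) k : injective g -> mxlin X ->
  mxbd X k ->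
  mxbd (fun a b : I * P => entry (X a.1 b.1) (g a.2) (g b.2)) k.
Proof.
move=> ginj hX h v; pose w j := \sum_p l2delta (g p) (v (j, p)).
have wE j p : w j (g p) = v (j, p).
  rewrite l2_sumE (bigD1 p)//= l2deltaE eqxx big1 ?addr0// => q qp.
  by rewrite l2deltaE (inj_eq ginj) eq_sym (negbTE qp).
have wn j : hnorm (w j) ^+ 2 <= \sum_p hnorm (v (j, p)) ^+ 2.
  apply: l2_le_sum => J.
  apply: (@le_trans _ _ (\sum_(s <- J) \sum_p if s == g p then hnorm (v (j, p)) ^+ 2 else 0)).
    apply: ler_sum => s _; have [[p ps]|ns] := pselect (exists p, g p = s).
      rewrite -ps wE (bigD1 p)//= eqxx lerDl sumr_ge0// => q _.
      by case: ifP => _ //; exact: sqr_ge0.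
    have -> : w j s = 0.
      rewrite l2_sumE big1// => p _; rewrite l2deltaE; case: eqP => // sp.
      by case: ns; exists p.
    rewrite hnorm0 expr0n sumr_ge0// => q _.
    by case: ifP => _ //; exact: sqr_ge0.
  rewrite exchange_big /=; apply: ler_sum => p _.
  rewrite (@fsum_single _ _ _ (g p)) => [|s /negbTE -> //].
  by rewrite eqxx; case: ifP => _ //; exact: sqr_ge0.
have XwE i p : (\sum_j X i j (w j)) (g p) =
    \sum_(b : I * P) entry (X i b.1) (g p) (g b.2) (v b).
  rewrite l2_sumE sum_pair /=.
  by apply: eq_bigr => j _; rewrite linsum// l2_sumE.
apply: (@le_trans _ _ (k ^+ 2 * \sum_j hnorm (w j) ^+ 2)); last first.
  rewrite ler_wpM2l ?sqr_ge0// sum_pair.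
  by apply: ler_sum => j _; exact: wn.
apply: le_trans (h w).
rewrite sum_pair /=.
apply: ler_sum => i _; under eq_bigr do rewrite -XwE.
have -> : \sum_p hnorm ((\sum_j X i j (w j)) (g p)) ^+ 2 =
    \sum_(s <- [fset g p | p : P]%fset) hnorm ((\sum_j X i j (w j)) s) ^+ 2.
  rewrite big_imfset /=; last by move=> ? ? _ _; exact: ginj.
  by rewrite big_enum.
exact: l2_sum_le.
Qed.

(** A single finite set serves all [i] at once: the union of sets that nearly exhaust each norm. *)
Lemma hnorm2_sup (y : I -> l2 G H) k :
  (forall J : {fset G}, \sum_i \sum_(s <- J) hnorm (y i s) ^+ 2 <= k) ->
  \sum_i hnorm (y i) ^+ 2 <= k.
Proof.
move=> h; apply/ler_addgt0Pr => e e0.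
have n0 : 0 < (#|I|%:R + 1 : R) by rewrite ltr_wpDl.
have [J hJ] := choice (fun i => l2_approx (y i) (divr_gt0 e0 n0)).
pose K := (\bigcup_(i <- enum I) J i)%fset.
have JK i : (J i `<=` K)%fset by apply: bigfcup_sup => //; rewrite mem_enum.
apply: (@le_trans _ _ (\sum_i (\sum_(s <- K) hnorm (y i s) ^+ 2 + e / (#|I|%:R + 1)))).
  apply: ler_sum => i _; have := hJ i; rewrite lerBlDr => hi.
  rewrite addrC; apply: le_trans hi _; rewrite lerD2l.
  by apply: fsum_subset => // s; exact: sqr_ge0.
rewrite big_split /= lerD// sum_constR mulrA ler_pdivrMr//.
by rewrite mulrC ler_pM2l// lerDl.
Qed.

(** Families of vectors supported in a common finite set [J] are dense. If only the output
    coordinates in a finite set [J'] are tested, all that is seen of [X] on them is its section over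
    the union of [J] and [J']. *)
Lemma mxbd_sections C k : mxlin X -> 0 <= k -> (forall i j, opbd (X i j) k) ->
  0 <= C ->
  (forall (P : finType) (g : P -> G), injective g ->
    mxbd (fun a b : I * P => entry (X a.1 b.1) (g a.2) (g b.2)) C) ->
  mxbd X C.
Proof.
move=> hX k0 kX C0 h; have [K K0 KX] := mxbd_ex kX k0.
apply/(mxbdP _ C0).
apply: (@opbd_dense _ _ _ _ K C
  [set v | exists J : {fset G}, forall i, v i = trunc J (v i)]) => //.
- exact: mxop_linear.
- exact/mxbdP.
- move=> x e e0; have n0 : 0 < (#|I|%:R + 1 : R) by rewrite ltr_wpDl.
  (* With this tolerance the squares of the [#|I|] errors add up to at most [e ^+ 2]; the [+ 1]
     covers an empty [I]. *)
  have q0 : 0 < Num.sqrt (e ^+ 2 / (#|I|%:R + 1)) by rewrite sqrtr_gt0 divr_gt0// exprn_gt0.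
  have [J hJ] := choice (fun i => trunc_approx (x i) q0).
  pose M := (\bigcup_(i <- enum I) J i)%fset.
  have JM i : (J i `<=` M)%fset by apply: bigfcup_sup => //; rewrite mem_enum.
  exists (mkl2 (fun i => trunc M (x i))) => /=.
    exists M => i; rewrite mkl2_finE; apply: l2_ext => s.
    by rewrite [RHS]truncE !truncE; case: ifP.
  rewrite -hnorm_unsquare ?hnorm_ge0 ?(ltW e0)// hnorm_l2fin.
  apply: (@le_trans _ _ (\sum_(i : I) (e ^+ 2 / (#|I|%:R + 1)))).
    apply: ler_sum => i _.
    have -> : (x - mkl2 (fun i => trunc M (x i))) i = x i - trunc M (x i).
      by rewrite -(mkl2_finE (fun i => trunc M (x i))).
    have := hJ i _ (JM i); rewrite -hnorm_unsquare ?hnorm_ge0 ?(ltW q0)//.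
    have q1 : 0 <= e ^+ 2 / (#|I|%:R + 1) by rewrite divr_ge0 ?sqr_ge0 ?(ltW n0).
    by rewrite -[X in _ -> _ <= X](sqr_sqrtr q1).
  rewrite sum_constR mulrA ler_pdivrMr// mulrC ler_wpM2l ?sqr_ge0//.
  by rewrite lerDl.
- move=> v [J vJ]; rewrite -hnorm_unsquare ?mulr_ge0 ?hnorm_ge0//.
  rewrite exprMn (hnorm_l2fin (mxop X v)) (hnorm_l2fin v); apply: hnorm2_sup => J'.
  pose P : finType := (J `|` J')%fset; pose g : P -> G := val.
  have sumP (F : G -> R) : \sum_(p : P) F (g p) = \sum_(s <- (J `|` J')%fset) F s.
    by rewrite big_seq_fsetE.
  pose w (b : I * P) := v b.1 (g b.2).
  have vE j : v j = \sum_(p : P) l2delta (g p) (w (j, p)).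
    apply: l2_ext => s; rewrite l2_sumE.
    have -> : \sum_p (l2delta (g p) (w (j, p))) s = trunc (J `|` J')%fset (v j) s.
      by rewrite /trunc l2_sumE big_seq_fsetE.
    rewrite truncE; case: ifPn => //; rewrite !inE negb_or => /andP[sJ _].
    by rewrite vJ truncE (negbTE sJ).
  have := h P g val_inj w.
  set S1 := (X in _ <= _ * X -> _).
  have -> : S1 = \sum_j \sum_(s <- (J `|` J')%fset) hnorm (v j s) ^+ 2.
    rewrite /S1 sum_pair /=.
    by apply: eq_bigr => j _; rewrite -sumP.
  move=> hh; apply: (@le_trans _ _ (C ^+ 2 *
     \sum_j \sum_(s <- (J `|` J')%fset) hnorm (v j s) ^+ 2)); last first.
    by rewrite ler_wpM2l ?sqr_ge0//; apply: ler_sum => j _; exact: l2_sum_le.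
  apply: le_trans hh.
  rewrite sum_pair /=.
  apply: ler_sum => i _; rewrite mxopE.
  have XE p : (\sum_j X i j (v j)) (g p) =
    \sum_(b : I * P) entry (X i b.1) (g p) (g b.2) (w b).
    rewrite l2_sumE sum_pair /=.
    by apply: eq_bigr => j _; rewrite {1}vE linsum// l2_sumE.
  under [leRHS]eq_bigr do rewrite -XE.
  rewrite (sumP (fun s => hnorm ((\sum_j X i j (v j)) s) ^+ 2)).
  by apply: fsum_subset => [s|]; rewrite ?sqr_ge0// fsubsetUr.
Qed.

End Sections.

(** * Contractivity of star homomorphisms *)

Lemma inv_succ_lt (R : realType) (e : R) : 0 < e ->
  exists N, forall n, (N <= n)%N -> n.+1%:R^-1 < e.
Proof.
move=> e0; have [N _ hN] := near_infty_natSinv_lt (PosNum e0).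
by exists N => n Nn; exact: hN.
Qed.

Section Adjoints.
Variables (R : realType) (H : hilbertType R).
Implicit Types (X Y : H -> H).

Lemma is_adjoint_sym X Y : is_adjoint X Y -> is_adjoint Y X.
Proof. by move=> h x y; rewrite hdotC -h -hdotC. Qed.

(** By Cauchy-Schwarz, [|Y y|^2 = Re (X (Y y), y) <= k |Y y| |y|]. *)
Lemma opbd_adjoint X Y k : is_adjoint X Y -> 0 <= k -> opbd X k -> opbd Y k.
Proof.
move=> XY k0 hX y; have [y0|y0] := eqVneq (hnorm (Y y)) 0.
  by rewrite y0 mulr_ge0 ?hnorm_ge0.
have yp : 0 < hnorm (Y y) by rewrite lt_neqAle eq_sym y0 hnorm_ge0.
rewrite -(ler_pM2l yp) -expr2 hnorm_sqr -XY.
apply: le_trans (Re_le_normc _) _; apply: le_trans (normc_hdot_CS _ _) _.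
by rewrite mulrA [_ * k]mulrC ler_wpM2r ?hnorm_ge0.
Qed.

End Adjoints.

Section StarHomomorphism.
Variables (R : realType) (H : hilbertType R) (B : set (H -> H)).
Variable phi : (H -> H) -> H -> H.
Hypotheses (BC : cstar_algebra B) (B1 : B idfun).
Hypothesis phi_lin : linear_on B phi.
Hypothesis phiM : forall a b, B a -> B b -> phi (a \o b) = phi a \o phi b.
Hypothesis phi_adj : forall a b, B a -> B b -> is_adjoint a b ->
  is_adjoint (phi a) (phi b).
Hypothesis phi1 : phi idfun = idfun.

Let Blin a : B a -> linear a.
Proof. by move=> /(cstar_bounded BC)[]. Qed.

Section SquareRoot.
Variables (c : H -> H) (q : R).
Hypotheses (Bc : B c) (cc : is_adjoint c c) (q0 : 0 <= q) (q1 : q < 1).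
Hypothesis cq : opbd c q.

(* The fixed point [y] of this iteration satisfies [(1 - y) ^ 2 = 1 - c]. *)
Fixpoint sqrt_iter n : H -> H :=
  if n is m.+1 then 2^-1 *: (c + (sqrt_iter m \o sqrt_iter m)) else 0.

Let y := sqrt_iter.

Lemma sqrt_iter_mem n : B (y n).
Proof.
elim: n => [|n IH] /=; first exact: (cstar0 BC).
rewrite -[2^-1 *: _]addr0; apply: (cstarP BC); last exact: (cstar0 BC).
by rewrite -[c]scale1r; apply: (cstarP BC) => //; exact: (cstarM BC).
Qed.

Let normc_half : normc (2^-1 : R[i]) = 2^-1.
Proof.
have -> : (2^-1 : R[i]) = (2^-1)%:C by rewrite fmorphV rmorph_nat.
by rewrite /= expr0n addr0 sqrtr_sqr ger0_norm.
Qed.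

(** The ball of radius [q] is stable under the iteration because [(q + q^2) / 2 <= q]. *)
Lemma sqrt_iter_bd n : opbd (y n) q.
Proof.
elim: n => [|n IH] /=; first exact: opbd_le q0 (@opbd0 R H).
apply: opbd_le (opbdZ _ (opbdD cq (opbdM q0 IH IH))).
by rewrite normc_half; move: q0 q1 => q0' q1'; nra.
Qed.

Lemma sqrt_iter_adj n : is_adjoint (y n) (y n).
Proof.
elim: n => [|n IH] x z /=; first by rewrite hdot0l hdot0r.
have h2 : Num.conj (2^-1 : R[i]) = 2^-1 by rewrite fmorphV rmorph_nat.
rewrite !fctE hdotZl hdotZr h2 hdotDl hdotDr (cc x z) /=.
by rewrite (IH (y n x) z) (IH x (y n z)).
Qed.

(** The identity [z^2 - w^2 = z (z - w) + (z - w) w] holds for noncommuting operators. Since [z] and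
    [w] have norm at most [q], the halved sum shrinks the previous step by the factor [q]. *)
Lemma sqrt_iter_step n : opbd (y n.+1 - y n) (q ^+ n.+1).
Proof.
elim: n => [|n IH].
  have o := @opbd0 R H; rewrite /y /= subr0.
  apply: opbd_le (opbdZ _ (opbdD cq (opbdM (lexx 0) o o))).
  by rewrite normc_half expr1; move: q0 q1 => q0' q1'; lra.
set z := y n.+1 in IH *; set w := y n in IH *.
have Bz : B z by exact: sqrt_iter_mem.
have -> : y n.+2 - z = 2^-1 *: ((z \o (z - w)) + ((z - w) \o w)).
  rewrite [y n.+2](_ : _ = 2^-1 *: (c + (z \o z)))//.
  rewrite [in X in _ - X](_ : z = 2^-1 *: (c + (w \o w)))//.
  rewrite -scalerBr; congr (_ *: _); apply/funext => x.
  rewrite !fctE /= (linB _ _ (Blin Bz)).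
  by rewrite opprD addrACA subrr add0r addrA subrK.
apply: opbd_le (opbdZ _ (opbdD (opbdM q0 (sqrt_iter_bd _) IH)
  (opbdM _ IH (sqrt_iter_bd _)))); last exact: exprn_ge0.
by move: q0 q1 => q0' q1'; rewrite normc_half -exprS -exprSr; lra.
Qed.

Lemma sqrt_iter_tail n k : opbd (y (n + k)%N - y n) (q ^+ n.+1 * (1 - q ^+ k) / (1 - q)).
Proof.
have p0 : 0 < 1 - q by rewrite subr_gt0.
elim: k => [|k IH]; first by rewrite addn0 subrr expr0 subrr mulr0 mul0r; exact: opbd0.
have -> : y (n + k.+1)%N - y n = (y (n + k).+1 - y (n + k)%N) + (y (n + k)%N - y n).
  by rewrite addrA subrK addnS.
apply: opbd_le (opbdD (sqrt_iter_step _) IH).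
rewrite -[q ^+ (n + k).+1](mulfK (lt0r_neq0 p0)) -mulrDl ler_pM2r ?invr_gt0//.
by rewrite -addSn exprD [q ^+ k.+1]exprSr; lra.
Qed.

(** The geometric tail makes the iterates Cauchy. Their limit [Y] lies in [B] because [B] is norm
    closed, it is selfadjoint as a limit of selfadjoint operators, and it is a fixed point, so
    [1 - Y] is the root. *)
Lemma sqrt_exists : exists b, [/\ B b, is_adjoint b b & b \o b = idfun - c].
Proof.
have p0 : 0 < 1 - q by rewrite subr_gt0.
have [|e e0|Y Ylin hY] := @op_complete R H y.
- by move=> n; apply/Blin/sqrt_iter_mem.
- have : (fun n => q ^+ n) @ \oo --> (0 : R).
    by apply: cvg_expr; rewrite ger0_norm.
  move=> /cvgrPdist_lt/(_ (e * (1 - q)) (mulr_gt0 e0 p0))[N _ hN].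
  have tail n k : (N <= n)%N -> opbd (y (n + k)%N - y n) e.
    move=> Nn; apply: opbd_le (sqrt_iter_tail n k).
    have := hN n Nn; rewrite /= sub0r normrN ger0_norm ?exprn_ge0// => /ltW h.
    rewrite ler_pdivrMr//; apply: le_trans h.
    rewrite exprS -mulrA; have := exprn_ge0 n q0; have := exprn_ge0 k q0.
    have : q ^+ k <= 1 by apply: exprn_ile1 => //; exact: ltW.
    move: (q ^+ k) (q ^+ n) => s t s1 s0 t0.
    rewrite mulrCA ler_piMr// mulr_ile1 ?subr_ge0 ?(ltW q1)//.
    by rewrite lerBlDr lerDl.
  exists N => m n Nm Nn; case: (leqP m n) => [mn|/ltnW nm].
    by apply: opbdBC; rewrite -(subnKC mn); exact: tail.
  by rewrite -(subnKC nm); exact: tail.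
have Yq : opbd Y q.
  apply: opbd_limit => e e0; have [N hN] := hY e e0.
  have -> : Y = y N - (y N - Y) by rewrite subKr.
  exact: opbdB (sqrt_iter_bd N) (hN N (leqnn N)).
have BY : B Y.
  apply: (cstar_closed BC); split; first by apply/bounded_opP; split => //; exists q.
  move=> e e0; have e2 : 0 < e / 2 by rewrite divr_gt0.
  have [N hN] := hY _ e2; exists (y N); first exact: sqrt_iter_mem.
  by apply: (opbd_opnorm_lt (ltW e2)); [lra|apply/opbdBC/hN].
have YY : is_adjoint Y Y.
  move=> x z; apply/eqP; rewrite -subr_eq0; apply/eqP/eq0_normc/eqP.
  rewrite eq_le normc_ge0 andbT; apply/ler_addgt0Pr => e e0.
  have d0 : 0 < 2 * (hnorm x * hnorm z) + 1 by rewrite ltr_wpDl// !mulr_ge0 ?hnorm_ge0.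
  have [N hN] := hY _ (divr_gt0 e0 d0); have {}hN := hN N (leqnn N).
  have -> : hdot (Y x) z - hdot x (Y z) = hdot x ((y N - Y) z) - hdot ((y N - Y) x) z.
    by rewrite !fctE hdotBl hdotBr (sqrt_iter_adj N x z); ring.
  rewrite add0r; apply: le_trans (le_normcD _ _) _; rewrite normcN.
  have h1 := le_trans (normc_hdot_CS x _) (ler_wpM2l (hnorm_ge0 x) (hN z)).
  have h2 := le_trans (normc_hdot_CS _ z) (ler_wpM2r (hnorm_ge0 z) (hN x)).
  apply: le_trans (lerD h1 h2) _.
  have -> : hnorm x * (e / (2 * (hnorm x * hnorm z) + 1) * hnorm z) +
    e / (2 * (hnorm x * hnorm z) + 1) * hnorm x * hnorm z =
    (e * (2 * (hnorm x * hnorm z))) / (2 * (hnorm x * hnorm z) + 1) by field; lra.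
  by rewrite ler_pdivrMr// ler_pM2l// lerDl.
have Yfix : Y = 2^-1 *: (c + (Y \o Y)).
  apply/eqP; rewrite -subr_eq0; apply/eqP; apply: opbd_small => e e0.
  have e3 : 0 < e / 3 by rewrite divr_gt0.
  have [N hN] := hY _ e3; set z := y N; have Bz : B z by exact: sqrt_iter_mem.
  have -> : Y - 2^-1 *: (c + (Y \o Y)) = - (y N.+1 - Y) + 2^-1 *: ((z \o (z - Y)) + ((z - Y) \o Y)).
    have -> : (z \o (z - Y)) + ((z - Y) \o Y) = (z \o z) - (Y \o Y).
      apply/funext => x; rewrite !fctE /= (linB _ _ (Blin Bz)).
      by rewrite addrA subrK.
    rewrite opprB -addrA; congr (_ + _).
    rewrite [y N.+1](_ : _ = 2^-1 *: (c + (z \o z)))// -!scalerN -scalerDr; congr (_ *: _).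
    by rewrite !opprD addrA subrK.
  have h1 := opbdN (hN N.+1 (leqnSn N)); have h2 := hN N (leqnn N).
  apply: opbd_le (opbdD h1 (opbdZ _ (opbdD (opbdM q0 (sqrt_iter_bd N) h2)
    (opbdM (ltW e3) h2 Yq)))).
  by move: q0 q1 => q0' q1'; rewrite normc_half; nra.
exists (idfun - Y); split.
- by rewrite addrC -scaleN1r; exact: (cstarP BC).
- by move=> x z; rewrite !fctE hdotBl hdotBr YY.
apply/funext => x; have := congr1 (fun f : H -> H => (2 : R[i]) *: f x) Yfix.
rewrite !fctE scalerA divff ?pnatr_eq0// scale1r /= => h.
rewrite [LHS]/= linB//.
have -> : c x = 2 *: Y x - Y (Y x) by rewrite h addrK.
by rewrite scaler_nat mulr2n !opprB opprD !addrA (addrAC x (- Y x)).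
Qed.

End SquareRoot.

(* For [|a| < 1] write [1 - a* a = b* b]; then [1 - phi(a)* phi(a) >= 0]. *)
Lemma star_hom_lt1 a r : B a -> 0 <= r -> r < 1 -> opbd a r -> opbd (phi a) 1.
Proof.
move=> Ba r0 r1 ar; have [a' Ba' aa'] := cstar_adjoint BC Ba.
have a'a := is_adjoint_sym aa'.
have Bc : B (a' \o a) by exact: (cstarM BC).
have [||||b [Bb bb bE]] := @sqrt_exists (a' \o a) (r ^+ 2) Bc.
- by move=> x z /=; rewrite a'a -aa'.
- exact: sqr_ge0.
- by rewrite exprn_ilt1.
- by rewrite expr2; apply: opbdM => //; exact: opbd_adjoint aa' r0 ar.
move=> x; rewrite mul1r -hnorm_unsquare ?hnorm_ge0//.
have -> : hnorm (phi a x) ^+ 2 = complex.Re (hdot (phi (a' \o a) x) x).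
  by rewrite hnorm_sqr (phiM Ba' Ba) /= (phi_adj Ba' Ba a'a).
have -> : a' \o a = (-1) *: (b \o b) + idfun.
  by rewrite bE scaleN1r opprB subrK.
rewrite phi_lin//; last exact: (cstarM BC).
rewrite phi1 (phiM Bb Bb) !fctE /= scaleN1r addrC hdotBl.
rewrite (phi_adj Bb Bb bb) !hdotxx /=.
by rewrite lerBlDr lerDl sqr_ge0.
Qed.

(** The square root is available only for norm strictly below 1, hence the rescaling by [k + e] and
    the limit in [e]. *)
Lemma star_hom_contractive a k : B a -> 0 <= k -> opbd a k -> opbd (phi a) k.
Proof.
move=> Ba k0 ak; apply: opbd_limit => e e0.
have d0 : 0 < k + e by rewrite ltr_wpDl.
have nd : normc ((k + e)^-1)%:C = (k + e)^-1.
  by rewrite /= expr0n addr0 sqrtr_sqr ger0_norm// invr_ge0 ltW.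
have dd : (k + e)%:C * ((k + e)^-1)%:C = 1 :> R[i].
  by rewrite -rmorphM /= mulfV ?gt_eqF// rmorph1.
have Ba1 : B (((k + e)^-1)%:C *: a).
  by rewrite -[_ *: a]addr0; apply: (cstarP BC) => //; exact: (cstar0 BC).
have h1 : opbd (phi (((k + e)^-1)%:C *: a)) 1.
  apply: (@star_hom_lt1 _ ((k + e)^-1 * k)) => //.
  - by rewrite mulr_ge0// invr_ge0 ltW.
  - by rewrite mulrC ltr_pdivrMr// mul1r ltrDl.
  - by rewrite -{2}nd; exact: opbdZ.
have -> : phi a = (k + e)%:C *: phi (((k + e)^-1)%:C *: a).
  have := phi_lin (k + e)%:C Ba1 (cstar0 BC).
  have p0 : phi 0 = 0.
    have := phi_lin (-1) (cstar0 BC) (cstar0 BC).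
    by rewrite scaler0 addr0 scaleN1r addNr.
  by rewrite p0 !addr0 scalerA dd scale1r.
apply: opbd_le (opbdZ _ h1).
by rewrite mulr1 /= expr0n addr0 sqrtr_sqr ger0_norm// ltW.
Qed.

End StarHomomorphism.

(** * Unordered sums in the operator norm *)

Section UnorderedSums.
Variables (R : realType) (H : hilbertType R) (I : choiceType).
Implicit Types (X : I -> H -> H) (Y : H -> H).

Lemma has_usum_opbd X Y (e : R) : (forall i, linear (X i)) -> linear Y ->
  has_usum (@opnorm R H) X Y -> 0 < e -> exists J0 : {fset I}, forall J : {fset I},
    (J0 `<=` J)%fset -> opbd (Y - \sum_(i <- J) X i) e.
Proof.
move=> hX hY h e0; have [J0 hJ] := h e e0; exists J0 => J /hJ.
by apply: opnorm_opbd; apply: linear_fctB => //; exact: linear_fct_sum.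
Qed.

(** [usum] is a choice; uniqueness of the limit identifies the chosen value. *)
Lemma usum_opE X Y : (forall i, linear (X i)) -> @bounded_op R H Y ->
  has_usum (@opnorm R H) X Y -> usum (@bounded_op R H) (@opnorm R H) X = Y.
Proof.
move=> hX bY XY; rewrite /usum; case: xgetP => [Z _ [bZ XZ]|/(_ Y)]; last by case.
apply/eqP; rewrite -subr_eq0; apply/eqP; apply: opbd_small => e e0.
have e2 : 0 < e / 2 by rewrite divr_gt0.
have [J1 h1] := has_usum_opbd hX (proj1 bY) XY e2.
have [J2 h2] := has_usum_opbd hX (proj1 bZ) XZ e2.
have {}h1 := h1 (J1 `|` J2)%fset (fsubsetUl _ _).
have {}h2 := h2 (J1 `|` J2)%fset (fsubsetUr _ _).
have -> : Z - Y = (Z - \sum_(i <- (J1 `|` J2)%fset) X i) - (Y - \sum_(i <- (J1 `|` J2)%fset) X i).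
  by rewrite opprB addrA subrK.
by apply: opbd_le (opbdB h2 h1); lra.
Qed.

(** Absolute convergence. The net of partial sums is reduced to a sequence: [J n] is a finite set
    beyond which the sums move by at most [1 / (n + 1)]. *)
Lemma usum_op_exists X (k : I -> R) K : (forall i, linear (X i)) ->
  (forall i, 0 <= k i) -> (forall i, opbd (X i) (k i)) ->
  (forall J : {fset I}, \sum_(i <- J) k i <= K) ->
  exists2 Y, @bounded_op R H Y & has_usum (@opnorm R H) X Y.
Proof.
move=> hX k0 Xk kK; pose S := [set \sum_(i <- J) k i | J in [set: {fset I}]].
have hS : has_sup S.
  split; first by exists (\sum_(i <- fset0) k i), fset0.
  by exists K => _ [J _ <-].
have tail (e : R) : 0 < e -> exists J0 : {fset I}, forall J : {fset I}, (J0 `<=` J)%fset ->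
    opbd (\sum_(i <- J) X i - \sum_(i <- J0) X i) e.
  move=> e0; have [_ [J0 _ <-] hJ0] := sup_adherent e0 hS.
  exists J0 => J J0J.
  have split (V : zmodType) (F : I -> V) : \sum_(i <- J) F i - \sum_(i <- J0) F i =
      \sum_(i <- (J `\` J0)%fset) F i.
    rewrite (big_fsetID _ (mem J0)) /=.
    rewrite (_ : [fset x in J | x \in J0]%fset = J0); last first.
      apply/fsetP => i; rewrite !inE /= andbC; case: (boolP (i \in J0)) => //= iJ0.
      exact: (fsubsetP J0J).
    rewrite addrC addrK; apply: congr_big => //; congr enum_fset.
    by apply/fsetP => i; rewrite !inE /= andbC.
  rewrite split; apply: opbd_le (opbd_sum _ (fun i _ => Xk i)).
  have : \sum_(i <- J) k i <= sup S by apply: ub_le_sup; [exact: hS.2|exists J].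
  by have := split R k; lra.
have tailn n : exists J0 : {fset I}, forall J : {fset I}, (J0 `<=` J)%fset ->
    opbd (\sum_(i <- J) X i - \sum_(i <- J0) X i) n.+1%:R^-1.
  by apply: tail; rewrite invr_gt0.
have [J hJ] := choice tailn.
have [||Y Ylin hY] := @op_complete R H (fun n => \sum_(i <- J n) X i).
- by move=> n; exact: linear_fct_sum.
- move=> e e0; have e2 : 0 < e / 2 by rewrite divr_gt0.
  have [N hN] := inv_succ_lt e2; exists N => m n /hN/ltW hm /hN/ltW hn.
  have h1 := opbd_le hm (hJ m _ (fsubsetUl (J m) (J n))).
  have h2 := opbd_le hn (hJ n _ (fsubsetUr (J m) (J n))).
  have := opbdB h2 h1; rewrite -splitr; congr opbd.
  by rewrite opprB addrC addrA subrK.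
have close (e : R) : 0 < e -> exists J0 : {fset I}, forall J : {fset I}, (J0 `<=` J)%fset ->
    opbd (Y - \sum_(i <- J) X i) e.
  move=> e0; have e2 : 0 < e / 2 by rewrite divr_gt0.
  have [N hN] := inv_succ_lt e2; have [M hM] := hY _ e2.
  pose n := maxn N M; exists (J n) => J' JJ'.
  have h1 := opbd_le (ltW (hN n (leq_maxl _ _))) (hJ n _ JJ').
  have h2 := hM n (leq_maxr _ _).
  have := opbdN (opbdD h2 h1); rewrite -splitr; congr opbd.
  rewrite addrC opprD !opprB.
  by rewrite addrC addrA subrK.
exists Y.
  apply/bounded_opP; split => //; have [J0 h0] := close 1 ltr01.
  exists (1 + \sum_(i <- J0) k i); first by rewrite addr_ge0// sumr_ge0.
  have -> : Y = (Y - \sum_(i <- J0) X i) + \sum_(i <- J0) X i by rewrite subrK.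
  by apply: opbdD; [exact: h0|apply: opbd_sum].
move=> e e0; have [J0 h0] := close e e0; exists J0 => J' JJ'.
by apply: opbd_opnorm; [exact: ltW|exact: h0].
Qed.

End UnorderedSums.

(** * Complete contractivity of automorphisms *)

Lemma opnorm_lt_opbd (R : realType) (H : hilbertType R) (X : H -> H) (e : R) :
  linear X -> (opnorm X < e%:E)%E -> opbd X e.
Proof. by move=> hX /ltW; exact: opnorm_opbd. Qed.

Section FiniteAdjoint.
Variables (R : realType) (I : finType) (H : hilbertType R).
Local Notation K := (l2H I H).
Implicit Types (x y : l2 I H) (X Y : K -> K).

Lemma hdot_l2fin x y : hdot x y = \sum_i hdot (x i) (y i).
Proof.
rewrite l2_hdotE; apply: csumE => e e0; exists [fset i | i : I]%fset => J hJ.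
have -> : \sum_(i <- J) hdot (x i) (y i) = \sum_i hdot (x i) (y i).
  apply/perm_big/uniq_perm; rewrite ?fset_uniq ?index_enum_uniq// => i.
  by rewrite mem_index_enum (fsubsetP hJ)// !inE.
by rewrite subrr normc0 lee_fin ltW.
Qed.

Lemma adjoint_entry X Y i j : is_adjoint X Y -> is_adjoint (entry X i j) (entry Y j i).
Proof.
by move=> XY h h'; rewrite /entry -hdot_l2delta XY hdotC hdot_l2delta -hdotC.
Qed.

Lemma mxop_adjoint (x y : I -> I -> H -> H) :
  (forall i j, is_adjoint (x i j) (y j i)) -> is_adjoint (mxop x) (mxop y).
Proof.
move=> xy v w; rewrite !hdot_l2fin.
have -> : \sum_i hdot (mxop x v i) (w i) = \sum_i \sum_j hdot (x i j (v j)) (w i).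
  by apply: eq_bigr => i _; rewrite mxopE hdot_suml.
rewrite exchange_big /=; apply: eq_bigr => j _; rewrite mxopE hdotC hdot_suml.
rewrite rmorph_sum /=; apply: eq_bigr => i _.
by rewrite xy hdotC.
Qed.

Lemma mxop_comp (x y : I -> I -> H -> H) : mxlin x ->
  mxop x \o mxop y = mxop (fun i j => \sum_k (x i k \o y k j)).
Proof.
move=> hx; apply/funext => v; apply: l2_ext => i; rewrite /= !mxopE.
have -> : \sum_j (\sum_k (x i k \o y k j)) (v j) = \sum_j \sum_k x i k (y k j (v j)).
  by apply: eq_bigr => j _; rewrite fct_sumE.
rewrite exchange_big /=; apply: eq_bigr => k _.
by rewrite mxopE linsum.
Qed.

Lemma bounded_op_uniform (x : I -> I -> H -> H) : (forall i j, bounded_op (x i j)) ->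
  exists2 k, 0 <= k & forall i j, opbd (x i j) k.
Proof.
move=> hx; have hk ij : exists k, 0 <= k /\ opbd (x ij.1 ij.2) k.
  by have /bounded_opP[_ [k k0 hk]] := hx ij.1 ij.2; exists k.
have [k hk'] := choice hk; exists (\sum_ij k ij).
  by apply: sumr_ge0 => a _; exact: (hk' a).1.
move=> i j; apply: opbd_le (hk' (i, j)).2; rewrite (bigD1 (i, j))//= lerDl sumr_ge0//.
by move=> a _; exact: (hk' a).1.
Qed.

Lemma mxop_bounded (x : I -> I -> H -> H) :
  (forall i j, bounded_op (x i j)) -> bounded_op (mxop x).
Proof.
move=> hx; have hl : mxlin x by move=> i j; have [] := hx i j.
have [k k0 hk] := bounded_op_uniform hx; have [K K0 hK] := mxbd_ex hk k0.
apply/bounded_opP; split; first exact: mxop_linear.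
by exists K => //; apply/mxbdP.
Qed.

End FiniteAdjoint.

Section MatrixAutomorphism.
Variables (R : realType) (H : hilbertType R) (A : set (H -> H)).
Hypotheses (AC : cstar_algebra A) (A1 : A idfun).

Lemma cstar_linear a : A a -> linear a.
Proof. by move=> /(cstar_bounded AC)[]. Qed.

Lemma cstarZ c a : A a -> A (c *: a).
Proof.
by move=> Aa; rewrite -[c *: a]addr0; apply: (cstarP AC) => //; exact: (cstar0 AC).
Qed.

Lemma cstarD a b : A a -> A b -> A (a + b).
Proof. by move=> Aa Ab; rewrite -[a]scale1r; exact: (cstarP AC). Qed.

Lemma cstarB a b : A a -> A b -> A (a - b).
Proof. by move=> Aa Ab; rewrite addrC -scaleN1r; exact: (cstarP AC). Qed.

Lemma cstar_sum (T : Type) (s : seq T) (P : pred T) (f : T -> H -> H) :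
  (forall t, P t -> A (f t)) -> A (\sum_(t <- s | P t) f t).
Proof.
move=> h; elim/big_rec: _ => [|t a Pt]; first exact: (cstar0 AC).
by apply: cstarD; exact: h.
Qed.

Section LinearOn.
Variables (V : lmodType R[i]) (T : (H -> H) -> V).
Hypothesis TA : linear_on A T.

Lemma linear_on0 : T 0 = 0.
Proof.
have := TA (-1) (cstar0 AC) (cstar0 AC).
by rewrite scaler0 addr0 scaleN1r addNr.
Qed.

Lemma linear_onZ c a : A a -> T (c *: a) = c *: T a.
Proof.
move=> Aa; have := TA c Aa (cstar0 AC).
by rewrite linear_on0 !addr0.
Qed.

Lemma linear_onD a b : A a -> A b -> T (a + b) = T a + T b.
Proof. by move=> Aa Ab; have := TA 1 Aa Ab; rewrite !scale1r. Qed.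

Lemma linear_onB a b : A a -> A b -> T (a - b) = T a - T b.
Proof. by move=> Aa Ab; have := TA (-1) Ab Aa; rewrite !scaleN1r addrC [RHS]addrC. Qed.

Lemma linear_on_sum (S : Type) (s : seq S) (f : S -> H -> H) :
  (forall t, A (f t)) -> T (\sum_(t <- s) f t) = \sum_(t <- s) T (f t).
Proof.
move=> h; elim: s => [|t s IH]; first by rewrite !big_nil linear_on0.
by rewrite !big_cons linear_onD ?IH//; exact: cstar_sum.
Qed.

End LinearOn.

Variable phi : (H -> H) -> H -> H.
Hypothesis phiP : star_automorphism A phi.

Let phiA a : A a -> A (phi a).
Proof. by move=> Aa; have [+ _ _] := saut_bij phiP; apply. Qed.

(** Surjectivity gives [b] with [phi b = 1], and then [phi 1 = phi 1 phi b = phi (1 b) = 1]. *)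
Lemma saut_idfun : phi idfun = idfun.
Proof.
have [_ _ /(_ idfun A1)[b Ab be]] := saut_bij phiP.
have : phi (idfun \o b) = phi idfun \o phi b by exact: (sautM phiP).
by rewrite be => h; rewrite [RHS](_ : _ = phi idfun \o idfun).
Qed.

Lemma saut_contractive a k : A a -> 0 <= k -> opbd a k -> opbd (phi a) k.
Proof.
move=> Aa k0 ak.
exact: (star_hom_contractive AC A1 (saut_linear phiP) (sautM phiP)
  (saut_adjoint phiP) saut_idfun).
Qed.

Variable I : finType.

Local Notation K := (l2H I H).

(** The matrix algebra [M_I(A)] realised on the Hilbert sum. As it is again a C*-algebra of
    operators, the contractivity result for single operators applies to matrices. *)
Let B : set (K -> K) :=
  [set X | bounded_op X /\ forall i j, A (entry X i j)].

Let Phi (X : K -> K) := mxop (fun i j => phi (entry X i j)).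

Let entry_comp (X Y : K -> K) i j : linear X -> 
  entry (X \o Y) i j = \sum_k (entry X i k \o entry Y k j).
Proof.
move=> hX; apply/funext => h; rewrite /entry /= fct_sumE -[in LHS](mxop_of_entries hX).
by rewrite mxopE.
Qed.

Let BC : cstar_algebra B.
Proof.
split.
- by move=> X [].
- split; last by move=> i j; exact: (cstar0 AC).
  by apply/bounded_opP; split; [exact: linear_fct0|exists 0 => //; exact: opbd0].
- move=> c X Y [/bounded_opP[hX [k k0 kX]] AX] [/bounded_opP[hY [l l0 lY]] AY].
  split; last by move=> i j; rewrite entryP; exact: (cstarP AC).
  apply/bounded_opP; split; first exact: linear_fctP.
  exists (normc c * k + l); first by rewrite addr_ge0// mulr_ge0// normc_ge0.
  by apply: opbdD => //; exact: opbdZ.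
- move=> X Y [/bounded_opP[hX [k k0 kX]] AX] [/bounded_opP[hY [l l0 lY]] AY].
  split; last first.
    by move=> i j; rewrite entry_comp//; apply: cstar_sum => t _; exact: (cstarM AC).
  apply/bounded_opP; split; first exact: linear_comp.
  by exists (k * l); [exact: mulr_ge0|exact: opbdM].
- move=> X [bX AX]; have hX := proj1 bX.
  (* Entry [(i, j)] of the adjoint is the adjoint of entry [(j, i)], hence the swapped indices. *)
  have [y hy] := choice (fun ij => let: ex_intro2 b Ab ab := cstar_adjoint AC (AX ij.2 ij.1)
    in ex_intro (fun b => A b /\ is_adjoint (entry X ij.2 ij.1) b) b (conj Ab ab)).
  have yl : mxlin (fun i j => y (i, j)) by move=> i j; exact/cstar_linear/(hy _).1.
  exists (mxop (fun i j => y (i, j))).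
    split; first by apply: mxop_bounded => i j; exact/(cstar_bounded AC)/(hy _).1.
    by move=> i j; rewrite mxop_entry//; exact: (hy _).1.
  rewrite -[X in is_adjoint X _](mxop_of_entries hX); apply: mxop_adjoint => i j.
  exact: (hy (j, i)).2.
move=> X [bX clX]; split => // i j; apply: (cstar_closed AC).
have hX := proj1 bX.
split.
  have /bounded_opP[_ [k k0 kX]] := bX; apply/bounded_opP.
  by split; [exact: entry_linear|exists k => //; exact: entry_opbd].
move=> e e0; have e2 : 0 < e / 2 by rewrite divr_gt0.
have [Y [bY AY] XY] := clX _ e2; exists (entry Y i j) => //.
have hXY := opnorm_lt_opbd (linear_fctB hX (proj1 bY)) XY.
by apply: (opbd_opnorm_lt (ltW e2)); [lra|exact: (entry_opbd i j hXY)].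
Qed.

Let B1 : B idfun.
Proof.
split.
  by apply/bounded_opP; split => //; exists 1 => // x; rewrite mul1r.
move=> i j; have [<-|ij] := eqVneq i j.
  by rewrite (_ : entry _ _ _ = idfun)//; apply/funext => h; rewrite /entry l2deltaE eqxx.
rewrite (_ : entry _ _ _ = 0); first exact: (cstar0 AC).
by apply/funext => h; rewrite /entry l2deltaE (negbTE ij).
Qed.

(** [Phi], the entrywise application of [phi], is a unital homomorphism on [M_I(A)] that preserves
    adjoints, hence contractive there. *)
Lemma mxbd_saut (x : I -> I -> H -> H) k : (forall i j, A (x i j)) -> 0 <= k ->
  mxbd x k -> mxbd (fun i j => phi (x i j)) k.
Proof.
move=> Ax k0 xk; have hx : mxlin x by move=> i j; exact/cstar_linear.
have BX : B (mxop x).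
  split; first by apply: mxop_bounded => i j; exact/(cstar_bounded AC).
  by move=> i j; rewrite mxop_entry.
have -> : (fun i j => phi (x i j)) = (fun i j => phi (entry (mxop x) i j)).
  by apply/funext => i; apply/funext => j; rewrite mxop_entry.
apply/mxbdP => //.
apply: (@star_hom_contractive _ _ B Phi BC B1) => //.
- move=> c X Y [_ AX] [_ AY]; apply/funext => v; apply: l2_ext => i.
  rewrite [RHS](_ : _ = c *: Phi X v i + Phi Y v i)// !mxopE scaler_sumr -big_split.
  by apply: eq_bigr => j _; rewrite entryP (saut_linear phiP).
- move=> X Y [bX AX] [bY AY]; rewrite mxop_comp; last first.
    by move=> a b; exact/cstar_linear/phiA.
  congr mxop; apply/funext => i; apply/funext => j.
  rewrite (entry_comp _ _ _ (proj1 bX)) (linear_on_sum (saut_linear phiP)); last first.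
    by move=> t; exact: (cstarM AC).
  by apply: eq_bigr => t _; exact: (sautM phiP).
- move=> X Y [_ AX] [_ AY] XY; apply: mxop_adjoint => i j.
  by apply: (saut_adjoint phiP) => //; exact: adjoint_entry.
- rewrite /Phi -[RHS]mxop_of_entries//; congr mxop; apply/funext => i; apply/funext => j.
  have [<-|ij] := eqVneq i j.
    rewrite (_ : entry _ _ _ = idfun) ?saut_idfun//.
    by apply/funext => h; rewrite /entry l2deltaE eqxx.
  rewrite (_ : entry _ _ _ = 0) ?(linear_on0 (saut_linear phiP))//.
  by apply/funext => h; rewrite /entry l2deltaE (negbTE ij).
- exact/mxbdP.
Qed.

End MatrixAutomorphism.

(** * The operators π(a)λ_r of the regular covariant representation *)

Section Action.
Variables (R : realType) (G : groupType) (H : hilbertType R) (A : set (H -> H)).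
Variable alpha : G -> (H -> H) -> H -> H.

(** By nondegeneracy every vector is close to some [\sum_k a_k y_k], and [one] fixes such sums. *)
Lemma unit_of_idfun one : cstar_algebra A -> nondegenerate_on A -> unit_of A one ->
  one = idfun.
Proof.
move=> AC nd [A1 h1]; have /bounded_opP[hone [k k0 kone]] := cstar_bounded AC A1.
apply/funext => x; apply/eqP; rewrite -subr_eq0; apply/eqP.
apply: (@hnorm_small _ _ _ (k + 1)) => e e0.
have [n [a [y [Aa hxy]]]] := nd x e e0; set s := \sum_k _ in hxy.
have os : one s = s.
  rewrite /s linsum//; apply: eq_bigr => i _.
  by have [h _] := h1 _ (Aa i); rewrite -[in RHS]h.
have -> : one x - idfun x = one (x - s) - (x - s).
  by rewrite linB// os opprB addrA subrK.
rewrite mulrDr mulr1 [e * k]mulrC; apply: hnormB_add; last exact: ltW.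
by apply: le_trans (kone _) _; rewrite ler_wpM2l// ltW.
Qed.

Hypotheses (AC : cstar_algebra A) (A1 : A idfun) (act : action_on A alpha).

Lemma alpha_mem t a : A a -> A (alpha t a).
Proof. by move=> Aa; have [+ _ _] := saut_bij (act.1 t); apply. Qed.

Lemma alpha_id a : A a -> alpha 1%g a = a.
Proof.
move=> Aa; have [_ _ /(_ a Aa)[b Ab <-]] := saut_bij (act.1 1%g).
by rewrite -act.2// mulg1.
Qed.

Lemma alpha_linear t : linear_on A (alpha t).
Proof. exact: (saut_linear (act.1 t)). Qed.

Lemma alpha_opbd t a k : A a -> 0 <= k -> opbd a k -> opbd (alpha t a) k.
Proof. exact: (saut_contractive AC A1 (act.1 t)). Qed.

Lemma shift_sum_le (r : G) (x : l2 G H) (J : {fset G}) :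
  \sum_(s <- J) hnorm (x (r^-1 * s)%g) ^+ 2 <= hnorm x ^+ 2.
Proof.
have -> : \sum_(s <- J) hnorm (x (r^-1 * s)%g) ^+ 2 =
    \sum_(s <- [fset (r^-1 * s)%g | s in J]%fset) hnorm (x s) ^+ 2.
  by rewrite big_imfset//= => ? ? _ _; exact: mulgI.
exact: l2_sum_le.
Qed.

Lemma lambda_shiftE (r : G) (x : l2 G H) s : lambda_shift r x s = x (r^-1 * s)%g.
Proof.
rewrite /lambda_shift mkl2E//; apply/square_summableP.
by exists (hnorm x ^+ 2) => J; exact: shift_sum_le.
Qed.

Lemma pi_repE a (x : l2 G H) s : A a -> pi_rep alpha a x s = alpha s^-1%g a (x s).
Proof.
move=> Aa; have /bounded_opP[_ [k k0 ak]] := cstar_bounded AC Aa.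
rewrite /pi_rep mkl2E//; apply/square_summableP; exists (k ^+ 2 * hnorm x ^+ 2) => J.
apply: le_trans (ler_wpM2l (sqr_ge0 k) (l2_sum_le x J)).
rewrite mulr_sumr; apply: ler_sum => t _.
rewrite -exprMn hnorm_unsquare ?hnorm_ge0 ?mulr_ge0 ?hnorm_ge0//.
exact: alpha_opbd.
Qed.

Local Notation K := (l2H G H).

Definition pilam (r : G) (a : H -> H) : K -> K :=
  pi_rep alpha a \o lambda_shift r.

Lemma pilamE r a x s : A a -> pilam r a x s = alpha s^-1%g a (x (r^-1 * s)%g).
Proof. by move=> Aa; rewrite /pilam /= pi_repE// lambda_shiftE. Qed.

Lemma pilam_linear r a : A a -> linear (pilam r a).
Proof.
move=> Aa c x y; apply: l2_ext => s.
refine (eq_trans (pilamE r (c *: x + y) s Aa) _).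
refine (eq_trans _ (f_equal2 (fun u v => c *: u + v) (esym (pilamE r x s Aa))
  (esym (pilamE r y s Aa)))).
exact: (cstar_linear AC (alpha_mem s^-1%g Aa)).
Qed.

Lemma pilam_linear_on r : linear_on A (pilam r).
Proof.
move=> c a b Aa Ab; apply/funext => x; apply: l2_ext => s.
rewrite [RHS](_ : _ = c *: pilam r a x s + pilam r b x s)// !pilamE//.
  by rewrite alpha_linear.
exact: (cstarP AC).
Qed.

Lemma pilam_entry r a s t : A a ->
  entry (pilam r a) s t = if (s * t^-1)%g == r then alpha s^-1%g a else 0.
Proof.
move=> Aa; apply/funext => h; rewrite /entry pilamE// l2deltaE.
have -> : ((r^-1 * s)%g == t) = ((s * t^-1)%g == r).
  apply/eqP/eqP => [<-|<-]; first by rewrite invgM invgK mulgA mulgV mul1g.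
  by rewrite invgM invgK -mulgA mulVg mulg1.
by case: ifP => // _; rewrite lin0//; exact/(cstar_linear AC)/alpha_mem.
Qed.

(** At the coordinate [s] the matrix acts through [alpha_{s^-1}(b_ij)] on the vectors [v_j(r^-1 s)].
    So [mxbd_saut] applies at each coordinate, and the shift by [r] only permutes coordinates. *)
Lemma mxbd_pilam (I : finType) (b : I -> I -> H -> H) r k :
  (forall i j, A (b i j)) -> 0 <= k -> mxbd b k ->
  mxbd (fun i j => pilam r (b i j)) k.
Proof.
move=> Ab k0 bk v; apply: hnorm2_sup => J; rewrite exchange_big /=.
have h s : \sum_i hnorm ((\sum_j pilam r (b i j) (v j)) s) ^+ 2 <=
    k ^+ 2 * \sum_j hnorm (v j (r^-1 * s)%g) ^+ 2.
  have := mxbd_saut AC A1 (act.1 s^-1%g) Ab k0 bk (fun j => v j (r^-1 * s)%g).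
  apply: le_trans; apply: ler_sum => i _.
  have -> : (\sum_j pilam r (b i j) (v j)) s =
     \sum_j alpha s^-1%g (b i j) (v j (r^-1 * s)%g).
    by rewrite l2_sumE; apply: eq_bigr => j _; exact: pilamE.
  by [].
apply: le_trans (ler_sum _ (fun s _ => h s)) _.
rewrite -mulr_sumr ler_wpM2l ?sqr_ge0// exchange_big /=.
by apply: ler_sum => j _; exact: shift_sum_le.
Qed.

Lemma opbd_pilam r a k : A a -> 0 <= k -> opbd a k -> opbd (pilam r a) k.
Proof.
move=> Aa k0 ak; apply/mxbd_unit => //.
by apply: mxbd_pilam => //; exact/mxbd_unit.
Qed.

Lemma pilam_bounded r a : A a -> bounded_op (pilam r a).
Proof.
move=> Aa; have /bounded_opP[_ [k k0 ak]] := cstar_bounded AC Aa.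
apply/bounded_opP; split; first exact: pilam_linear.
by exists k => //; exact: opbd_pilam.
Qed.

End Action.

(** * The reduced crossed product *)

Lemma lt_pinfty_bound (R : realType) (x : \bar R) : (x < +oo)%E ->
  exists2 M : R, 0 <= M & (x <= M%:E)%E.
Proof.
case: x => [r _|//|_]; last by exists 0; rewrite ?leNye.
by exists `|r|; rewrite ?normr_ge0// lee_fin ler_norm.
Qed.

(** * Complete boundedness with explicit constants *)

Section CompletelyBounded.
Variables (R : realType) (H : hilbertType R).
Implicit Types (X Z : set (H -> H)) (T : (H -> H) -> H -> H).

Definition cbbd X T (M : R) : Prop :=
  forall (I : finType) (x : I -> I -> H -> H), (forall i j, X (x i j)) ->
  forall C, 0 <= C -> mxbd x C -> mxbd (fun i j => T (x i j)) (M * C).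

Lemma cbbd_opbd X T M a k : cbbd X T M -> 0 <= M -> X a -> 0 <= k -> opbd a k ->
  opbd (T a) (M * k).
Proof.
move=> hT M0 Xa k0 ak; apply/mxbd_unit; first exact: mulr_ge0.
by apply: (hT unit (fun _ _ => a)) => //; exact/mxbd_unit.
Qed.

Lemma cbbd_op_cbnorm X T M : (forall a, X a -> linear a) ->
  0 <= M -> cbbd X T M -> (op_cbnorm X T <= M%:E)%E.
Proof.
move=> Xl M0 h; apply: ge_ereal_sup => _ [n [x [Xx x1 ->]]].
apply: mxbd_mxnorm => //; rewrite -[M]mulr1; apply: h => //.
by apply: mxnorm_mxbd => // i j; exact/Xl.
Qed.

(** [op_cbnorm] tests matrices of norm at most 1 indexed by ordinals. Rescaling and [mxbd_inj] reach
    every [C > 0] and every finite index type; [C = 0] follows by letting positive constants tend to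
    it. *)
Lemma op_cbnorm_cbbd X T M : (forall a, X a -> linear a) ->
  (forall (c : R[i]) a, X a -> X (c *: a)) ->
  (forall (c : R[i]) a, X a -> T (c *: a) = c *: T a) ->
  (forall a, X a -> linear (T a)) ->
  0 <= M -> (op_cbnorm X T <= M%:E)%E -> cbbd X T M.
Proof.
move=> Xl XZ TZ Tl M0 h.
have pos (I : finType) (x : I -> I -> H -> H) (C : R) : (forall i j, X (x i j)) -> 0 < C ->
    mxbd x C -> mxbd (fun i j => T (x i j)) (M * C).
  move=> Xx C0 xC.
  pose c : R[i] := (C^-1)%:C.
  have nc : normc c = C^-1.
    by rewrite /= expr0n addr0 sqrtr_sqr ger0_norm// invr_ge0 ltW.
  have nC : normc (C%:C : R[i]) = C.
    by rewrite /= expr0n addr0 sqrtr_sqr ger0_norm// ltW.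
  pose y (i j : 'I_#|I|) := c *: x (enum_val i) (enum_val j).
  have Xy i j : X (y i j) by exact: XZ.
  have xl : mxlin x by move=> i j; exact/Xl.
  have y1 : mxbd y 1.
    have := mxbdZ c (mxbd_inj (@enum_val_inj I predT) xl xC).
    by rewrite nc mulVf ?gt_eqF.
  have Ty : mxbd (fun i j => T (y i j)) M.
    apply: mxnorm_mxbd => //; first by move=> i j; exact/Tl.
    apply: le_trans h; apply: ereal_sup_ubound; exists #|I|, y; split => //.
    exact: mxbd_mxnorm.
  have Tyl : mxlin (fun i j => T (y i j)) by move=> i j; exact/Tl.
  have := mxbdZ (C%:C) (mxbd_inj (@enum_rank_inj I) Tyl Ty).
  rewrite nC mulrC; congr mxbd.
  apply/funext => i; apply/funext => j.
  rewrite /y !enum_rankK TZ// scalerA -rmorphM /= mulfV ?gt_eqF// rmorph1.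
  by rewrite scale1r.
move=> I x Xx C C0 xC; apply: mxbd_limit => [|e e0]; first exact: mulr_ge0.
have p : 0 < M + 1 by rewrite ltr_wpDl.
have q : 0 < e / (M + 1) by rewrite divr_gt0.
have Cq : 0 < C + e / (M + 1) by rewrite ltr_wpDl.
apply: (@mxbd_le _ _ _ _ (M * (C + e / (M + 1)))).
- by rewrite mulr_ge0// ltW.
- rewrite mulrDr lerD2l mulrA ler_pdivrMr// mulrC ler_pM2l//.
  by rewrite lerDl.
apply: pos => //; apply: (mxbd_le C0) xC.
by rewrite lerDl ltW.
Qed.

End CompletelyBounded.

Local Opaque mkl2 usum pi_rep lambda_shift.

Section Crossed.
Variables (R : realType) (G : groupType) (H : hilbertType R) (A : set (H -> H)).
Variable alpha : G -> (H -> H) -> H -> H.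
Hypotheses (AC : cstar_algebra A) (A1 : A idfun) (act : action_on A alpha).
Local Notation K := (l2H G H).
Local Notation CP := (crossed_product A alpha).
Local Notation trep := (trep alpha).
Local Notation pilam := (pilam alpha).
Implicit Types (f g : G -> H -> H) (X Y : K -> K).

Lemma l1A_summable f : l1A A f -> exists k : G -> R, [/\ (forall s, 0 <= k s),
  (forall s, opbd (f s) (k s)) & exists K, forall J : {fset G}, \sum_(s <- J) k s <= K].
Proof.
move=> [Af fin]; pose k s := fine (opnorm (f s)).
have kE s : (k s)%:E = opnorm (f s).
  rewrite fineK// ge0_fin_numE; last exact: opnorm_ge0.
  exact: (cstar_bounded AC (Af s)).2.
exists k; split => [s|s|].
- by rewrite fine_ge0// opnorm_ge0.
- by apply: opnorm_opbd; [exact/(cstar_linear AC)|rewrite kE].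
have [K K0 hK] := lt_pinfty_bound fin; exists K => J.
rewrite -lee_fin; apply: le_trans hK; apply: esum_ge; exists [set` J]; first by split.
rewrite -fsbig_seq ?fset_uniq// -sumEFin.
by apply: lee_sum => s _; rewrite kE.
Qed.

Lemma summable_l1A f (k : G -> R) K : (forall s, A (f s)) -> (forall s, 0 <= k s) ->
  (forall s, opbd (f s) (k s)) -> (forall J : {fset G}, \sum_(s <- J) k s <= K) ->
  l1A A f.
Proof.
move=> Af k0 fk kK; split => //; apply: (@le_lt_trans _ _ K%:E); last exact: ltry.
apply: ge_ereal_sup => _ [J [finJ _] <-]; rewrite fsbig_finite//.
apply: (@le_trans _ _ (\sum_(s <- fset_set J) (k s)%:E)%E).
  by apply: lee_sum => s _; exact: opbd_opnorm.
by rewrite sumEFin lee_fin.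
Qed.

(** [trep] is a choice with default value 0. Since each [pilam s] is contractive, summability of the
    norms of [f] makes the sum converge, and the choice returns its limit. *)
Lemma trep_spec f : l1A A f -> bounded_op (trep f) /\
  has_usum (@opnorm R K) (fun s => pilam s (f s)) (trep f).
Proof.
move=> lf; have [k [k0 fk [K hK]]] := l1A_summable lf; have [Af _] := lf.
have pl s := pilam_linear AC A1 act s (Af s).
have pk s := opbd_pilam AC A1 act s (Af s) (k0 s) (fk s).
have [Y bY hY] := usum_op_exists pl k0 pk hK.
by have -> : trep f = Y := usum_opE pl bY hY.
Qed.

Lemma entry_sum (T : Type) (r : seq T) (F : T -> K -> K) s t :
  entry (\sum_(i <- r) F i) s t = \sum_(i <- r) entry (F i) s t.
Proof. by elim: r => [|i r IH]; rewrite ?big_nil ?big_cons// entryD IH. Qed.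

(** Only the summand at [r = s t^-1] has a nonzero [(s, t)] entry, so that entry is the same for all
    partial sums containing [r]. *)
Lemma entry_trep f s t : l1A A f -> entry (trep f) s t = alpha s^-1%g (f (s * t^-1)%g).
Proof.
move=> lf; have [[hl _] hu] := trep_spec lf; have [Af _] := lf.
apply/eqP; rewrite -subr_eq0; apply/eqP; apply: opbd_small => e e0.
have [J0 hJ] := has_usum_opbd (fun s => pilam_linear AC A1 act s (Af s)) hl hu e0.
pose r := (s * t^-1)%g; pose J := (r |` J0)%fset.
have := entry_opbd s t (hJ J (fsubsetU1 _ _)); congr opbd.
rewrite entryB entry_sum (@fsum_single _ _ _ r) => [|q qr]; last first.
  by rewrite (pilam_entry AC A1 act)// eq_sym (negbTE qr).
by rewrite fset1U1 (pilam_entry AC A1 act)// eqxx.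
Qed.

Lemma eq_bounded_entries X Y : bounded_op X -> bounded_op Y ->
  (forall s t, entry X s t = entry Y s t) -> X = Y.
Proof.
move=> /bounded_opP[hX [k k0 kX]] /bounded_opP[hY [l l0 lY]].
exact: eq_entries hX hY k0 l0 kX lY.
Qed.

Lemma bounded_op_fctP (K : hilbertType R) c (X Y : K -> K) :
  bounded_op X -> bounded_op Y -> bounded_op (c *: X + Y).
Proof.
move=> /bounded_opP[hX [k k0 kX]] /bounded_opP[hY [l l0 lY]].
apply/bounded_opP; split; first exact: linear_fctP.
exists (normc c * k + l); first by rewrite addr_ge0// mulr_ge0// normc_ge0.
by apply: opbdD => //; exact: opbdZ.
Qed.

Lemma bounded_op0 (K : hilbertType R) : bounded_op (0 : K -> K).
Proof.
by apply/bounded_opP; split; [exact: linear_fct0|exists 0 => //; exact: opbd0].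
Qed.

Lemma l1A_P c f g : l1A A f -> l1A A g -> l1A A (fun s => c *: f s + g s).
Proof.
move=> lf lg; have [k [k0 fk [K hK]]] := l1A_summable lf.
have [l [l0 gl [L hL]]] := l1A_summable lg; have [Af _] := lf; have [Ag _] := lg.
apply: (@summable_l1A _ (fun s => normc c * k s + l s) (normc c * K + L)).
- by move=> s; exact: (cstarP AC).
- by move=> s; rewrite addr_ge0// mulr_ge0// normc_ge0.
- by move=> s; apply: opbdD => //; exact: opbdZ.
move=> J; rewrite big_split /= -mulr_sumr lerD// ler_wpM2l//.
exact: normc_ge0.
Qed.

Lemma trepP c f g : l1A A f -> l1A A g ->
  trep (fun s => c *: f s + g s) = c *: trep f + trep g.
Proof.
move=> lf lg; have lh := l1A_P c lf lg; have [Af _] := lf; have [Ag _] := lg.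
apply: eq_bounded_entries; first exact: (trep_spec lh).1.
  by apply: bounded_op_fctP; [exact: (trep_spec lf).1|exact: (trep_spec lg).1].
move=> s t; refine (eq_trans (entry_trep s t lh) _).
refine (eq_trans _ (f_equal2 (fun u v => c *: u + v) (esym (entry_trep s t lf))
  (esym (entry_trep s t lg)))).
exact: (alpha_linear act).
Qed.

Lemma l1A_fin (D : {fset G}) f : (forall s, A (f s)) ->
  (forall s, s \notin D -> f s = 0) -> l1A A f.
Proof.
move=> Af f0.
have hk s : exists k, 0 <= k /\ opbd (f s) k.
  by have /bounded_opP[_ [k k0 kf]] := cstar_bounded AC (Af s); exists k.
have [k hk'] := choice hk.
apply: (@summable_l1A _ (fun s => if s \in D then k s else 0) (\sum_(s <- D) k s)) => //.
- by move=> s; case: ifP => _ //; exact: (hk' s).1.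
- move=> s; case: ifPn => [_|/f0 ->]; first exact: (hk' s).2.
  exact: opbd0.
move=> J; apply: (@le_trans _ _ (\sum_(s <- (J `|` D)%fset) if s \in D then k s else 0)).
  apply: fsum_subset; last exact: fsubsetUl.
  by move=> s; case: ifP => _ //; exact: (hk' s).1.
rewrite (big_fsetID _ (mem D)) /= [X in _ + X]big1_fset ?addr0; last first.
  by move=> s; rewrite !inE /= => /andP[_ /negbTE ->].
rewrite (_ : [fset x in _ | _]%fset = D); last first.
  apply/fsetP => s; rewrite !inE /= andbC; case: (s \in D) => //=.
  by rewrite orbT.
by rewrite big_seq [leRHS]big_seq; apply: ler_sum => s ->.
Qed.

Lemma bounded_op_sum (K : hilbertType R) (T : Type) (r : seq T) (F : T -> K -> K) :
  (forall i, bounded_op (F i)) -> bounded_op (\sum_(i <- r) F i).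
Proof.
move=> h; elim: r => [|i r IH]; first by rewrite big_nil; exact: bounded_op0.
by rewrite big_cons -[F i]scale1r; exact: bounded_op_fctP.
Qed.

Lemma trep_fin (D : {fset G}) f : (forall s, A (f s)) ->
  (forall s, s \notin D -> f s = 0) -> trep f = \sum_(s <- D) pilam s (f s).
Proof.
move=> Af f0; have lf := l1A_fin Af f0.
apply: eq_bounded_entries; first exact: (trep_spec lf).1.
  by apply: bounded_op_sum => i; exact: (pilam_bounded AC A1 act).
move=> s t; rewrite entry_trep// entry_sum (@fsum_single _ _ _ (s * t^-1)%g).
  case: ifPn => [_|/f0 ->]; first by rewrite (pilam_entry AC A1 act)// eqxx.
  by rewrite (linear_on0 AC (alpha_linear act _)).
by move=> r rst; rewrite (pilam_entry AC A1 act)// eq_sym (negbTE rst).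
Qed.

(* For [X] in the crossed product, [fcoef r X] is its [r]-th Fourier coefficient. *)
Definition fcoef (r : G) X : H -> H := entry X 1%g r^-1%g.

Lemma fcoefP r c X Y : fcoef r (c *: X + Y) = c *: fcoef r X + fcoef r Y.
Proof. by []. Qed.

Lemma fcoefB r X Y : fcoef r (X - Y) = fcoef r X - fcoef r Y.
Proof. by []. Qed.

Lemma fcoef_trep r f : l1A A f -> fcoef r (trep f) = f r.
Proof.
by move=> lf; have [Af _] := lf; rewrite /fcoef entry_trep// invg1 invgK mul1g (alpha_id act).
Qed.

Lemma CP_bounded X : CP X -> bounded_op X.
Proof. by case. Qed.

Lemma CP_linear X : CP X -> linear X.
Proof. by move=> cX; have [] := CP_bounded cX. Qed.

Lemma CP_approx X (e : R) : CP X -> 0 < e -> exists2 f, l1A A f & opbd (X - trep f) e.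
Proof.
move=> [bX clX] e0; have [_ [f lf <-] XY] := clX e e0; exists f => //.
by apply: opnorm_lt_opbd => //; apply: linear_fctB; [exact: bX.1|exact: (trep_spec lf).1.1].
Qed.

Lemma CP_intro X : bounded_op X ->
  (forall e : R, 0 < e -> exists2 f, l1A A f & opbd (X - trep f) e) -> CP X.
Proof.
move=> bX h; split => // e e0; have e2 : 0 < e / 2 by rewrite divr_gt0.
have [f lf Xf] := h _ e2; exists (trep f); first by exists f.
by apply: (opbd_opnorm_lt (ltW e2)) => //; lra.
Qed.

Lemma CP_trep f : l1A A f -> CP (trep f).
Proof.
move=> lf; apply: CP_intro; first exact: (trep_spec lf).1.
move=> e e0; exists f => //; rewrite subrr; apply: opbd_le (@opbd0 R _).
exact: ltW.
Qed.

Local Opaque crossed_product Defs.trep.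

Lemma CP_limit X : bounded_op X ->
  (forall e : R, 0 < e -> exists2 Y, CP Y & opbd (X - Y) e) -> CP X.
Proof.
move=> bX h; apply: CP_intro => // e e0; have e2 : 0 < e / 2 by rewrite divr_gt0.
have [Y cY XY] := h _ e2; have [f lf Yf] := CP_approx cY e2; exists f => //.
have -> : X - trep f = (X - Y) + (Y - trep f) by rewrite addrA subrK.
by apply: opbd_le (opbdD XY Yf); lra.
Qed.

Lemma CP_P c X Y : CP X -> CP Y -> CP (c *: X + Y).
Proof.
move=> cX cY; apply: CP_intro; first by apply: bounded_op_fctP; exact: CP_bounded.
move=> e e0; have n0 : 0 < normc c + 1 by rewrite ltr_wpDl// normc_ge0.
have d0 : 0 < e / 2 / (normc c + 1) by rewrite !divr_gt0.
have e2 : 0 < e / 2 by rewrite divr_gt0.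
have [f lf Xf] := CP_approx cX d0; have [g lg Yg] := CP_approx cY e2.
exists (fun s => c *: f s + g s); first exact: l1A_P.
rewrite trepP//.
have -> : c *: X + Y - (c *: trep f + trep g) = c *: (X - trep f) + (Y - trep g).
  by rewrite scalerBr opprD addrACA.
apply: opbd_le (opbdD (opbdZ c Xf) Yg).
have : normc c * (e / 2 / (normc c + 1)) <= e / 2.
  by rewrite mulrA ler_pdivrMr// mulrC ler_pM2l// lerDl.
lra.
Qed.

Lemma CP0 : CP 0.
Proof.
apply: CP_intro; first exact: bounded_op0.
move=> e e0; exists (fun=> 0).
  by apply: (@l1A_fin fset0) => // s; exact: (cstar0 AC).
rewrite (@trep_fin fset0) ?big_seq_fset0 ?subr0//; last by move=> s; exact: (cstar0 AC).
by apply: opbd_le (@opbd0 R _); exact: ltW.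
Qed.

Lemma CP_Z c X : CP X -> CP (c *: X).
Proof.
move=> cX; rewrite -[c *: X]addr0; apply: CP_P; first exact: cX.
exact: CP0.
Qed.

Lemma CP_B X Y : CP X -> CP Y -> CP (X - Y).
Proof. by move=> cX cY; rewrite addrC -scaleN1r; exact: CP_P. Qed.

Lemma CP_sum (T : Type) (r : seq T) (F : T -> K -> K) :
  (forall i, CP (F i)) -> CP (\sum_(i <- r) F i).
Proof.
move=> h; elim: r => [|i r IH]; first by rewrite big_nil; exact: CP0.
rewrite big_cons -[F i]scale1r; apply: CP_P; first exact: h.
exact: IH.
Qed.

Lemma CP_pilam r a : A a -> CP (pilam r a).
Proof.
move=> Aa; pose f s := if s == r then a else 0.
have Af s : A (f s) by rewrite /f; case: ifP => _ //; exact: (cstar0 AC).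
have f0 s : s \notin [fset r]%fset -> f s = 0.
  by rewrite !inE /f => /negbTE ->.
have -> : pilam r a = trep f.
  by rewrite (trep_fin Af f0) big_seq_fset1 /f eqxx.
exact/CP_trep/(l1A_fin Af f0).
Qed.

Lemma fcoef_mem r X : CP X -> A (fcoef r X).
Proof.
move=> cX; apply: (cstar_closed AC).
have /bounded_opP[hX [k k0 kX]] := CP_bounded cX; split.
  apply/bounded_opP; split; first exact: entry_linear.
  by exists k => //; exact: entry_opbd.
move=> e e0; have e2 : 0 < e / 2 by rewrite divr_gt0.
have [f lf Xf] := CP_approx cX e2; exists (f r); first exact: lf.1.
rewrite -(fcoef_trep r lf); apply: (opbd_opnorm_lt (ltW e2)); first lra.
exact: (entry_opbd 1%g r^-1%g Xf).
Qed.

(** The formula is [entry_trep] for [X = trep f] and passes to limits, since [alpha] is contractive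
    on [A]. It is the reason why Fourier coefficients determine [X]. *)
Lemma entry_CP X s t : CP X -> entry X s t = alpha s^-1%g (fcoef (s * t^-1)%g X).
Proof.
move=> cX; apply/eqP; rewrite -subr_eq0; apply/eqP; apply: opbd_small => e e0.
have e2 : 0 < e / 2 by rewrite divr_gt0.
have [f lf Xf] := CP_approx cX e2; have [Af _] := lf.
have cf := fcoef_mem (s * t^-1)%g cX.
have h1 := entry_opbd s t Xf; have h2 := entry_opbd 1%g (s * t^-1)^-1%g Xf.
rewrite entryB entry_trep// in h1.
rewrite entryB [entry (trep f) _ _](fcoef_trep _ lf) in h2.
have := alpha_opbd AC A1 act s^-1%g (cstarB AC cf (Af _)) (ltW e2) h2.
rewrite (linear_onB (alpha_linear act _))// => h3.
have := opbdB h1 h3; rewrite -splitr; congr opbd.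
by rewrite opprB addrA subrK.
Qed.

Lemma CP_ext X Y : CP X -> CP Y -> (forall r, fcoef r X = fcoef r Y) -> X = Y.
Proof.
move=> cX cY h; apply: eq_bounded_entries; [exact: CP_bounded|exact: CP_bounded|].
by move=> s t; rewrite !entry_CP// h.
Qed.

Lemma fcoef_pilam r s a : A a -> fcoef s (pilam r a) = if s == r then a else 0.
Proof.
move=> Aa; rewrite /fcoef (pilam_entry AC A1 act)// mul1g invgK; case: ifP => // _.
by rewrite invg1 (alpha_id act).
Qed.

Lemma cb_map_cbbd S : cb_map CP CP S -> exists2 M, 0 <= M & cbbd CP S M.
Proof.
move=> [Sl SC /lt_pinfty_bound[M M0 hM]]; exists M => //.
have S0 : S 0 = 0.
  by have := Sl (-1) 0 0 CP0 CP0; rewrite scaler0 addr0 scaleN1r addNr.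
apply: op_cbnorm_cbbd.
- exact: CP_linear.
- exact: CP_Z.
- by move=> c a Ca; have := Sl c a 0 Ca CP0; rewrite S0 !addr0.
- by move=> a Ca; exact/CP_linear/SC.
- exact: M0.
- exact: hM.
Qed.

(** Two completely bounded extensions agree on the dense set of all [trep f], hence on the crossed
    product. So any candidate [S0] computes [HS_map] there, while the values outside depend on the
    choice. *)
Lemma HS_mapP F S0 : cb_map CP CP S0 ->
  (forall f, l1A A f -> S0 (trep f) = trep (mulF F f)) ->
  cb_map CP CP (HS_map A alpha F) /\ forall X, CP X -> HS_map A alpha F X = S0 X.
Proof.
move=> cS hS; rewrite /HS_map; case: xgetP => [S _ [cS' hS']|/(_ S0)]; last by case.
split => // X cX; apply/eqP; rewrite -subr_eq0; apply/eqP; apply: opbd_small => e e0.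
have [M M0 hM] := cb_map_cbbd cS; have [N N0 hN] := cb_map_cbbd cS'.
have p : 0 < M + N + 1 by rewrite ltr_wpDl// addr_ge0.
have d : 0 < e / (M + N + 1) by rewrite divr_gt0.
have [f lf Xf] := CP_approx cX d; have cf := CP_trep lf.
have SB (S1 : (K -> K) -> K -> K) : cb_map CP CP S1 -> S1 (X - trep f) = S1 X - S1 (trep f).
  move=> [Sl _ _]; have := Sl (-1) _ _ cf cX.
  by rewrite !scaleN1r addrC [RHS]addrC.
have -> : S X - S0 X = S (X - trep f) - S0 (X - trep f).
  rewrite !SB// hS// hS'// opprB addrA subrK//.
apply: opbd_le (opbdB (cbbd_opbd hN N0 (CP_B cX cf) (ltW d) Xf)
  (cbbd_opbd hM M0 (CP_B cX cf) (ltW d) Xf)).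
rewrite -mulrDl mulrA ler_pdivrMr// mulrC ler_pM2l//.
by rewrite addrC lerDl.
Qed.

End Crossed.

(** * Schur multipliers *)

Section Orthonormal.
Variables (R : realType) (H : hilbertType R).

Definition orthonormal (E : finType) (e : E -> H) : Prop :=
  forall k l, hdot (e k) (e l) = (k == l)%:R.

Section Expansion.
Variables (E : finType) (e : E -> H).
Hypothesis eON : orthonormal e.

Lemma hdot_onsum (c : E -> R[i]) k : hdot (\sum_l c l *: e l) (e k) = c k.
Proof.
rewrite hdot_suml (bigD1 k)//= hdotZl eON eqxx mulr1 big1 ?addr0// => l /negbTE lk.
by rewrite hdotZl eON lk mulr0.
Qed.

Lemma hdot_sumr (F : E -> H) y : hdot y (\sum_k F k) = \sum_k hdot y (F k).
Proof.
rewrite hdotC hdot_suml rmorph_sum /=; apply: eq_bigr => k _.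
by rewrite [RHS]hdotC.
Qed.

Lemma hdot_proj y : hdot y (\sum_k hdot y (e k) *: e k) =
  (\sum_k normc (hdot y (e k)) ^+ 2)%:C.
Proof.
rewrite hdot_sumr rmorph_sum; apply: eq_bigr => k _.
transitivity ((normc (hdot y (e k)) ^+ 2)%:C); last by [].
by rewrite normc_sqr hdotZr mulrC.
Qed.

Lemma hnorm_onsum (c : E -> R[i]) :
  hnorm (\sum_k c k *: e k) ^+ 2 = \sum_k normc (c k) ^+ 2.
Proof.
set x := \sum_k c k *: e k; have xc k : hdot x (e k) = c k by exact: hdot_onsum.
have := hdot_proj x.
have -> : \sum_k hdot x (e k) *: e k = x by apply: eq_bigr => k _; rewrite xc.
rewrite hdotxx => /complexI ->.
by apply: eq_bigr => k _; rewrite xc.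
Qed.

Lemma bessel y : \sum_k normc (hdot y (e k)) ^+ 2 <= hnorm y ^+ 2.
Proof.
set p := \sum_k hdot y (e k) *: e k.
have := sqr_ge0 (hnorm (y - p)); rewrite hnormD_sqr hnormN_sqr.
have -> : hnorm p ^+ 2 = \sum_k normc (hdot y (e k)) ^+ 2 by exact: hnorm_onsum.
have -> : hdot y (- p) = - (\sum_k normc (hdot y (e k)) ^+ 2)%:C.
  by rewrite -scaleN1r hdotZr rmorphN rmorph1 mulN1r /p hdot_proj.
by rewrite /=; lra.
Qed.

End Expansion.

(** Each vector outside the span reached so far adds one point to the index type. Membership in the
    span is stated as the expansion itself, the form in which it is applied. *)
Lemma gram_schmidt (s : seq H) : exists (E : finType) (e : E -> H),
  orthonormal e /\ forall v, v \in s -> v = \sum_k hdot v (e k) *: e k.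
Proof.
elim: s => [|v s [E [e [eON es]]]].
  by exists void, (fun x : void => match x with end); split => // -[].
set w := v - \sum_k hdot v (e k) *: e k.
have [w0|w0] := eqVneq w 0.
  exists E, e; split => // x; rewrite inE => /orP[/eqP ->|/es//].
  by apply/eqP; rewrite -subr_eq0 -/w w0.
have wp : 0 < hnorm w.
  by rewrite lt_neqAle hnorm_ge0 andbT eq_sym; apply: contraNneq w0 => /hnorm_eq0 ->.
have we k : hdot w (e k) = 0 by rewrite /w hdotBl hdot_onsum// subrr.
have ew k : hdot (e k) w = 0 by rewrite hdotC we rmorph0.
pose c : R[i] := ((hnorm w)^-1)%:C.
have cc : Num.conj c = c by exact: conjc_real.
pose e' (x : unit + E) := if x is inr k then e k else c *: w.
have cw : c * c * (hnorm w ^+ 2)%:C = 1.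
  by rewrite -!rmorphM /= -expr2 exprVn mulVf ?rmorph1// expf_neq0// gt_eqF.
exists (unit + E)%type, e'; split.
  move=> [[]|k] [[]|l] /=.
  - by rewrite hdotZl hdotZr cc hdotxx mulrA cw.
  - by rewrite hdotZl we mulr0.
  - by rewrite hdotZr ew mulr0.
  - by rewrite eON.
move=> x xs; rewrite big_sumType /= (bigD1 tt)//= big1 ?addr0; last by case.
move: xs; rewrite inE => /orP[/eqP ->|xs]; last first.
  have xw : hdot x w = 0.
    by rewrite (es x xs) hdot_suml big1// => k _; rewrite hdotZl ew mulr0.
  by rewrite hdotZr xw mulr0 scale0r add0r; exact: es.
have vw : hdot v w = (hnorm w ^+ 2)%:C.
  rewrite -[v](subrK (\sum_k hdot v (e k) *: e k)) -/w hdotDl hdotxx.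
  by rewrite hdot_suml big1 ?addr0// => k _; rewrite hdotZl ew mulr0.
rewrite hdotZr cc vw scalerA mulrAC cw scale1r.
by rewrite /w subrK.
Qed.

End Orthonormal.

(** * Schur multipliers of scalar and operator matrices *)

Section ScalarMatrices.
Variable R : realType.
Local Notation C := (R[i]^o).

Definition smx (I : finType) (a : I -> I -> R[i]) : I -> I -> C -> C :=
  fun i j z => a i j *: z.

Lemma smx_linear (I : finType) (a : I -> I -> R[i]) : mxlin (smx a).
Proof. by move=> i j c x y; rewrite /smx scalerDr !scalerA mulrC. Qed.

Lemma hnorm_scalar (z : C) : hnorm z = normc (z : R[i]).
Proof.
apply/eqP; rewrite -(@eqrXn2 _ 2)// ?hnorm_ge0 ?normc_ge0//.
rewrite hnorm_sqr scalar_hdotE; have -> : Num.conj (z : R[i]) = conjc z by [].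
by rewrite -normc_sqr.
Qed.

Lemma smxE (I : finType) (a : I -> I -> R[i]) k : mxbd (smx a) k <->
  forall c : I -> R[i], \sum_i normc (\sum_j a i j * c j) ^+ 2 <=
    k ^+ 2 * \sum_j normc (c j) ^+ 2.
Proof.
have E (c : I -> R[i]) : (\sum_i hnorm (\sum_j smx a i j (c j)) ^+ 2 =
     \sum_i normc (\sum_j a i j * c j) ^+ 2) /\
   (\sum_j hnorm (c j : C) ^+ 2 = \sum_j normc (c j) ^+ 2).
  by split; apply: eq_bigr => i _; rewrite hnorm_scalar.
by split => h c; have := h c; rewrite (E c).1 (E c).2.
Qed.

(** [K] bounds the Schur multiplier [u(s t^-1)] on all finite scalar matrices. The family [s] may
    repeat group elements; the amplifications below depend on this, as they index rows by pairs of
    which only one component carries a group element. *)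
Definition schur_bd (G : groupType) (u : G -> R[i]) (K : R) : Prop :=
  forall (I : finType) (s : I -> G) (a : I -> I -> R[i]) k, 0 <= k ->
    mxbd (smx a) k ->
    mxbd (smx (fun i j => u (s i * (s j)^-1)%g * a i j)) (K * k).

Variable G : groupType.
Implicit Types (u v : G -> R[i]).

Lemma schur_bd1 u K : 0 <= K ->
  (forall (I : finType) (s : I -> G) (a : I -> I -> R[i]), mxbd (smx a) 1 ->
    mxbd (smx (fun i j => u (s i * (s j)^-1)%g * a i j)) K) -> schur_bd u K.
Proof.
move=> K0 h I s a k k0 ak; apply: mxbd_limit => [|e e0]; first exact: mulr_ge0.
have p : 0 < K + 1 by rewrite ltr_wpDl.
pose d := k + e / (K + 1).
have d0 : 0 < d by rewrite ltr_wpDl// divr_gt0.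
have nd : normc ((d^-1)%:C : R[i]) = d^-1.
  by rewrite /= expr0n addr0 sqrtr_sqr ger0_norm// invr_ge0 ltW.
have nD : normc (d%:C : R[i]) = d.
  by rewrite /= expr0n addr0 sqrtr_sqr ger0_norm// ltW.
have ad : mxbd (smx a) d by apply: mxbd_le ak => //; rewrite lerDl divr_ge0// ltW.
have a1 : mxbd (smx (fun i j => (d^-1)%:C * a i j)) 1.
  have := mxbdZ (d^-1)%:C ad; rewrite nd mulVf ?gt_eqF//; congr mxbd.
  by apply/funext => i; apply/funext => j; apply/funext => z; rewrite /smx scalerA.
apply: (@mxbd_le _ _ _ _ (K * d)); first by rewrite mulr_ge0// ltW.
  rewrite mulrDr lerD2l mulrA ler_pdivrMr// mulrC ler_pM2l//.
  by rewrite lerDl.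
have := mxbdZ d%:C (h I s _ a1); rewrite nD mulrC; congr mxbd.
apply/funext => i; apply/funext => j; apply/funext => z; rewrite /smx scalerA.
congr (_ *: _); rewrite mulrCA; congr (_ * _).
by rewrite mulrA -rmorphM /= mulfV ?gt_eqF// rmorph1 mul1r.
Qed.

Lemma schur_bdD u v K L : 0 <= K -> 0 <= L -> schur_bd u K -> schur_bd v L ->
  schur_bd (fun s => u s + v s) (K + L).
Proof.
move=> K0 L0 hu hv I s a k k0 ak; rewrite mulrDl.
have := mxbdD (mulr_ge0 K0 k0) (mulr_ge0 L0 k0) (hu I s a k k0 ak) (hv I s a k k0 ak).
congr mxbd; apply/funext => i; apply/funext => j; apply/funext => z.
by rewrite /smx !fctE -scalerDl -mulrDl.
Qed.

Lemma schur_bd_le u K L : 0 <= K -> K <= L -> schur_bd u K -> schur_bd u L.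
Proof.
move=> K0 KL hu I s a k k0 ak; apply: mxbd_le (hu I s a k k0 ak).
  exact: mulr_ge0.
exact: ler_wpM2r.
Qed.

(* Expanding along an orthonormal basis of the span of the finitely many
   vectors involved turns the operator matrix into a scalar one. *)
Lemma schur_bd_op (H : hilbertType R) u K : 0 <= K -> schur_bd u K ->
  forall (I : finType) (s : I -> G) (x : I -> I -> H -> H), mxlin x ->
  forall k, 0 <= k -> mxbd x k ->
  mxbd (fun i j => u (s i * (s j)^-1)%g *: x i j) (K * k).
Proof.
move=> K0 hu I s x hx k k0 xk v.
pose U i j := u (s i * (s j)^-1)%g.
pose y i := \sum_j U i j *: x i j (v j).
have [E [e [eON es]]] := gram_schmidt ([seq v j | j <- enum I] ++ [seq y i | i <- enum I]).
have InE (f : I -> H) i : f i \in [seq f j | j <- enum I].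
  by apply: map_f; rewrite mem_enum.
have ve j : v j = \sum_l hdot (v j) (e l) *: e l.
  by apply: es; rewrite mem_cat InE.
have ye i : y i = \sum_l hdot (y i) (e l) *: e l.
  by apply: es; rewrite mem_cat InE orbT.
pose b (p q : I * E) := hdot (x p.1 q.1 (e q.2)) (e p.2).
have bk : mxbd (smx b) k.
  apply/smxE => c; pose w j := \sum_l c (j, l) *: e l.
  rewrite !sum_pair /=.
  have -> : \sum_j \sum_l normc (c (j, l)) ^+ 2 = \sum_j hnorm (w j) ^+ 2.
    by apply: eq_bigr => j _; rewrite hnorm_onsum.
  apply: le_trans (xk w); apply: ler_sum => i _.
  apply: le_trans (bessel eON _); apply: ler_sum => m _.
  rewrite le_eqVlt; apply/orP; left; apply/eqP; congr (normc _ ^+ 2).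
  rewrite sum_pair hdot_suml; apply: eq_bigr => j _.
  rewrite /w linsum// hdot_suml; apply: eq_bigr => l _.
  by rewrite linZ// hdotZl mulrC.
have /smxE/(_ (fun q => hdot (v q.1) (e q.2))) := hu _ (fun p : I * E => s p.1) b k k0 bk.
rewrite !sum_pair /=.
have -> : \sum_i \sum_l normc (hdot (v i) (e l)) ^+ 2 = \sum_j hnorm (v j) ^+ 2.
  by apply: eq_bigr => j _; rewrite [in RHS]ve hnorm_onsum.
apply: le_trans; apply: ler_sum => i _.
rewrite -[\sum_j _]/(y i) {1}ye hnorm_onsum//; apply: ler_sum => m _.
rewrite le_eqVlt; apply/orP; left; apply/eqP; congr (normc _ ^+ 2).
rewrite sum_pair /y hdot_suml; apply: eq_bigr => j _ /=.
rewrite {1}ve linsum// scaler_sumr hdot_suml; apply: eq_bigr => l _.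
rewrite hdotZl linZ// hdotZl /b /=.
by rewrite -mulrA; congr (_ * _); rewrite mulrC.
Qed.

End ScalarMatrices.

(** * Multipliers of the Fourier algebra *)

Local Opaque mkl2 usum lambda_shift.

Section Regular.
Variables (R : realType) (G : groupType).
Local Notation C := (R[i]^o).
Local Notation K := (l2H G C).
Implicit Types (u v : G -> R[i]) (x y : K) (r s t : G).

Lemma lambda0E r x s : lambda0 r x s = x (r^-1 * s)%g.
Proof. exact: lambda_shiftE. Qed.

Lemma lambda0_linear r : linear (@lambda0 R G r).
Proof.
move=> c x y; apply: l2_ext => s; refine (eq_trans (lambda0E _ _ _) _).
by refine (eq_trans _ (f_equal2 (fun a b => c *: a + b) (esym (lambda0E r x s))
  (esym (lambda0E r y s)))).
Qed.

Lemma lambda0_opbd r : opbd (@lambda0 R G r) 1.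
Proof.
move=> x; rewrite mul1r -hnorm_unsquare ?hnorm_ge0//; apply: l2_le_sum => J.
apply: le_trans (shift_sum_le r x J); apply: ler_sum => s _.
by rewrite lambda0E.
Qed.

Lemma lambda0_sqr r x : hnorm (lambda0 r x) ^+ 2 <= hnorm x ^+ 2.
Proof.
by rewrite hnorm_unsquare ?hnorm_ge0//; rewrite -[leRHS]mul1r; exact: lambda0_opbd.
Qed.

Lemma lambda0M r s x : lambda0 (r * s)%g x = lambda0 r (lambda0 s x).
Proof. by apply: l2_ext => t; rewrite !lambda0E invgM mulgA. Qed.

Lemma lambda0_l2delta r s (h : C) : lambda0 r (l2delta s h) = l2delta (r * s)%g h.
Proof.
apply: l2_ext => t; rewrite lambda0E !l2deltaE.
have -> // : ((r^-1 * t)%g == s) = (t == (r * s)%g).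
by apply/eqP/eqP => [<-|->]; rewrite ?mulVKg ?mulKg.
Qed.

Lemma lambda0_bounded r c : bounded_op (c *: @lambda0 R G r).
Proof.
apply/bounded_opP; split.
  by rewrite -[_ *: _]addr0; apply: linear_fctP; [exact: lambda0_linear|exact: linear_fct0].
by exists (normc c * 1); [rewrite mulr1 normc_ge0|apply/opbdZ/lambda0_opbd].
Qed.

Section LambdaMatrix.
Variables (I : finType) (s : I -> G) (b : I -> I -> R[i]).

Definition lammx (i j : I) : K -> K := b i j *: @lambda0 R G (s i * (s j)^-1)%g.

Lemma lammx_linear : mxlin lammx.
Proof. by move=> i j; have [] := lambda0_bounded (s i * (s j)^-1)%g (b i j). Qed.

(** The amplification [b (x) 1] acts separately at each coordinate of [G]. *)
Lemma amplify_smx k (y : I -> K) : mxbd (smx b) k ->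
  \sum_i hnorm (\sum_j b i j *: y j) ^+ 2 <= k ^+ 2 * \sum_j hnorm (y j) ^+ 2.
Proof.
move=> bk; apply: hnorm2_sup => J; rewrite exchange_big /=.
apply: (@le_trans _ _ (\sum_(t <- J) k ^+ 2 * \sum_j hnorm (y j t) ^+ 2)).
  apply: ler_sum => t _; apply: le_trans (bk (fun j => y j t)).
  by apply: ler_sum => i _; rewrite l2_sumE.
rewrite -mulr_sumr ler_wpM2l ?sqr_ge0// exchange_big /=.
by apply: ler_sum => j _; exact: l2_sum_le.
Qed.

(* Conjugation by diag(lambda_{s_i}) turns [lammx] into [b_ij (x) 1]. *)
Lemma lammx_bd k : mxbd (smx b) k -> mxbd lammx k.
Proof.
move=> bk v; pose w j := lambda0 (s j)^-1%g (v j).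
apply: (@le_trans _ _ (k ^+ 2 * \sum_j hnorm (w j) ^+ 2)); last first.
  rewrite ler_wpM2l ?sqr_ge0//; apply: ler_sum => j _.
  exact: lambda0_sqr.
apply: le_trans (amplify_smx w bk); apply: ler_sum => i _.
have -> : \sum_j lammx i j (v j) = lambda0 (s i) (\sum_j b i j *: w j).
  rewrite (linsum _ _ _ (lambda0_linear (s i))); apply: eq_bigr => j _.
  by rewrite (linZ _ _ (lambda0_linear (s i))) -lambda0M.
exact: lambda0_sqr.
Qed.

(** [lambda_{s_i s_j^-1}] sends the basis vector at [s_j] to the one at [s_i], so on vectors [c_j]
    placed at [s_j] the matrix acts as [b]. *)
Lemma lammx_scalar k : mxbd lammx k -> mxbd (smx b) k.
Proof.
move=> h c; have := h (fun j => l2delta (s j) (c j)).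
have -> : \sum_j hnorm (l2delta (s j) (c j)) ^+ 2 = \sum_j hnorm (c j) ^+ 2.
  by apply: eq_bigr => j _; rewrite hnorm_l2delta.
apply: le_trans; rewrite le_eqVlt; apply/orP; left; apply/eqP.
apply: eq_bigr => i _; rewrite -(hnorm_l2delta (s i)); congr (hnorm _ ^+ 2).
rewrite l2delta_sum; apply: eq_bigr => j _.
by rewrite /lammx /smx !fctE lambda0_l2delta -mulgA mulVg mulg1 l2deltaZ.
Qed.

End LambdaMatrix.

Lemma lambda0_sum_single r (c : R[i]) (f : G -> R[i]) :
  f = (fun s => if s == r then c else 0) ->
  l1C f /\ lambda0_sum f = c *: @lambda0 R G r.
Proof.
move=> fE; have f0 s : s != r -> f s = 0 by rewrite fE => /negbTE ->.
have sumE (J : {fset G}) : (fset1 r `<=` J)%fset ->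
    \sum_(s <- J) f s *: @lambda0 R G s = c *: @lambda0 R G r.
  move=> rJ; rewrite (@fsum_single _ _ _ r) => [|s /f0 ->]; last by rewrite scale0r.
  by rewrite (fsubsetP rJ) ?inE// fE eqxx.
split.
  apply: (@le_lt_trans _ _ (normc c)%:E); last exact: ltry.
  apply: ge_ereal_sup => _ [J [finJ _] <-]; rewrite fsbig_finite//.
  rewrite sumEFin lee_fin (@fsum_single _ _ _ r) => [|s /f0 ->]; last exact: normc0.
  by case: ifP => _; rewrite ?normc_ge0// fE eqxx.
apply: usum_opE.
- by move=> s; have [] := lambda0_bounded s (f s).
- exact: lambda0_bounded.
move=> e e0; exists (fset1 r) => J rJ; rewrite sumE// subrr.
by apply: opbd_opnorm; [exact: ltW|apply: opbd_le (@opbd0 R K); exact: ltW].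
Qed.

(** The multiplier is tested on the matrix of point masses of weight [a_ij] at [s_i s_j^-1]. It is
    represented by [lammx], whose norm is controlled by that of [a]; the image is the [lammx] of the
    Schur product, which [lammx_scalar] turns back into a scalar matrix. *)
Lemma schur_bd_multiplier u M : 0 <= M -> (cb_multiplier_norm u <= M%:E)%E ->
  schur_bd u M.
Proof.
move=> M0 hu; apply: schur_bd1 => // I s a a1.
pose n := #|I|; pose ev : 'I_n -> I := enum_val.
pose r i j := (s (ev i) * (s (ev j))^-1)%g.
pose f (i j : 'I_n) := fun t => if t == r i j then a (ev i) (ev j) else 0.
have fE i j := @lambda0_sum_single (r i j) (a (ev i) (ev j)) (f i j) erefl.
have uE i j : mulu u (f i j) = fun t => if t == r i j then u (r i j) * a (ev i) (ev j) else 0.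
  by apply/funext => t; rewrite /mulu /f; case: eqP => [->|_] //; rewrite mulr0.
have h1 : (lambda0_mxnorms f <= 1%:E)%E.
  apply: mxbd_mxnorm => //.
  have -> : (fun i j => lambda0_sum (f i j)) = lammx (s \o ev) (fun i j => a (ev i) (ev j)).
    by apply/funext => i; apply/funext => j; rewrite (fE i j).2.
  apply: lammx_bd; exact: (mxbd_inj (@enum_val_inj I predT) (smx_linear a) a1).
have h2 : (lambda0_mxnorms (fun i j => mulu u (f i j)) <= M%:E)%E.
  apply: le_trans hu; apply: ereal_sup_ubound; exists n, f; split => //.
  by move=> i j; exact: (fE i j).1.
have h3 : mxbd (lammx (s \o ev) (fun i j => u (r i j) * a (ev i) (ev j))) M.
  apply: mxnorm_mxbd M0 _; first exact: lammx_linear.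
  have -> : lammx (s \o ev) (fun i j => u (r i j) * a (ev i) (ev j)) =
      fun i j => lambda0_sum (mulu u (f i j)).
    apply/funext => i; apply/funext => j; apply: esym.
    exact: (lambda0_sum_single (uE i j)).2.
  exact: h2.
have := mxbd_inj (@enum_rank_inj I) (@smx_linear _ _ _) (lammx_scalar h3).
congr mxbd; apply/funext => i; apply/funext => j; apply/funext => z.
by rewrite /smx /r /ev !enum_rankK.
Qed.

(** Applied to [c], the Schur product has coordinates [(lambda_{s_i} (\sum_j a_ij w_j), y)] with
    [w_j = c_j lambda_{s_j^-1} x]. The amplified [a] and Cauchy-Schwarz bound them. The Schur norm
    is thus continuous in [x] and [y], which permits truncating these vectors. *)
Lemma coeff_schur x y : schur_bd (coeff x y) (hnorm x * hnorm y).
Proof.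
move=> I s a k k0 ak; apply/smxE => c.
pose w j := c j *: lambda0 (s j)^-1%g x.
have zE i : \sum_j coeff x y (s i * (s j)^-1)%g * a i j * c j =
    hdot (lambda0 (s i) (\sum_j a i j *: w j)) y.
  rewrite (linsum _ _ _ (lambda0_linear (s i))) hdot_suml; apply: eq_bigr => j _.
  rewrite /w scalerA (linZ _ _ (lambda0_linear (s i))) hdotZl -lambda0M -mulrA.
  by rewrite mulrC.
have wn j : hnorm (w j) ^+ 2 <= normc (c j) ^+ 2 * hnorm x ^+ 2.
  rewrite -exprMn hnorm_unsquare ?mulr_ge0 ?hnorm_ge0 ?normc_ge0// hnormZ.
  rewrite ler_wpM2l ?normc_ge0//.
  by rewrite -[leRHS]mul1r; exact: lambda0_opbd.
apply: (@le_trans _ _ (\sum_i hnorm (\sum_j a i j *: w j) ^+ 2 * hnorm y ^+ 2)).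
  apply: ler_sum => i _; rewrite zE -exprMn.
  rewrite hnorm_unsquare ?mulr_ge0 ?hnorm_ge0 ?normc_ge0//.
  apply: le_trans (normc_hdot_CS _ _) _; rewrite ler_wpM2r ?hnorm_ge0//.
  by rewrite -[leRHS]mul1r; exact: lambda0_opbd.
rewrite -mulr_suml.
apply: (@le_trans _ _ (k ^+ 2 * (\sum_j normc (c j) ^+ 2 * hnorm x ^+ 2) * hnorm y ^+ 2)).
  rewrite ler_wpM2r ?sqr_ge0//; apply: le_trans (amplify_smx w ak) _.
  by rewrite ler_wpM2l ?sqr_ge0//; apply: ler_sum => j _; exact: wn.
rewrite -mulr_suml !exprMn le_eqVlt; apply/orP; left; apply/eqP; ring.
Qed.

Lemma coeffDl x x' y : coeff (x + x') y = fun s => coeff x y s + coeff x' y s.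
Proof.
by apply/funext => s; rewrite /coeff (linD _ _ (lambda0_linear s)) hdotDl.
Qed.

Lemma coeffDr x y y' : coeff x (y + y') = fun s => coeff x y s + coeff x y' s.
Proof. by apply/funext => s; rewrite /coeff hdotDr. Qed.

Lemma coeff_l2delta s t r : coeff (l2delta s (1 : C)) (l2delta t (1 : C)) r = ((r * s)%g == t)%:R :> R[i].
Proof.
rewrite /coeff lambda0_l2delta hdot_l2delta l2deltaE eq_sym.
case: eqP => _; last exact: hdot0l.
by rewrite scalar_hdotE mul1r; exact: conjc1.
Qed.

Lemma coeff_trunc_support (J J' : {fset G}) x y :
  exists D : {fset G}, forall r, r \notin D -> coeff (trunc J x) (trunc J' y) r = 0.
Proof.
exists [fset (t * s^-1)%g | t in J', s in J]%fset => r rD.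
rewrite /coeff /trunc (linsum _ _ _ (lambda0_linear r)) hdot_suml big_seq big1// => s sJ.
rewrite lambda0_l2delta hdotC hdot_suml big_seq big1 ?rmorph0// => t tJ.
rewrite hdotC hdot_l2delta l2deltaE; case: eqP => [e|_]; last by rewrite hdot0l rmorph0.
case/negP: rD; apply/imfset2P; exists t => //; exists s => //.
by rewrite e mulgK.
Qed.

(** Three errors of [e / 3]: from [u] to a coefficient function, and from each of its two vectors to
    a truncation. *)
Lemma Acb_approx u (e : R) : AcbG u -> 0 < e ->
  exists (v : G -> R[i]) (D : {fset G}), (forall r, r \notin D -> v r = 0) /\
    schur_bd (fun s => u s - v s) e.
Proof.
move=> [_ hu] e0; have e3 : 0 < e / 3 by rewrite divr_gt0.
have [v0 [x [y v0E]] uv0] := hu _ e3.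
have x1 : 0 < hnorm y + 1 by rewrite ltr_wpDl ?hnorm_ge0.
have [J hJ] := trunc_approx x (divr_gt0 e3 x1); have {}hJ := hJ J (fsubset_refl _).
(* The error in [y] is paired with the truncated [x], so its tolerance is fixed after [J]. *)
have y1 : 0 < hnorm (trunc J x) + 1 by rewrite ltr_wpDl ?hnorm_ge0.
have [J' hJ'] := trunc_approx y (divr_gt0 e3 y1); have {}hJ' := hJ' J' (fsubset_refl _).
have [D hD] := coeff_trunc_support J J' x y.
exists (coeff (trunc J x) (trunc J' y)), D; split => //.
have s1 := schur_bd_multiplier (ltW e3) (ltW uv0).
have s2 : schur_bd (coeff (x - trunc J x) y) (e / 3).
  apply: schur_bd_le (coeff_schur _ _); first by rewrite mulr_ge0 ?hnorm_ge0.
  apply: (@le_trans _ _ (e / 3 / (hnorm y + 1) * (hnorm y + 1))).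
    by apply: ler_pM; rewrite ?hnorm_ge0// lerDl.
  by rewrite divfK// gt_eqF.
have s3 : schur_bd (coeff (trunc J x) (y - trunc J' y)) (e / 3).
  apply: schur_bd_le (coeff_schur _ _); first by rewrite mulr_ge0 ?hnorm_ge0.
  apply: (@le_trans _ _ ((hnorm (trunc J x) + 1) * (e / 3 / (hnorm (trunc J x) + 1)))).
    by apply: ler_pM; rewrite ?hnorm_ge0// lerDl.
  by rewrite mulrC divfK// gt_eqF.
have := schur_bdD (addr_ge0 (ltW e3) (ltW e3)) (ltW e3)
  (schur_bdD (ltW e3) (ltW e3) s1 s2) s3.
have -> : e / 3 + e / 3 + e / 3 = e by field.
congr schur_bd; apply/funext => s.
have h1 : coeff x y s = coeff (x - trunc J x) y s + coeff (trunc J x) y s.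
  by rewrite -[x in LHS](subrK (trunc J x)) coeffDl.
have h2 : coeff (trunc J x) y s = coeff (trunc J x) (y - trunc J' y) s +
    coeff (trunc J x) (trunc J' y) s.
  by rewrite -[y in LHS](subrK (trunc J' y)) coeffDr.
rewrite v0E h1 h2; move: (u s) (coeff (x - trunc J x) y s)
  (coeff (trunc J x) (y - trunc J' y) s) (coeff (trunc J x) (trunc J' y) s).
by move=> p q r t; ring.
Qed.

Lemma hdot_lspan_lambda0 (Y : K -> K) x y x' y' : lspan (range (@lambda0 R G)) Y ->
  coeff x y = coeff x' y' -> hdot (Y x) y = hdot (Y x') y'.
Proof.
move=> [n [c [Z [hZ ->]]]] xy; rewrite !fct_sumE !hdot_suml; apply: eq_bigr => k _.
have [r _ <-] := hZ k; rewrite !fctE !hdotZl; congr (_ * _).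
exact: (congr1 (fun f => f r) xy).
Qed.

(** [pairing] picks some vectors that represent the coefficient function. On the span of the
    [lambda0 r] the value depends on the function alone, and this persists in the weak closure. *)
Lemma pairingE (X : K -> K) x y : group_vN X -> pairing (coeff x y) X = hdot (X x) y.
Proof.
move=> [_ hX]; rewrite /pairing.
case: xgetP => [c _ [x' [y' [xy ->]]]|/(_ (hdot (X x) y))]; last by case; exists x, y.
apply/eqP; rewrite -subr_eq0; apply/eqP/eq0_normc/eqP.
rewrite eq_le normc_ge0 andbT; apply/ler_addgt0Pr => e e0.
have e2 : 0 < e / 2 by rewrite divr_gt0.
(* Both representing pairs are listed together, so that one weak approximant serves them
   simultaneously. *)
pose xx (i : 'I_2) := if i == ord0 then x else x'.
pose yy (i : 'I_2) := if i == ord0 then y else y'.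
have [Y sY hY] := hX 2 xx yy _ e2.
have := hY ord0; have := hY ord_max; rewrite /xx /yy /= !hdotBl => h1 h2.
have -> : hdot (X x') y' - hdot (X x) y =
   (hdot (X x') y' - hdot (Y x') y') - (hdot (X x) y - hdot (Y x) y).
  by rewrite (hdot_lspan_lambda0 sY xy); ring.
rewrite add0r; apply: le_trans (le_normcD _ _) _; rewrite normcN.
by rewrite [leRHS]splitr; apply: lerD; exact: ltW.
Qed.

Lemma group_vN_lambda0 (c : R[i]) r : group_vN (c *: @lambda0 R G r).
Proof.
split; first exact: lambda0_bounded.
move=> n x y e e0; exists (c *: @lambda0 R G r).
  exists 1%N, (fun=> c), (fun=> @lambda0 R G r); split; first by move=> _; exists r.
  by rewrite big_ord1.
by move=> k; rewrite subrr hdot0l normc0.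
Qed.

(* [w p q] is the indicator function of [g_p g_q^-1], and the matrix [w] has
   norm at most 1.  Pairing [u w] with [lammx s a] and restricting to the
   indices [(idx i, i)] yields the Schur product. *)
Lemma schur_bd_McbA u : McbA u -> exists2 M, 0 <= M & schur_bd u M.
Proof.
move=> [uA /lt_pinfty_bound[M M0 hM]]; exists M => //.
apply: schur_bd1 => // I s a a1.
(* Finite sections are taken along distinct group elements, whereas [s] may repeat them; [idx]
   restores the repetitions. *)
have [n [g [idx [ginj gidx]]]] : exists n (g : 'I_n -> G) (idx : I -> 'I_n),
    injective g /\ forall i, g (idx i) = s i.
  pose J := [fset s i | i : I]%fset; pose P : finType := J.
  have sJ i : s i \in J by apply/imfsetP; exists i.
  exists #|P|, (fun p => val (enum_val p : P)), (fun i => enum_rank ([` sJ i]%fset : P)).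
  split; first by move=> p q /val_inj/enum_val_inj.
  by move=> i; rewrite enum_rankK.
pose w (p q : 'I_n) := coeff (l2delta (g q) (1 : C)) (l2delta (g p) (1 : C)).
have wA : mx_over (@fourier_algebra R G) w.
  by move=> p q; exists (l2delta (g q) (1 : C)), (l2delta (g p) (1 : C)).
(* Pairing [w p q] with [X k l] gives the entry of [X k l] at [(g p, g q)], so the resulting scalar
   matrix is a finite section of [X], up to the order of the two indices. *)
have w1 : (fourier_mxnorms w <= 1%:E)%E.
  apply: ge_ereal_sup => _ [m [X [hX X1 ->]]].
  pose b (p q : 'I_n * 'I_m) := pairing (w p.1 q.1) (X p.2 q.2).
  apply: (@mxbd_mxnorm _ _ _ (smx b)) => //.
  have Xl : mxlin X by move=> k l; have [[]] := hX k l.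
  have Xb := mxnorm_mxbd Xl ler01 X1.
  have sec := mxbd_section ginj Xl Xb.
  have swap : injective (fun pk : 'I_n * 'I_m => (pk.2, pk.1)).
    by move=> [p k] [q l] [-> ->].
  have el : mxlin (fun a b : 'I_m * 'I_n => entry (X a.1 b.1) (g a.2) (g b.2)).
    by move=> k l; apply: entry_linear; exact: Xl.
  have := mxbd_inj swap el sec; congr mxbd.
  apply/funext => -[p k]; apply/funext => -[q l]; apply/funext => z /=.
  rewrite /smx /b /= /w (pairingE _ _ (hX k l)) hdot_l2delta scalar_hdotE /entry.
  have -> : l2delta (g q) z = (z : R[i]) *: l2delta (g q) (1 : C).
    rewrite -l2deltaZ; congr l2delta; exact: (esym (mulr1 (z : R[i]))).
  rewrite (linZ _ _ (Xl k l)).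
  have -> : Num.conj (1 : R[i]) = 1 by exact: conjc1.
  rewrite mulr1; exact: mulrC.
have uw : (fourier_mxnorms (fun p q => mulu u (w p q)) <= M%:E)%E.
  by apply: le_trans hM; apply: ereal_sup_ubound; exists n, w.
pose m := #|I|; pose ev : 'I_m -> I := enum_val.
pose X := lammx (s \o ev) (fun k l => a (ev k) (ev l)).
have hX k l : group_vN (X k l) by exact: group_vN_lambda0.
have X1 : (mxnorm X <= 1%:E)%E.
  apply: mxbd_mxnorm => //; apply: lammx_bd.
  exact: (mxbd_inj (@enum_val_inj I predT) (smx_linear a) a1).
pose b (p q : 'I_n * 'I_m) := pairing (mulu u (w p.1 q.1)) (X p.2 q.2).
have bM : mxbd (smx b) M.
  apply: mxnorm_mxbd M0 _; first exact: smx_linear.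
  by apply: le_trans uw; apply: ereal_sup_ubound; exists m, X.
have f_inj : injective (fun i : I => (idx i, enum_rank i)).
  by move=> i j [_ /enum_rank_inj].
have := mxbd_inj f_inj (smx_linear b) bM; congr mxbd.
apply/funext => i; apply/funext => j; apply/funext => z.
rewrite /smx /b /=; congr (_ *: _).
have [x [y xyE]] := uA _ (wA (idx i) (idx j)).
rewrite xyE (pairingE _ _ (hX _ _)) /X /lammx !fctE /= hdotZl /ev !enum_rankK mulrC.
congr (_ * _).
have -> : hdot (lambda0 (s i * (s j)^-1)%g x) y = coeff x y (s i * (s j)^-1)%g by [].
by rewrite -xyE /mulu /w coeff_l2delta !gidx -mulgA mulVg mulg1 eqxx mulr1.
Qed.

End Regular.

(** * The maps S_F *)

Section FiniteDimension.
Variables (R : realType) (V : lmodType R[i]).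

Lemma lspan_rangeP (E : finType) (b : E -> V) y :
  lspan (range b) y <-> exists c : E -> R[i], y = \sum_k c k *: b k.
Proof.
split=> [[n [c [x [hx ->]]]]|[c ->]].
  have [j hj] := choice (fun k => let: ex_intro2 j _ e := hx k in ex_intro _ j e).
  exists (fun l => \sum_(k | j k == l) c k).
  rewrite (partition_big j xpredT)//=; apply: eq_bigr => l _.
  by rewrite scaler_suml; apply: eq_bigr => k /eqP <-; rewrite hj.
exists #|E|, (fun k => c (enum_val k)), (fun k => b (enum_val k)); split.
  by move=> k; exists (enum_val k).
by rewrite (reindex_onto (@enum_val E predT) enum_rank)/=;
  [apply: eq_bigl => k; rewrite enum_valK eqxx|move=> k _; rewrite enum_rankK].
Qed.

Lemma finite_dim_range (E : finType) (b : E -> V) : finite_dim (lspan (range b)).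
Proof.
exists #|E|, (fun k => b (enum_val k)); congr lspan; apply/seteqP; split.
  by move=> _ [k _ <-]; exists (enum_rank k); rewrite ?enum_rankK.
by move=> _ [k _ <-]; exists (enum_val k).
Qed.

Lemma subspace_finite_basis n (b : 'I_n -> V) (W : set V) :
  W 0 -> (forall (c : R[i]) x y, W x -> W y -> W (c *: x + y)) ->
  (forall w, W w -> exists c : 'I_n -> R[i], w = \sum_k c k *: b k) ->
  exists (E : finType) (b' : E -> V), (forall k, W (b' k)) /\
    forall w, W w -> exists c : E -> R[i], w = \sum_k c k *: b' k.
Proof.
elim: n b W => [|n IH] b W W0 WP hW.
  exists 'I_0, b; split => [[]//|w /hW[c ->]]; exists c => //.
pose b1 k := b (widen_ord (leqnSn n) k).
pose rep (c : 'I_n.+1 -> R[i]) := \sum_k c k *: b k.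
have repE c : rep c = \sum_k c (widen_ord (leqnSn n) k) *: b1 k + c ord_max *: b ord_max.
  by rewrite /rep big_ord_recr.
(* [w0] is a pivot, an element of [W] with nonzero last coordinate. If there is none, the remaining
   vectors of [b] already suffice. *)
have [[w0 [c0 [Ww0 w0E c00]]]|hn] := pselect (exists w0 c, [/\ W w0, w0 = rep c & c ord_max != 0]);
  last first.
  apply: (IH b1 W W0 WP) => w Ww; have [c wE] := hW w Ww.
  have [c0|c0] := eqVneq (c ord_max) 0; last by case: hn; exists w, c.
  exists (fun k => c (widen_ord (leqnSn n) k)).
  by rewrite {1}wE -[LHS]/(rep c) repE c0 scale0r addr0.
pose W' := [set w | W w /\ exists c : 'I_n -> R[i], w = \sum_k c k *: b1 k].
have [||w [_ //]|E [b' [hb' hE]]] := IH b1 W'.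
- by split => //; exists (fun=> 0); rewrite big1// => k _; rewrite scale0r.
- move=> c x y [Wx [d dE]] [Wy [f fE]]; split; first exact: WP.
  exists (fun k => c * d k + f k); rewrite dE fE scaler_sumr -big_split.
  by apply: eq_bigr => k _; rewrite /= scalerDl scalerA.
exists (unit + E)%type, (fun x => if x is inr k then b' k else w0); split.
  by move=> [_|k] //; exact: (hb' k).1.
move=> w Ww; have [c wE] := hW w Ww.
pose d := c ord_max / c0 ord_max.
have : W' (w - d *: w0).
  split; first by rewrite addrC -scaleNr; exact: WP.
  exists (fun k => c (widen_ord (leqnSn n) k) - d * c0 (widen_ord (leqnSn n) k)).
  rewrite {1}wE -[\sum_k _]/(rep c) w0E !repE.
  rewrite scalerDr scalerA divfK// opprD addrACA subrr addr0.
  rewrite scaler_sumr -sumrB; apply: eq_bigr => k _.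
  by rewrite scalerBl scalerA.
move=> /hE[f fE]; exists (fun x => if x is inr k then f k else d).
rewrite big_sumType /= (bigD1 tt)//= big1 ?addr0; last by case.
by rewrite -fE addrC subrK.
Qed.

End FiniteDimension.

Local Opaque mkl2 usum pi_rep lambda_shift crossed_product trep pilam.

Section Multipliers.
Variables (R : realType) (G : groupType) (H : hilbertType R) (A : set (H -> H)).
Variable alpha : G -> (H -> H) -> H -> H.
Hypotheses (AC : cstar_algebra A) (A1 : A idfun) (act : action_on A alpha).
Local Notation K := (l2H G H).
Local Notation CP := (crossed_product A alpha).
Local Notation trep := (trep alpha).
Local Notation pilam := (pilam alpha).
Implicit Types (T : (H -> H) -> H -> H) (u v : G -> R[i]).

Lemma cb_map_alg_cbbd T : cb_map A A T -> exists2 M, 0 <= M & cbbd A T M.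
Proof.
move=> [Tl TA /lt_pinfty_bound[M M0 hM]]; exists M; first exact: M0.
apply: op_cbnorm_cbbd.
- exact: cstar_linear.
- exact: cstarZ.
- exact: (linear_onZ AC Tl).
- by move=> a Aa; exact/(cstar_linear AC)/TA.
- exact: M0.
- exact: hM.
Qed.

Lemma l1A_mulF (F : G -> (H -> H) -> H -> H) (B : R) (f : G -> H -> H) : 0 <= B ->
  (forall t a k, A a -> 0 <= k -> opbd a k -> A (F t a) /\ opbd (F t a) (B * k)) ->
  l1A A f -> l1A A (mulF F f).
Proof.
move=> B0 hF lf; have [k [k0 fk [L hL]]] := l1A_summable AC lf; have [Af _] := lf.
apply: (@summable_l1A _ _ _ _ _ (fun s => B * k s) (B * L)).
- by move=> s; exact: (hF s _ _ (Af s) (k0 s) (fk s)).1.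
- by move=> s; exact: mulr_ge0.
- by move=> s; exact: (hF s _ _ (Af s) (k0 s) (fk s)).2.
by move=> J; rewrite -mulr_sumr; exact: ler_wpM2l.
Qed.

Lemma FTu_cbbd T u M t : cbbd A T M -> cbbd A (FTu T u t) (normc (u t) * M).
Proof.
by move=> hT I x Ax C C0 xC; rewrite -mulrA; exact: (mxbdZ (u t) (hT I x Ax C C0 xC)).
Qed.

Lemma FTu_mem T u t a : cb_map A A T -> A a -> A (FTu T u t a).
Proof. by move=> [_ TA _] Aa; apply: (cstarZ AC); exact: TA. Qed.

Lemma FTu_cb_map T u t : cb_map A A T -> cb_map A A (FTu T u t).
Proof.
move=> cT; have [M M0 hM] := cb_map_alg_cbbd cT; have [Tl TA _] := cT; split.
- by move=> c x y Ax Ay; rewrite /FTu Tl// scalerDr !scalerA mulrC.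
- by move=> a; exact: FTu_mem.
apply: le_lt_trans (ltry (normc (u t) * M)); apply: cbbd_op_cbnorm.
- exact: cstar_linear.
- by rewrite mulr_ge0// normc_ge0.
- exact: FTu_cbbd.
Qed.

Lemma HS_multiplier_intro T u (B N : R) : cb_map A A T -> 0 <= N ->
  (forall t, normc (u t) <= B) ->
  (forall f, l1A A f -> l1A A (mulF (FTu T u) f)) ->
  (forall n (f : 'I_n -> 'I_n -> G -> H -> H), (forall i j, l1A A (f i j)) ->
     mxbd (fun i j => trep (f i j) : K -> K) 1 ->
     mxbd (fun i j => trep (mulF (FTu T u) (f i j)) : K -> K) N) ->
  HS_multiplier A alpha (FTu T u).
Proof.
move=> cT N0 uB lF hN; have [M M0 hM] := cb_map_alg_cbbd cT; split.
- by move=> t; exact: FTu_cb_map.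
- exists (B * M) => t; apply: (@le_trans _ _ (normc (u t) * M)%:E).
    apply: cbbd_op_cbnorm; first exact: cstar_linear.
      by rewrite mulr_ge0// normc_ge0.
    exact: FTu_cbbd.
  by rewrite lee_fin ler_wpM2r.
apply: le_lt_trans (ltry N); apply: ge_ereal_sup => _ [n [f [lf f1 ->]]].
apply: mxbd_mxnorm N0 _; apply: hN; first exact: lf.
apply: mxnorm_mxbd ler01 f1 => i j.
exact: (CP_linear (CP_trep AC A1 act (lf i j))).
Qed.

(** * The map S_F for invariant T and a bounded Schur multiplier u *)

Section SchurTimesInvariant.
Variables (T : (H -> H) -> H -> H) (M : R).
Hypotheses (cT : cb_map A A T) (iT : alpha_invariant A alpha T).
Hypotheses (M0 : 0 <= M) (hM : cbbd A T M).

(* In matrix form [S_F] applies [T] to every entry and multiplies the entry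
   [(s, t)] by [u(s t^-1)]. *)
Lemma mxbd_FTu u B (I : finType) (X L : I -> I -> K -> K) C : 0 <= B -> schur_bd u B ->
  (forall i j, CP (X i j)) -> (forall i j, CP (L i j)) ->
  (forall i j r, fcoef r (L i j) = u r *: T (fcoef r (X i j))) ->
  0 <= C -> mxbd X C -> mxbd L (B * (M * C)).
Proof.
move=> B0 uB cX cL LE C0 XC; have [_ TA _] := cT; have [Tl _ _] := cT.
have Ll : mxlin L by move=> i j; exact: (CP_linear (cL i j)).
have Xl : mxlin X by move=> i j; exact: (CP_linear (cX i j)).
have [k k0 hk] := bounded_op_uniform (fun i j => CP_bounded (cL i j)).
apply: (mxbd_sections Ll k0 hk); first by rewrite !mulr_ge0.
move=> P g ginj.
have Aent i j s t : A (entry (X i j) s t).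
  rewrite (entry_CP AC A1 act s t (cX i j)); apply: (alpha_mem act).
  exact: (fcoef_mem AC A1 act _ (cX i j)).
have Tent := hM (fun a b : I * P => Aent a.1 b.1 (g a.2) (g b.2)) C0
  (mxbd_section ginj Xl XC).
have := @schur_bd_op _ _ _ u B B0 uB _ (fun a : I * P => g a.2) _ _ _ (mulr_ge0 M0 C0) Tent.
move=> /(_ (fun a b => cstar_linear AC (TA _ (Aent _ _ _ _)))); congr mxbd.
apply/funext => a; apply/funext => b.
have cA := fcoef_mem AC A1 act (g a.2 * (g b.2)^-1)%g (cX a.1 b.1).
rewrite (entry_CP AC A1 act _ _ (cL a.1 b.1)) LE.
rewrite (linear_onZ AC (alpha_linear act _) _ (TA _ cA)) (iT _ cA).
by rewrite (entry_CP AC A1 act _ _ (cX a.1 b.1)).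
Qed.

(** Tested on a 2 by 2 matrix unit with group elements [t] and [1]: the Schur product is [u t] times
    that matrix unit. *)
Lemma schur_bd_normc u B t : 0 <= B -> schur_bd u B -> normc (u t) <= B.
Proof.
move=> B0 uB.
have a1 : mxbd (smx (fun i j : bool => (i && ~~ j)%:R : R[i])) 1.
  apply/smxE => c; rewrite !big_bool /= !mul0r !mul1r add0r addr0 normc0 expr0n addr0.
  by rewrite expr1n mul1r lerDr sqr_ge0.
have := uB _ (fun b : bool => if b then t else 1%g) _ _ ler01 a1.
move=> /smxE/(_ (fun j => (~~ j)%:R)); rewrite !big_bool /= invg1 mulg1.
rewrite !(mulr0, mulr1, mul0r, addr0, add0r, normc0, normc1, expr1n, expr0n) /=.
rewrite ?(mulr0, mulr1, mul0r, addr0, add0r, normc0, normc1, expr1n, expr0n) /=.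
by rewrite sqrtr0 sqrtr1 expr0n expr1n add0r mulr1 hnorm_unsquare ?normc_ge0.
Qed.

Variables (u : G -> R[i]) (B : R).
Hypotheses (B0 : 0 <= B) (uB : schur_bd u B).

Lemma l1A_FTu f : l1A A f -> l1A A (mulF (FTu T u) f).
Proof.
apply: (@l1A_mulF _ (B * M)); first exact: mulr_ge0.
move=> t a k Aa k0 ak; split; first exact: FTu_mem.
have TM := cbbd_opbd hM M0 Aa k0 ak; rewrite -mulrA.
apply: opbd_le (opbdZ (u t) TM); rewrite ler_wpM2r ?mulr_ge0//.
exact: schur_bd_normc.
Qed.

Lemma fcoef_trep_FTu f r : l1A A f ->
  fcoef r (trep (mulF (FTu T u) f)) = u r *: T (fcoef r (trep f)).
Proof.
move=> lf; apply: (eq_trans (fcoef_trep AC A1 act r (l1A_FTu lf))).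
by rewrite (fcoef_trep AC A1 act r lf).
Qed.

Lemma HS_multiplier_FTu : HS_multiplier A alpha (FTu T u).
Proof.
apply: (@HS_multiplier_intro T u B (B * (M * 1)) cT).
- by rewrite !mulr_ge0.
- by move=> t; exact: schur_bd_normc.
- exact: l1A_FTu.
move=> n f lf f1; apply: (mxbd_FTu B0 uB _ _ _ ler01 f1).
- by move=> i j; exact: (CP_trep AC A1 act (lf i j)).
- by move=> i j; exact: (CP_trep AC A1 act (l1A_FTu (lf i j))).
- by move=> i j r; exact: fcoef_trep_FTu.
Qed.

Lemma opbd_FTu (X L : K -> K) C : CP X -> CP L ->
  (forall r, fcoef r L = u r *: T (fcoef r X)) -> 0 <= C -> opbd X C ->
  opbd L (B * (M * C)).
Proof.
move=> cX cL LE C0 XC; apply/mxbd_unit; first by rewrite !mulr_ge0.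
apply: (@mxbd_FTu u B unit (fun _ _ => X) (fun _ _ => L) C B0 uB).
- by move=> _ _; exact: cX.
- by move=> _ _; exact: cL.
- by move=> _ _; exact: LE.
- exact: C0.
- by apply/mxbd_unit.
Qed.

(** [L] is the limit of the images of [trep (f n)] for a sequence [trep (f n)] tending to [X]; the
    Schur estimate for differences makes these images Cauchy. Stated through coefficients, [L] does
    not depend on the sequence. *)
Lemma FTu_extension (X : K -> K) : CP X ->
  exists L, CP L /\ forall r, fcoef r L = u r *: T (fcoef r X).
Proof.
move=> cX; have [Tl TA _] := cT.
have fex n : exists f, l1A A f /\ opbd (X - trep f) n.+1%:R^-1.
  have n0 : 0 < n.+1%:R^-1 :> R by rewrite invr_gt0.
  by have [f lf h] := CP_approx AC A1 act cX n0; exists f.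
have [f hf] := choice fex; pose h n := trep (f n) : K -> K.
pose g n := trep (mulF (FTu T u) (f n)) : K -> K.
have ch n : CP (h n) by exact: (CP_trep AC A1 act (hf n).1).
have cg n : CP (g n) by exact: (CP_trep AC A1 act (l1A_FTu (hf n).1)).
have hX n : opbd (X - h n) n.+1%:R^-1 := (hf n).2.
have gh n r : fcoef r (g n) = u r *: T (fcoef r (h n)) := fcoef_trep_FTu r (hf n).1.
clearbody g h.
(* [B * M] is the Lipschitz constant of the map; the [+ 1] keeps the quotients meaningful when it
   vanishes. *)
have kp : 0 < B * M + 1 by rewrite ltr_wpDl// mulr_ge0.
have small (e : R) : 0 < e -> exists N, forall n, (N <= n)%N -> n.+1%:R^-1 < e / (B * M + 1).
  by move=> e0; apply: inv_succ_lt; rewrite divr_gt0.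
have kle (e : R) : 0 < e -> B * (M * (e / (B * M + 1))) <= e.
  move=> e0; rewrite mulrA [_ * (_ / _)]mulrA ler_pdivrMr// mulrC ler_pM2l//.
  by rewrite lerDl.
have gC m n C : 0 <= C -> opbd (h m - h n) C -> opbd (g m - g n) (B * (M * C)).
  move=> C0 hC.
  apply: (opbd_FTu (CP_B AC A1 act (ch m) (ch n)) (CP_B AC A1 act (cg m) (cg n)) _ C0 hC).
  move=> r.
  rewrite (fcoefB r (g m) (g n)) (fcoefB r (h m) (h n)) (gh m r) (gh n r).
  have cm := fcoef_mem AC A1 act r (ch m); have cn := fcoef_mem AC A1 act r (ch n).
  by rewrite (linear_onB Tl cm cn) scalerBr.
have [||L Ll hL] := @op_complete _ _ g.
- by move=> n; exact: (CP_linear (cg n)).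
- move=> e e0; have e2 : 0 < e / 2 by rewrite divr_gt0.
  have [N hN] := small _ e2; exists N => m n /hN/ltW hm /hN/ltW hn.
  have h1 := opbd_le hm (hX m); have h2 := opbd_le hn (hX n).
  have d0 : 0 <= e / (B * M + 1) by rewrite divr_ge0// ltW.
  apply: opbd_le (kle e e0) _; apply: (gC m n _ d0).
  have := opbdB h2 h1; rewrite -mulrDl -splitr; congr opbd.
  by rewrite opprB addrC addrA subrK.
have bL : bounded_op L.
  have [N hN] := hL 1 ltr01; have /bounded_opP[_ [k k0 kg]] := CP_bounded (cg N).
  apply/bounded_opP; split; first exact: Ll.
  exists (k + 1); first by rewrite addr_ge0.
  have -> : L = g N - (g N - L) by rewrite subKr.
  exact: opbdB kg (hN N (leqnn N)).
have cL : CP L.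
  apply: (CP_limit AC A1 act bL) => e e0; have [N hN] := hL e e0.
  by exists (g N); [exact: cg|exact: (opbdBC (hN N (leqnn N)))].
exists L; split; first exact: cL.
move=> r; apply/eqP; rewrite -subr_eq0; apply/eqP; apply: opbd_small => e e0.
have e2 : 0 < e / 2 by rewrite divr_gt0.
have [N1 hN1] := small _ e2; have [N2 hN2] := hL _ e2; pose n := maxn N1 N2.
have h1 := opbd_le (ltW (hN1 n (leq_maxl _ _))) (hX n).
have h2 := hN2 n (leq_maxr _ _).
have cXr := fcoef_mem AC A1 act r cX; have cn := fcoef_mem AC A1 act r (ch n).
have d0 : 0 <= e / 2 / (B * M + 1) by rewrite divr_ge0// ltW.
have h3 : opbd (fcoef r X - fcoef r (h n)) (e / 2 / (B * M + 1)).
  exact: (entry_opbd 1%g r^-1%g h1).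
have h4 := opbdZ (u r) (cbbd_opbd hM M0 (cstarB AC cXr cn) d0 h3).
have h5 : opbd (fcoef r (g n) - fcoef r L) (e / 2) by exact: (entry_opbd 1%g r^-1%g h2).
have := opbdN (opbdD h5 h4).
have le1 : e / 2 + normc (u r) * (M * (e / 2 / (B * M + 1))) <= e.
  rewrite [leRHS]splitr lerD2l; apply: le_trans (kle _ e2).
  apply: ler_wpM2r; first exact: mulr_ge0 M0 d0.
  exact: schur_bd_normc.
move=> /(opbd_le le1); congr opbd.
rewrite (gh n r) (linear_onB Tl cXr cn) scalerBr.
by rewrite addrC addrA subrK opprB.
Qed.

(** The pointwise chosen extensions form a linear map because Fourier coefficients determine an
    element. The Schur estimate makes it completely bounded, so [HS_mapP] applies. *)
Lemma HS_map_FTu : cb_map CP CP (HS_map A alpha (FTu T u)) /\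
  forall X r, CP X -> fcoef r (HS_map A alpha (FTu T u) X) = u r *: T (fcoef r X).
Proof.
have Sex X : exists L, CP X -> CP L /\ forall r, fcoef r L = u r *: T (fcoef r X).
  have [cX|nX] := pselect (CP X); last by exists 0.
  by have [L hL] := FTu_extension cX; exists L.
have [S hS] := choice Sex; have [Tl _ _] := cT.
have cS : cb_map CP CP S.
  split.
  - move=> c X Y cX cY; have cXY := CP_P AC A1 act c cX cY.
    apply: (CP_ext AC A1 act (hS _ cXY).1 (CP_P AC A1 act c (hS _ cX).1 (hS _ cY).1)) => r.
    rewrite (hS _ cXY).2 !fcoefP (hS _ cX).2 (hS _ cY).2.
    have mX := fcoef_mem AC A1 act r cX; have mY := fcoef_mem AC A1 act r cY.
    by rewrite (Tl c _ _ mX mY) scalerDr !scalerA mulrC.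
  - by move=> X cX; exact: (hS X cX).1.
  apply: le_lt_trans (ltry (B * M)); apply: cbbd_op_cbnorm.
  - by move=> X cX; exact: (CP_linear cX).
  - exact: mulr_ge0.
  move=> I x cx C C0 xC; rewrite -mulrA; apply: (mxbd_FTu B0 uB cx _ _ C0 xC).
  - by move=> i j; exact: (hS _ (cx i j)).1.
  - by move=> i j r; exact: (hS _ (cx i j)).2.
have [c1 c2] := HS_mapP AC A1 act cS (F := FTu T u)
  (fun f lf => CP_ext AC A1 act (hS _ (CP_trep AC A1 act lf)).1
    (CP_trep AC A1 act (l1A_FTu lf)) (fun r => eq_trans ((hS _ (CP_trep AC A1 act lf)).2 r)
      (esym (fcoef_trep_FTu r lf)))).
split; first exact: c1.
by move=> X r cX; rewrite (c2 X cX) (hS X cX).2.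
Qed.

End SchurTimesInvariant.

(** * Multipliers with finitely supported v and an arbitrary completely bounded T *)

Section FinitelySupported.
Variables (T : (H -> H) -> H -> H) (M : R) (v : G -> R[i]) (D : {fset G}).
Hypotheses (cT : cb_map A A T) (M0 : 0 <= M) (hM : cbbd A T M).
Hypothesis vD : forall r, r \notin D -> v r = 0.

(** Each coefficient is read off, transformed by [T] and put back as [pi(.) lambda_r]. This gives
    S_F for [F = FTu T v] also when [T] does not commute with the action, as may happen for finite
    rank approximants. *)
Definition fin_multiplier (X : K -> K) : K -> K :=
  \sum_(r <- D) v r *: pilam r (T (fcoef r X)).

Local Notation N := (\sum_(r <- D) normc (v r)).

Let TA a : A a -> A (T a).
Proof. by have [_ + _] := cT; apply. Qed.

Let Tl : linear_on A T.
Proof. by case: cT. Qed.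

Lemma fin_multiplier_CP X : CP X -> CP (fin_multiplier X).
Proof.
move=> cX; apply: (CP_sum AC A1 act) => r; apply: (CP_Z AC A1 act).
by apply: (CP_pilam AC A1 act); apply: TA; exact: (fcoef_mem AC A1 act).
Qed.

Lemma fcoef_sum (S : Type) (s : seq S) (F : S -> K -> K) r :
  fcoef r (\sum_(i <- s) F i) = \sum_(i <- s) fcoef r (F i).
Proof. exact: entry_sum. Qed.

Lemma fcoefZ (c : R[i]) (X : K -> K) r : fcoef r (c *: X) = c *: fcoef r X.
Proof. by []. Qed.

Lemma fcoef_fin_multiplier X r : CP X ->
  fcoef r (fin_multiplier X) = v r *: T (fcoef r X).
Proof.
move=> cX; have AT s := TA (fcoef_mem AC A1 act s cX).
rewrite /fin_multiplier fcoef_sum (@fsum_single _ _ _ r) => [|s /negbTE sr].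
  case: ifPn => [_|/vD ->]; last by rewrite scale0r.
  by rewrite fcoefZ (fcoef_pilam AC A1 act _ _ (AT r)) eqxx.
by rewrite fcoefZ (fcoef_pilam AC A1 act _ _ (AT s)) eq_sym sr scaler0.
Qed.

Let N0 : 0 <= N.
Proof. by apply: sumr_ge0 => r _; exact: normc_ge0. Qed.

Lemma mxbd_pilam_sum (I : finType) (y : G -> I -> I -> H -> H) C : 0 <= C ->
  (forall r i j, A (y r i j)) -> (forall r, mxbd (y r) C) ->
  mxbd (fun i j => \sum_(r <- D) v r *: pilam r (y r i j) : K -> K) (N * C).
Proof.
move=> C0 Ay yC; rewrite mulr_suml; apply: mxbd_sum => r.
  by rewrite mulr_ge0// normc_ge0.
by apply: mxbdZ; exact: (mxbd_pilam AC A1 act r (Ay r) C0 (yC r)).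
Qed.

(** Taking the [r]-th coefficient and forming [pi(a) lambda_r] are completely contractive, so the
    term at [r] costs [|v r| M]. *)
Lemma fin_multiplier_cbbd : cbbd CP fin_multiplier (N * M).
Proof.
move=> I x cx C C0 xC; rewrite -mulrA.
have AX r i j := fcoef_mem AC A1 act r (cx i j).
apply: (@mxbd_pilam_sum I (fun r i j => T (fcoef r (x i j)))).
- exact: mulr_ge0.
- by move=> r i j; exact: TA.
by move=> r; exact: (hM (AX r) C0 (mxbd_coord _ _ xC)).
Qed.

Lemma fin_multiplier_cb : cb_map CP CP fin_multiplier.
Proof.
split.
- move=> c X Y cX cY; have cXY := CP_P AC A1 act c cX cY.
  apply: (CP_ext AC A1 act (fin_multiplier_CP cXY)
    (CP_P AC A1 act c (fin_multiplier_CP cX) (fin_multiplier_CP cY))) => r.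
  rewrite (fcoef_fin_multiplier r cXY) !fcoefP (fcoef_fin_multiplier r cX).
  rewrite (fcoef_fin_multiplier r cY).
  rewrite (Tl c (fcoef_mem AC A1 act r cX) (fcoef_mem AC A1 act r cY)).
  by rewrite scalerDr !scalerA mulrC.
- exact: fin_multiplier_CP.
apply: le_lt_trans (ltry (N * M)); apply: cbbd_op_cbnorm.
- by move=> X cX; exact: (CP_linear cX).
- exact: mulr_ge0.
- exact: fin_multiplier_cbbd.
Qed.

Let FA f t : l1A A f -> A (mulF (FTu T v) f t).
Proof. by move=> [Af _]; apply: (cstarZ AC); exact/TA. Qed.

Let F0 f t : t \notin D -> mulF (FTu T v) f t = 0.
Proof. by move=> /vD h; rewrite /mulF /FTu h scale0r. Qed.

Lemma l1A_fin_multiplier f : l1A A f -> l1A A (mulF (FTu T v) f).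
Proof.
by move=> lf; exact: (l1A_fin AC (fun t => FA t lf) (fun t => @F0 f t)).
Qed.

Lemma trep_fin_multiplier f : l1A A f ->
  fin_multiplier (trep f) = trep (mulF (FTu T v) f).
Proof.
move=> lf; have ct := CP_trep AC A1 act lf; have lF := l1A_fin_multiplier lf.
apply: (CP_ext AC A1 act (fin_multiplier_CP ct) (CP_trep AC A1 act lF)) => r.
apply: (eq_trans _ (esym (fcoef_trep AC A1 act r lF))).
apply: (eq_trans (fcoef_fin_multiplier r ct)).
by rewrite (fcoef_trep AC A1 act r lf).
Qed.

Lemma HS_multiplier_fin : HS_multiplier A alpha (FTu T v).
Proof.
apply: (@HS_multiplier_intro T v N (N * M * 1) cT).
- by rewrite mulr1 mulr_ge0.
- move=> t; have [tD|/vD ->] := boolP (t \in D); last by rewrite normc0.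
  rewrite (bigD1_seq t) ?fset_uniq//= lerDl sumr_ge0// => r _.
  exact: normc_ge0.
- exact: l1A_fin_multiplier.
move=> n f lf f1.
have := fin_multiplier_cbbd (fun i j => CP_trep AC A1 act (lf i j)) ler01 f1.
congr mxbd; apply/funext => i; apply/funext => j.
exact: trep_fin_multiplier.
Qed.

Lemma HS_map_fin : cb_map CP CP (HS_map A alpha (FTu T v)) /\
  forall X, CP X -> HS_map A alpha (FTu T v) X = fin_multiplier X.
Proof. exact: (HS_mapP AC A1 act fin_multiplier_cb trep_fin_multiplier). Qed.

Section FiniteDimensionalRange.
Variables (E : finType) (b : E -> H -> H).
Hypothesis Ab : forall k, A (b k).

(** The operators [pi(b_k) lambda_r] with [r] in [D]; they span the range of [fin_multiplier]
    whenever the values of [T] on [A] lie in the span of [b]. *)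
Definition pilam_basis (p : E * D) : K -> K := pilam (val p.2) (b p.1).

Lemma pilam_basis_CP : lspan (range pilam_basis) `<=` CP.
Proof.
move=> _ /lspan_rangeP[c ->]; apply: (CP_sum AC A1 act) => p.
by apply: (CP_Z AC A1 act); apply: (CP_pilam AC A1 act).
Qed.

Lemma pilam_sum_mem (y : G -> H -> H) : (forall r, lspan (range b) (y r)) ->
  lspan (range pilam_basis) (\sum_(r <- D) v r *: pilam r (y r)).
Proof.
move=> hy; have ex r : exists c : E -> R[i], y r = \sum_k c k *: b k by exact/lspan_rangeP.
have [c hc] := choice ex.
apply/lspan_rangeP; exists (fun p => v (val p.2) * c (val p.2) p.1).
rewrite sum_pair exchange_big /= big_seq_fsetE /=; apply: eq_bigr => r _.
have pl := @pilam_linear_on _ _ _ _ _ AC A1 act (val r).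
rewrite hc (linear_on_sum AC pl) => [|k]; last exact: (cstarZ AC).
rewrite scaler_sumr; apply: eq_bigr => k _.
by rewrite (linear_onZ AC pl)// scalerA.
Qed.

End FiniteDimensionalRange.

End FinitelySupported.

(** The difference has coefficients [(u - v)(r) T(a_r)]. Since [T] is invariant, the Schur estimate
    for [u - v] applies, and its constant [d] does not grow with the support of [v]. *)
Lemma HS_map_FTu_approx T M u B v (D : {fset G}) d (I : finType)
    (x : I -> I -> K -> K) : cb_map A A T -> alpha_invariant A alpha T ->
  0 <= M -> cbbd A T M -> 0 <= B -> schur_bd u B -> 0 <= d ->
  schur_bd (fun s => u s - v s) d -> (forall r, r \notin D -> v r = 0) ->
  (forall i j, CP (x i j)) -> forall C, 0 <= C -> mxbd x C ->
  mxbd (fun i j => HS_map A alpha (FTu T u) (x i j) - fin_multiplier T v D (x i j))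
    (d * (M * C)).
Proof.
move=> cT iT M0 hM B0 uB d0 uv vD cx C C0 xC.
have [[_ c1 _] c2] := HS_map_FTu cT iT M0 hM B0 uB.
apply: (mxbd_FTu cT iT M0 hM d0 uv cx _ _ C0 xC).
- move=> i j; apply: (CP_B AC A1 act); first exact: (c1 _ (cx i j)).
  exact: (fin_multiplier_CP v D cT (cx i j)).
move=> i j r; rewrite fcoefB (c2 _ r (cx i j)).
by rewrite (fcoef_fin_multiplier cT vD r (cx i j)) scalerBl.
Qed.

Lemma half_fraction_lt (e M : R) : 0 < e -> 0 <= M -> e / 2 / (M + 1) * M < e / 2.
Proof.
move=> e0 M0; have p : 0 < M + 1 by rewrite ltr_wpDl.
by rewrite mulrAC ltr_pdivrMr// ltr_pM2l ?divr_gt0// ltrDl.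
Qed.

Lemma HS_inv_FTu T u : McbA u -> cb_map A A T -> alpha_invariant A alpha T ->
  HS_inv A alpha (FTu T u).
Proof.
move=> uM cT iT; have [M M0 hM] := cb_map_alg_cbbd cT.
have [B B0 uB] := schur_bd_McbA uM; split.
  exact: (HS_multiplier_FTu cT iT M0 hM B0 uB).
move=> s t a Aa; have [_ TA _] := cT.
by rewrite /FTu (linear_onZ AC (alpha_linear act t) _ (TA _ Aa)) iT.
Qed.

(** The subspace is spanned by the [pi(b_k) lambda_r] with [r] in [D], where [b] spans a subspace
    that serves for [T] at a finer tolerance. One half of [e] pays for replacing [u] by [v], the
    other for approximating the finitely many coefficients. *)
Lemma HS_map_FTu_cc T u : McbA u -> alpha_invariant A alpha T -> AcbG u ->
  completely_compact A A T ->
  completely_compact CP CP (HS_map A alpha (FTu T u)).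
Proof.
move=> uM iT uA [cT ccT]; have [M M0 hM] := cb_map_alg_cbbd cT.
have [B B0 uB] := schur_bd_McbA uM; have [Tl TA _] := cT.
split; first exact: (HS_map_FTu cT iT M0 hM B0 uB).1.
move=> e e0; have e2 : 0 < e / 2 by rewrite divr_gt0.
have dp : 0 < e / 2 / (M + 1) by rewrite divr_gt0// ltr_wpDl.
have [v [D [vD uv]]] := Acb_approx uA dp.
pose N := \sum_(r <- D) normc (v r).
have N0 : 0 <= N by apply: sumr_ge0 => r _; exact: normc_ge0.
(* An error in the coefficients is multiplied by at most [N] when they are reassembled, and
   [N e / (2 (N + 1)) < e / 2]. *)
have ep : 0 < e / 2 / (N + 1) by rewrite divr_gt0// ltr_wpDl.
have [Y0 [[m [b Y0E]] YA hY]] := ccT _ ep.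
have Ab k : A (b k).
  apply: YA; rewrite Y0E; exists 1%N, (fun=> 1), (fun=> b k); split.
    by move=> _; exists k.
  by rewrite big_ord1 scale1r.
exists (lspan (range (pilam_basis (D := D) b))); split.
- exact: finite_dim_range.
- exact: (pilam_basis_CP Ab).
move=> n x cx x1.
have xl : mxlin x by move=> i j; exact: (CP_linear (cx i j)).
have xb := mxnorm_mxbd xl ler01 x1.
have Ax r i j := fcoef_mem AC A1 act r (cx i j).
(* Taking coefficients is completely contractive, so the matrix of [r]-th coefficients lies in the
   unit ball, where compactness of [T] can be used. *)
have yex r : exists y : 'I_n -> 'I_n -> H -> H, mx_over Y0 y /\
    mxbd (fun i j => T (fcoef r (x i j)) - y i j) (e / 2 / (N + 1)).
  have := hY n (fun i j => fcoef r (x i j)) (Ax r).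
  have h1 : (mxnorm (fun i j => fcoef r (x i j)) <= 1%:E)%E.
    by apply: mxbd_mxnorm ler01 _; exact: mxbd_coord.
  move=> /(_ h1); rewrite /mxdist => /ereal_inf_lt[_ [y Yy <-] hy].
  exists y; split; first exact: Yy.
  apply: mxnorm_mxbd (ltW ep) (ltW hy) => i j.
  apply: linear_fctB; first by apply: (cstar_linear AC); exact: TA.
  by apply: (cstar_linear AC); apply: YA; exact: Yy.
have [y hy] := choice yex.
pose z i j : K -> K := \sum_(r <- D) v r *: pilam r (y r i j).
have zY : mx_over (lspan (range (pilam_basis (D := D) b))) z.
  move=> i j; have hyY r : lspan (range b) (y r i j) by rewrite -Y0E; exact: (hy r).1.
  exact: (pilam_sum_mem v D Ab hyY).
apply: (@le_lt_trans _ _ (mxnorm (fun i j => HS_map A alpha (FTu T u) (x i j) - z i j))).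
  by apply: ereal_inf_lbound; exists z.
have Ad r i j : A (T (fcoef r (x i j)) - y r i j).
  by apply: (cstarB AC); [exact: TA|apply: YA; exact: (hy r).1].
have h1 := HS_map_FTu_approx cT iT M0 hM B0 uB (ltW dp) uv vD cx ler01 xb.
have h2 := @mxbd_pilam_sum v D _ (fun r i j => T (fcoef r (x i j)) - y r i j)
  _ (ltW ep) Ad (fun r => (hy r).2).
have k1 : 0 <= e / 2 / (M + 1) * (M * 1) by rewrite mulr1 mulr_ge0 ?(ltW dp).
have k2 : 0 <= N * (e / 2 / (N + 1)) by rewrite mulr_ge0 ?(ltW ep).
have h3 := mxbdD k1 k2 h1 h2.
apply: (@le_lt_trans _ _ (e / 2 / (M + 1) * (M * 1) + N * (e / 2 / (N + 1)))%:E).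
  apply: mxbd_mxnorm; first exact: addr_ge0.
  move: h3; congr mxbd; apply/funext => i; apply/funext => j.
  have -> : \sum_(r <- D) v r *: pilam r (T (fcoef r (x i j)) - y r i j) =
      fin_multiplier T v D (x i j) - z i j.
    rewrite /fin_multiplier /z -sumrB; apply: eq_bigr => r _.
    rewrite (linear_onB (@pilam_linear_on _ _ _ _ _ AC A1 act r)).
    - exact: scalerBr.
    - exact: TA.
    - by apply: YA; exact: (hy r).1.
  by rewrite addrA subrK.
rewrite lte_fin mulr1 [N * _]mulrC [ltRHS]splitr.
by apply: ltrD; exact: half_fraction_lt.
Qed.

(** The difference splits into the multiplier of [(T, u - v)], controlled by the Schur norm because
    [T] is invariant, and that of [(T - T', v)], controlled coefficient by coefficient through
    [N]. *)
Lemma HS_map_FTu_finite_rank T u : McbA u -> cb_map A A T ->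
  alpha_invariant A alpha T -> AcbG u ->
  (forall e : R, 0 < e -> exists2 T', finite_rank A A T' &
     (op_cbnorm A (T - T')%R < e%:E)%E) ->
  forall e : R, 0 < e -> exists F,
    [/\ HS_multiplier A alpha F, finite_rank CP CP (HS_map A alpha F) &
        (op_cbnorm CP (HS_map A alpha (FTu T u) - HS_map A alpha F)%R < e%:E)%E].
Proof.
move=> uM cT iT uA hT e e0; have [M M0 hM] := cb_map_alg_cbbd cT.
have [B B0 uB] := schur_bd_McbA uM; have [Tl TA _] := cT.
have e2 : 0 < e / 2 by rewrite divr_gt0.
have dp : 0 < e / 2 / (M + 1) by rewrite divr_gt0// ltr_wpDl.
have [v [D [vD uv]]] := Acb_approx uA dp.
pose N := \sum_(r <- D) normc (v r).
have N0 : 0 <= N by apply: sumr_ge0 => r _; exact: normc_ge0.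
have ep : 0 < e / 2 / (N + 1) by rewrite divr_gt0// ltr_wpDl.
have [T' [cT' [Y0 [m [b Y0E]] T'Y]] TT'] := hT _ ep.
have [Tl' TA' _] := cT'; have [M' M'0 hM'] := cb_map_alg_cbbd cT'.
have [c1 c2] := HS_map_fin cT' M'0 hM' vD.
have hTT : cbbd A (T - T') (e / 2 / (N + 1)).
  apply: op_cbnorm_cbbd.
  - exact: cstar_linear.
  - exact: cstarZ.
  - move=> c a Aa; transitivity (T (c *: a) - T' (c *: a)); first by [].
    by rewrite (linear_onZ AC Tl c Aa) (linear_onZ AC Tl' c Aa) -scalerBr.
  - move=> a Aa; apply: linear_fctB; apply: (cstar_linear AC); first exact: TA.
    exact: TA'.
  - exact: ltW.
  - exact: ltW.
exists (FTu T' v); split.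
- exact: (HS_multiplier_fin cT' M'0 hM' vD).
- split; first exact: c1.
  (* The subspace witnessing finite rank need not lie in [A], whereas [pilam] is controlled on [A];
     a spanning family is therefore taken inside the image of [A] under [T']. *)
  have [|||E [b' [hb' hE]]] := @subspace_finite_basis _ _ m b [set T' a | a in A].
  + by exists 0; [exact: (cstar0 AC)|exact: (linear_on0 AC Tl')].
  + move=> c _ _ [x Ax <-] [y Ay <-]; exists (c *: x + y); first exact: (cstarP AC).
    exact: Tl'.
  + move=> _ [a Aa <-]; apply/lspan_rangeP; rewrite -Y0E.
    exact: T'Y.
  have Ab' k : A (b' k) by have [a Aa <-] := hb' k; exact: TA'.
  exists (lspan (range (pilam_basis (D := D) b'))); first exact: finite_dim_range.
  move=> X cX; rewrite (c2 X cX); apply: (pilam_sum_mem v D Ab') => r.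
  apply/lspan_rangeP; apply: hE; exists (fcoef r X); last by [].
  exact: (fcoef_mem AC A1 act r cX).
have k1 : 0 <= e / 2 / (M + 1) * M by rewrite mulr_ge0// ltW.
have k2 : 0 <= N * (e / 2 / (N + 1)) by rewrite mulr_ge0// ltW.
apply: (@le_lt_trans _ _ (e / 2 / (M + 1) * M + N * (e / 2 / (N + 1)))%:E); last first.
  rewrite lte_fin [N * _]mulrC [ltRHS]splitr.
  by apply: ltrD; exact: half_fraction_lt.
apply: cbbd_op_cbnorm.
- by move=> X cX; exact: (CP_linear cX).
- exact: addr_ge0.
move=> I x cx C C0 xC.
have Ax r i j := fcoef_mem AC A1 act r (cx i j).
have h1 := HS_map_FTu_approx cT iT M0 hM B0 uB (ltW dp) uv vD cx C0 xC.
have h2 := @mxbd_pilam_sum v D _ (fun r i j => (T - T') (fcoef r (x i j)))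
  _ (mulr_ge0 (ltW ep) C0) (fun r i j => cstarB AC (TA _ (Ax r i j)) (TA' _ (Ax r i j)))
  (fun r => hTT _ _ (Ax r) _ C0 (mxbd_coord _ _ xC)).
rewrite mulrDl -!mulrA in h1 h2 *.
have := mxbdD _ _ h1 h2; rewrite !mulrA in k1 k2 *.
move=> /(_ (mulr_ge0 k1 C0) (mulr_ge0 k2 C0)); congr mxbd.
apply/funext => i; apply/funext => j.
transitivity (HS_map A alpha (FTu T u) (x i j) - HS_map A alpha (FTu T' v) (x i j));
  last by [].
rewrite (c2 _ (cx i j)).
have -> : \sum_(r <- D) v r *: pilam r ((T - T') (fcoef r (x i j))) =
    fin_multiplier T v D (x i j) - fin_multiplier T' v D (x i j).
  rewrite /fin_multiplier -sumrB; apply: eq_bigr => r _.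
  apply: (eq_trans _ (scalerBr _ _ _)); congr (_ *: _).
  exact: (linear_onB (@pilam_linear_on _ _ _ _ _ AC A1 act r) (TA _ (Ax r i j))
    (TA' _ (Ax r i j))).
by rewrite addrA subrK.
Qed.


End Multipliers.

Theorem theorem4p1 (R : realType) (G : groupType) (H : hilbertType R)
    (A : set (H -> H)) (one : H -> H) (alpha : G -> (H -> H) -> H -> H)
    (u : G -> R[i]) (T : (H -> H) -> H -> H) :
  cstar_algebra A -> nondegenerate_on A -> unit_of A one ->
  action_on A alpha -> amenable_action A alpha one ->
  McbA u -> cb_map A A T -> alpha_invariant A alpha T ->
  [/\ HS_inv A alpha (FTu T u),
      AcbG u -> completely_compact A A T -> HS_inv_cc A alpha (FTu T u) &
      AcbG u ->
      (forall e : R, 0 < e -> exists2 T', finite_rank A A T' &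
         (op_cbnorm A (T - T')%R < e%:E)%E) ->
      forall e : R, 0 < e -> exists F,
        [/\ HS_multiplier A alpha F,
            finite_rank (crossed_product A alpha) (crossed_product A alpha)
              (HS_map A alpha F) &
            (op_cbnorm (crossed_product A alpha)
               (HS_map A alpha (FTu T u) - HS_map A alpha F)%R < e%:E)%E]].
Proof.
move=> AC nd unit act _ uM cT iT.
have A1 : A idfun by rewrite -(unit_of_idfun AC nd unit); exact: unit.1.
split.
- exact: (HS_inv_FTu AC A1 act uM cT iT).
- move=> uA ccT; split; first exact: (HS_inv_FTu AC A1 act uM cT iT).
  exact: (HS_map_FTu_cc AC A1 act uM iT uA ccT).
- by move=> uA hT; exact: (HS_map_FTu_finite_rank AC A1 act uM cT iT uA hT).
Qed.
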